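(* If $(A_n,L_n)_{n\in\mathbb N}$ is a sequence of quantum compact metric spaces converging for the propinquity to a quantum compact metric space $(A,L)$, and if $\mu\in S(A)$, then there exists $\mu_n\in S(A_n)$ for all $n\in\mathbb N$ such that $$\lim_{n\to\infty}\ \sup_{M\ge1}\ \eth_M\bigl((A_n,L_n,\mathbb C1_{A_n},\mu_n),(A,L,\mathbb C1_A,\mu)\bigr)=0,$$ and in particular $$\lim_{n\to\infty}\mathsf D\bigl((A_n,L_n,\mathbb C1_{A_n},\mu_n),(A,L,\mathbb C1_A,\mu)\bigr)=0 .$$
   Context: **Basics.** For a C*-algebra $A$: $\mathrm{sa}(A)$ is its self-adjoint part, $S(A)$ its state space, $Q(A)$ the set of positive linear functionals of norm at most $1$; $\mathfrak uA=A$ if $A$ is unital and otherwise $\mathfrak uA=A\oplus\mathbb C$ is the minimal unitization; $1_A$ is the unit of $\mathfrak uA$. An element $h\in\mathrm{sa}(A)$ is strictly positive when $\varphi(h)>0$ for all $\varphi\in S(A)$. A seminorm $L$ on a subspace $\mathrm{dom}(L)\subseteq A$ is hermitian when $a\in\mathrm{dom}(L)$ implies $a^*\in\mathrm{dom}(L)$ and $L(a^* )=L(a)$; then $\mathrm{dom}_{sa}(L)=\mathrm{dom}(L)\cap\mathrm{sa}(A)$. It is a norm modulo constants when it is a norm if $A$ has no unit, and $\{a:L(a)=0\}=\mathbb C1_A$ if $A$ is unital. It is Leibniz when $\mathrm{dom}(L)$ is a subalgebra and $L(ab)\le\|a\|L(b)+L(a)\|b\|$. For $M\ge1$, $\|a\|_{L,M}=\max\{\frac1M\|a\|_A,L(a)\}$.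 For positive linear functionals $\varphi,\psi$, $\mathsf{bl}_{L,M}(\varphi,\psi)=\sup\{|\varphi(a)-\psi(a)|:a\in\mathrm{dom}_{sa}(L),\|a\|_{L,M}\le1\}$, and $\mathsf{bl}_L=\mathsf{bl}_{L,1}$. For states, $\mathsf{mk}_L(\varphi,\psi)=\sup\{|\varphi(a)-\psi(a)|:a\in\mathrm{dom}_{sa}(L),L(a)\le1\}\in[0,\infty]$, and $\mathrm{qdiam}(A,L)=\sup_{\varphi,\psi\in S(A)}\mathsf{mk}_L(\varphi,\psi)$. **Quantum compact metric spaces and propinquity.** A quantum compact metric space $(A,L)$ is a unital C*-algebra $A$ with a hermitian, Leibniz norm modulo constants $L$ on a dense *-subalgebra $\mathrm{dom}(L)$ such that $\{a\in\mathrm{dom}_{sa}(L):L(a)\le1\}$ is norm closed and $\mathsf{mk}_L$ metrizes the weak* topology of $S(A)$. For any $\mu\in S(A)$, $(A,L,\mathbb C1_A,\mu)$ is a pointed proper quantum metric space (defined below). A quantum isometry $\pi:(D,L_D)\to(A,L_A)$ of quantum compact metric spaces is a *-epimorphism with $L_A(a)=\inf\{L_D(d):d\in\mathrm{dom}_{sa}(L_D),\pi(d)=a\}$ for $a\in\mathrm{dom}_{sa}(L_A)$. A compact tunnel $(D,L_D,\pi,\rho)$ from $(A,L_A)$ to $(B,L_B)$ is a quantum compact metric space $(D,L_D)$ with quantum isometries $\pi$ onto $(A,L_A)$, $\rho$ onto $(B,L_B)$; its extent is the maximum of the Hausdorff distances, for $\mathsf{mk}_{L_D}$, between $S(D)$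 and $\pi^*(S(A))$ and between $S(D)$ and $\rho^*(S(B))$. The propinquity between $(A,L_A)$ and $(B,L_B)$ is the infimum of the extents of compact tunnels from $(A,L_A)$ to $(B,L_B)$. **Locally compact spaces.** A separable quantum locally compact metric space (sqlcms) $(A,L)$ is a separable C*-algebra $A$ with a Leibniz hermitian norm modulo constants $L$ on a dense *-subalgebra $\mathrm{dom}(L)$ of $A$ such that: (i) $\mathsf{bl}_L$ induces the weak* topology on $S(A)$; (ii) $\{a\in\mathrm{dom}_{sa}(L):L(a)\le1\}$ is norm closed in $\mathrm{sa}(A)$; (iii) there are a strictly positive $h\in\mathrm{sa}(A)$ and $\mu\in S(A)$ with $\mu(h)=1$ such that $\{hah\in\mathfrak uA:a=b+t1_A,\ t\in\mathbb R,\ b\in\mathrm{dom}_{sa}(L),\ L(b)\le1,\ \mu(b)=-t\}$ is bounded. A pin of $(A,L)$ is a state $\mu$ such that $\{\varphi\in S(A):\mathsf{mk}_L(\varphi,\mu)<\infty\}$ is weak* dense in $S(A)$; then $(A,L,\mu)$ is called pinned. An $L$-Lipschitz $\mu$-pinned exhaustive sequence is a sequence $(h_n)$ in $\mathrm{dom}_{sa}(L)$ with $L(h_n)\to0$, $\mu(h_n)\to1$, $\|h_n\|_A\to1$. A topography of $(A,L)$ is an Abelian C*-subalgebra $\mathfrak M$ of $A$ containing some $h\in\mathrm{dom}(L)$ strictly positive in $A$ such that $\{hah\in\mathfrak uA:a=b+t1_A,\ t\in\mathbb R,\ b\in\mathrm{dom}_{sa}(L),\ L(b)\le1,\ \mu(b)=-t\}$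 is bounded for some state $\mu$ of $A$ restricting to a character of $\mathfrak M$; $(A,L,\mathfrak M)$ is then a topographic sqlcms. A pointed proper quantum metric space $(A,L,\mathfrak M,\mu)$ is a pinned sqlcms $(A,L,\mu)$ with a topography $\mathfrak M$ such that $\mu$ restricts to a character of $\mathfrak M$ and there is an $L$-Lipschitz $\mu$-pinned exhaustive sequence contained in $\mathfrak M$. **Isometries.** A quantum $M$-isometry $\pi:(D,L_D)\to(A,L_A)$ between sqlcms is a surjective *-morphism, proper (mapping an approximate unit to an approximate unit), with $\pi(\mathrm{dom}(L_D))=\mathrm{dom}(L_A)$, $\|a\|_{L_A,M}=\inf\{\|d\|_{L_D,M}:d\in\mathrm{dom}_{sa}(L_D),\pi(d)=a\}$ for all $a\in\mathrm{dom}_{sa}(L_A)$, and $L_A(\pi(d))\le L_D(d)$ for all $d\in\mathrm{dom}_{sa}(L_D)$. It is topographic from $(D,L_D,\mathfrak M_D)$ to $(A,L_A,\mathfrak M_A)$ when $\pi(\mathfrak M_D)\subseteq\mathfrak M_A$ and for all $a\in\mathrm{dom}_{sa}(L_A)\cap\mathfrak M_A$, $\varepsilon>0$ there is $d\in\mathfrak M_D\cap\mathrm{dom}_{sa}(L_D)$ with $\pi(d)=a$, $\|d\|_D\le e^\varepsilon\|a\|_A$, $L_D(d)\le e^{\varepsilon}L_A(a)$. **Tunnels.** An $M$-tunnel $\tau=(D,L_D,\mathfrak M_D,\pi_A,\pi_B,e)$ from $(A,L_A,\mathfrak M_A,\mu_A)$ to $(B,L_B,\mathfrak M_B,\mu_B)$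 consists of a topographic sqlcms $(D,L_D,\mathfrak M_D)$, an element $e\in\mathrm{dom}_{sa}(L_D)\cap\mathfrak M_D$, and topographic quantum $M$-isometries $\pi_A:(D,L_D,\mathfrak M_D)\to(A,L_A,\mathfrak M_A)$, $\pi_B:(D,L_D,\mathfrak M_D)\to(B,L_B,\mathfrak M_B)$, such that $\mu_A\circ\pi_A$ is a pin of $(D,L_D)$. Write $eQ(D)e=\{\varphi(e\cdot e):\varphi\in Q(D)\}$, $\pi^*(\varphi)=\varphi\circ\pi$, and $X\subseteq_\varepsilon^{d}Y$ when every $x\in X$ satisfies $\inf_{y\in Y}d(x,y)\le\varepsilon$. The extent $\chi(\tau)$ is the maximum of: $\inf\{\varepsilon>0:eQ(D)e\subseteq_\varepsilon^{\mathsf{bl}_{L_D,M}}\pi_A^*(Q(A))\text{ and }eQ(D)e\subseteq_\varepsilon^{\mathsf{bl}_{L_D,M}}\pi_B^*(Q(B))\}$; $\mathsf{mk}_{L_D}(\mu_A\circ\pi_A,\mu_B\circ\pi_B)$; and $\max\{2M L_D(e),|1-\mu_A(\pi_A(e))|,|1-\mu_B(\pi_B(e))|\}$. The $M$-local quantum metametric is $\eth_M(\mathbb A,\mathbb B)=\inf\{\chi(\tau):\tau\text{ an }M\text{-tunnel from }\mathbb A\text{ to }\mathbb B\}$. **Quantum metametric.** With $e^{-\infty}=0$ and $\sup\emptyset=0$, $$\mathsf D(\mathbb A,\mathbb B)=\max\Bigl\{\inf\bigl\{\varepsilon>0:\sup_{r\in[1,1/\varepsilon]}\eth_r(\mathbb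 A,\mathbb B)<\varepsilon\bigr\},\ \bigl|e^{-\mathrm{qdiam}(A,L_A)}-e^{-\mathrm{qdiam}(B,L_B)}\bigr|\Bigr\}.$$
   Formalization: A quantum isometry of quantum compact metric spaces is also required to map dom_sa(L_D) into dom(L_A) (convention L = ∞ off its domain); without this, the propinquity can vanish between spaces of different diameters and the claim fails. *)

(* Defs.v *)
From HB Require Import structures.
From mathcomp Require Import all_boot all_order all_algebra.
From mathcomp Require Import complex.
From mathcomp Require Import all_classical all_reals all_analysis.
Set Implicit Arguments.
Unset Strict Implicit.
Unset Printing Implicit Defensive.
Import Order.TTheory GRing.Theory Num.Theory.
Import numFieldNormedType.Exports.
Local Open Scope classical_set_scope.
Local Open Scope ring_scope.

(* Possibly non-unital complex C*-algebras. *)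
HB.mixin Record isCStarAlgebra (R : realType) A
    of CompleteNormedModule R[i] A := {
  cmul : A -> A -> A;
  cstar : A -> A;
  cmulA : associative cmul;
  cmulDl : left_distributive cmul +%R;
  cmulDr : right_distributive cmul +%R;
  cmulZl : forall (z : R[i]) a b, cmul (z *: a) b = z *: cmul a b;
  cmulZr : forall (z : R[i]) a b, cmul a (z *: b) = z *: cmul a b;
  cstarK : involutive cstar;
  cstarD : {morph cstar : a b / a + b};
  cstarZ : forall (z : R[i]) a, cstar (z *: a) = (z^*)%C *: cstar a;
  cstarM : forall a b, cstar (cmul a b) = cmul (cstar b) (cstar a);
  cnormM_le : forall a b, `|cmul a b| <= `|a| * `|b|;
  cnorm_star_mul : forall a, `|cmul (cstar a) a| = `|a| ^+ 2
}.

#[short(type="cstarAlgType")]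
HB.structure Definition CStarAlgebra (R : realType) :=
  {A of isCStarAlgebra R A & CompleteNormedModule R[i] A}.

Declare Scope cstar_scope.
Delimit Scope cstar_scope with A.
Notation "a ** b" := (cmul a b) (at level 40, left associativity)
  : cstar_scope.
Notation "a ^*" := (cstar a) : cstar_scope.
Local Open Scope cstar_scope.
Local Notation normc := ComplexField.Normc.normc.

(* Supremum in [0, +oo], so that the supremum of the empty set is 0. *)
Definition esup {R : realType} (X : set (\bar R)) : \bar R :=
  ereal_sup ([set 0%E] `|` X).

Section Algebra.
Context {R : realType} {A : cstarAlgType R}.
Implicit Types (a b h u : A) (phi psi mu : A -> R[i]).

(* The norm of A takes its values in the nonnegative reals of R[i]. *)
Definition cnorm a : R := complex.Re `|a|.

Definition sa : set A := [set a | a^* = a].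

Definition positive a : Prop := exists b, a = b^* ** b.

(* By convention the unit of a unital C*-algebra is nonzero. *)
Definition is_one u : Prop := u <> 0 /\ forall a, u ** a = a /\ a ** u = a.

Definition unital : Prop := exists u, is_one u.

(* The set C 1_A; it is empty when A has no unit. *)
Definition scalars : set A :=
  [set a | exists (z : R[i]) u, is_one u /\ a = z *: u].

Definition separable : Prop := exists2 X : set A, countable X & dense X.

Definition positive_functional phi : Prop :=
  scalar phi /\ forall a, 0 <= phi (a^* ** a).

Definition functional_norm phi : \bar R :=
  esup [set (normc (phi a))%:E | a in [set a | cnorm a <= 1]].

Definition state : set (A -> R[i]) :=
  [set phi | positive_functional phi /\ functional_norm phi = 1%E].

Definition quasi_state : set (A -> R[i]) :=
  [set phi | positive_functional phi /\ (functional_norm phi <= 1)%E].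

Definition strictly_positive h : Prop :=
  sa h /\ forall phi, state phi -> 0 < phi h.

Definition star_subalgebra (M : set A) : Prop :=
  [/\ M 0, forall a b, M a -> M b -> M (a + b),
      forall (z : R[i]) a, M a -> M (z *: a),
      forall a b, M a -> M b -> M (a ** b) &
      forall a, M a -> M a^*].

Definition abelian_cstar_subalgebra (M : set A) : Prop :=
  [/\ star_subalgebra M, closed M &
      forall a b, M a -> M b -> a ** b = b ** a].

(* phi, assumed linear, restricts to a character of M. *)
Definition restricts_to_character phi (M : set A) : Prop :=
  (forall a b, M a -> M b -> phi (a ** b) = phi a * phi b) /\
  (exists2 a, M a & phi a <> 0).

(* An approximate unit, as a proper filter: the tail filter of the net. *)
Definition approximate_unit (F : set_system A) : Prop :=
  [/\ ProperFilter F,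
      (\forall e \near F, positive e /\ cnorm e <= 1),
      forall a, e ** a @[e --> F] --> a &
      forall a, a ** e @[e --> F] --> a].

Definition weakstar_nbhs phi : set_system (A -> R[i]) :=
  within state (nbhs (phi : {ptws A -> R[i]^o})).

Definition weakstar_closure (X : set (A -> R[i])) : set (A -> R[i]) :=
  closure (X : set {ptws A -> R[i]^o}).

Definition weakstar_dense (X : set (A -> R[i])) : Prop :=
  state `<=` weakstar_closure X.

Definition induces_weakstar (d : (A -> R[i]) -> (A -> R[i]) -> \bar R) :
    Prop :=
  forall phi, state phi -> forall U : set (A -> R[i]),
    weakstar_nbhs phi U <->
    exists2 eps : R, 0 < eps &
      forall psi, state psi -> (d phi psi < eps%:E)%E -> U psi.

Definition metric_on_states (d : (A -> R[i]) -> (A -> R[i]) -> \bar R) :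
    Prop :=
  [/\ forall phi psi, state phi -> state psi ->
        (0 <= d phi psi)%E /\ (d phi psi < +oo)%E,
      forall phi psi, state phi -> state psi ->
        d phi psi = 0%E <-> phi = psi,
      forall phi psi, state phi -> state psi -> d phi psi = d psi phi &
      forall phi psi mu, state phi -> state psi -> state mu ->
        (d phi mu <= d phi psi + d psi mu)%E].

Definition metrizes_weakstar d : Prop :=
  metric_on_states d /\ induces_weakstar d.

End Algebra.
Arguments sa {R} A.
Arguments unital {R} A.
Arguments scalars {R} A.
Arguments separable {R} A.
Arguments state {R} A.
Arguments quasi_state {R} A.

(* A real-valued function on a subspace; values of lip outside dom are junk
   and are never used. *)
Record lipschitz_data (R : realType) (A : cstarAlgType R) := LipschitzData {
  dom : set A;
  lip :> A -> R
}.

Section Seminorms.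
Context {R : realType} {A : cstarAlgType R}.
Implicit Types (L : lipschitz_data A) (M : R) (a b h : A)
  (phi psi mu : A -> R[i]).

Definition dom_sa L : set A := dom L `&` sa A.

Definition seminorm L : Prop :=
  [/\ dom L 0,
      forall a b, dom L a -> dom L b ->
        dom L (a + b) /\ L (a + b) <= L a + L b,
      forall (z : R[i]) a, dom L a ->
        dom L (z *: a) /\ L (z *: a) = normc z * L a &
      forall a, dom L a -> 0 <= L a].

Definition hermitian L : Prop :=
  forall a, dom L a -> dom L a^* /\ L a^* = L a.

Definition norm_modulo_constants L : Prop :=
  (~ unital A -> [set a | dom L a /\ L a = 0] = [set 0]) /\
  (unital A -> [set a | dom L a /\ L a = 0] = scalars A).

Definition leibniz L : Prop :=
  forall a b, dom L a -> dom L b ->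
    dom L (a ** b) /\ L (a ** b) <= cnorm a * L b + L a * cnorm b.

(* dom L is then automatically a *-subalgebra. *)
Definition leibniz_hermitian_norm L : Prop :=
  [/\ seminorm L, hermitian L, norm_modulo_constants L, leibniz L &
      dense (dom L)].

Definition sa_ball L : set A := [set a | dom_sa L a /\ L a <= 1].

Definition norm_LM L M a : R := Num.max (M^-1 * cnorm a) (L a).

Definition bl L M phi psi : \bar R :=
  esup [set (normc (phi a - psi a))%:E |
         a in [set a | dom_sa L a /\ norm_LM L M a <= 1]].

Definition mk L phi psi : \bar R :=
  esup [set (normc (phi a - psi a))%:E | a in sa_ball L].

Definition qdiam L : \bar R :=
  esup [set x | exists phi psi, [/\ state A phi, state A psi &
                                    x = mk L phi psi]].

(* Boundedness of the h a h with a = b + t 1_A, b in the unit ball of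
   dom_sa L and mu b = - t.  As A is an ideal of its unitization,
   h (b + t 1_A) h = h b h + t h^2 lies in A, whether or not A is unital. *)
Definition bounded_cutdown L h mu : Prop :=
  exists K : R, forall (b : A) (t : R), sa_ball L b -> mu b = (- t)%:C%C ->
    cnorm (h ** b ** h + t%:C%C *: (h ** h)) <= K.

Definition sqlcms L : Prop :=
  [/\ separable A, leibniz_hermitian_norm L,
      induces_weakstar (bl L 1), closed (sa_ball L) &
      exists h mu, [/\ strictly_positive h, state A mu, mu h = 1 &
                       bounded_cutdown L h mu]].

Definition pin L mu : Prop :=
  state A mu /\
  weakstar_dense [set phi | state A phi /\ (mk L phi mu < +oo)%E].

Definition pinned_exhaustive_sequence L mu (h : nat -> A) : Prop :=
  [/\ forall n, dom_sa L (h n),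
      L (h n) @[n --> \oo] --> (0 : R),
      mu (h n) @[n --> \oo] --> (1 : R[i]^o) &
      cnorm (h n) @[n --> \oo] --> (1 : R)].

Definition topography L (T : set A) : Prop :=
  abelian_cstar_subalgebra T /\
  exists h mu, [/\ T h /\ dom L h, strictly_positive h,
                   state A mu /\ restricts_to_character mu T &
                   bounded_cutdown L h mu].

Definition topographic_sqlcms L (T : set A) : Prop :=
  sqlcms L /\ topography L T.

Definition pointed_proper L (T : set A) mu : Prop :=
  [/\ topographic_sqlcms L T, pin L mu, restricts_to_character mu T &
      exists s : nat -> A, pinned_exhaustive_sequence L mu s /\ forall n, T (s n)].

Definition quantum_compact L : Prop :=
  [/\ unital A, leibniz_hermitian_norm L, closed (sa_ball L) &
      metrizes_weakstar (mk L)].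

End Seminorms.

Section Morphisms.
Context {R : realType} {D A : cstarAlgType R}.
Implicit Types (LD : lipschitz_data D) (LA : lipschitz_data A) (pi : D -> A).

Definition star_morphism pi : Prop :=
  [/\ linear pi, {morph pi : a b / a ** b} & {morph pi : a / a^*}].

Definition star_epimorphism pi : Prop :=
  star_morphism pi /\ set_surj setT setT pi.

Definition proper_morphism pi : Prop :=
  exists F : set_system D, approximate_unit F /\ approximate_unit (pi @ F).

Definition dual_image pi (X : set (A -> R[i])) : set (D -> R[i]) :=
  [set phi \o pi | phi in X].

(* The first clause is the usual convention that L_A = +oo off its domain,
   under which L_A is the quotient seminorm of L_D on all of sa A. *)
Definition quantum_isometry LD LA pi : Prop :=
  [/\ star_epimorphism pi,
      forall d, dom_sa LD d -> dom LA (pi d) &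
      forall a, dom_sa LA a ->
        (LA a)%:E =
        ereal_inf [set (LD d)%:E | d in [set d | dom_sa LD d /\ pi d = a]]].

Definition quantum_Misometry (M : R) LD LA pi : Prop :=
  [/\ star_epimorphism pi /\ proper_morphism pi,
      pi @` dom LD = dom LA,
      forall a, dom_sa LA a ->
        (norm_LM LA M a)%:E =
        ereal_inf [set (norm_LM LD M d)%:E |
                    d in [set d | dom_sa LD d /\ pi d = a]] &
      forall d, dom_sa LD d -> LA (pi d) <= LD d].

Definition topographic LD (TD : set D) LA (TA : set A) pi : Prop :=
  pi @` TD `<=` TA /\
  forall a (eps : R), dom_sa LA a -> TA a -> 0 < eps ->
    exists d, [/\ TD d /\ dom_sa LD d, pi d = a,
                  cnorm d <= expR eps * cnorm a &
                  LD d <= expR eps * LA a].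

End Morphisms.

Section Distances.
Context {R : realType} {T : Type}.
Implicit Types (d : T -> T -> \bar R) (X Y : set T).

Definition almost_subset d (eps : R) X Y : Prop :=
  forall x, X x -> (ereal_inf [set d x y | y in Y] <= eps%:E)%E.

Definition hausdorff_distance d X Y : \bar R :=
  ereal_inf [set eps%:E | eps in
    [set eps : R | [/\ 0 < eps, almost_subset d eps X Y &
                                almost_subset d eps Y X]]].

End Distances.

Record qcms (R : realType) := QCMS {
  qcms_alg :> cstarAlgType R;
  qcms_lip : lipschitz_data qcms_alg;
  qcmsP : quantum_compact qcms_lip
}.

Arguments qcms_lip {R} q.

Record compact_tunnel (R : realType) (A B : qcms R) := CompactTunnel {
  ct_D : qcms R;
  ct_pi : ct_D -> A;
  ct_rho : ct_D -> B;
  ct_piP : quantum_isometry (qcms_lip ct_D) (qcms_lip A) ct_pi;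
  ct_rhoP : quantum_isometry (qcms_lip ct_D) (qcms_lip B) ct_rho
}.

Arguments ct_D {R A B} c.
Arguments ct_pi {R A B} c.
Arguments ct_rho {R A B} c.

Definition compact_extent (R : realType) (A B : qcms R)
    (t : compact_tunnel A B) : \bar R :=
  let d := mk (qcms_lip (ct_D t)) in
  maxe (hausdorff_distance d (state (ct_D t))
                             (dual_image (ct_pi t) (state A)))
       (hausdorff_distance d (state (ct_D t))
                             (dual_image (ct_rho t) (state B))).

Definition propinquity (R : realType) (A B : qcms R) : \bar R :=
  ereal_inf [set x | exists t : compact_tunnel A B, x = compact_extent t].

Record pointed_data (R : realType) := PointedData {
  pd_alg :> cstarAlgType R;
  pd_lip : lipschitz_data pd_alg;
  pd_topo : set pd_alg;
  pd_base : pd_alg -> R[i]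
}.

Arguments pd_lip {R} p.
Arguments pd_topo {R} p.
Arguments pd_base {R} p.

Definition pointed_proper_qms (R : realType) (P : pointed_data R) : Prop :=
  pointed_proper (pd_lip P) (pd_topo P) (pd_base P).

(* Tunnels are only defined between pointed proper quantum metric spaces:
   mt_srcP and mt_tgtP record this. *)
Record Mtunnel (R : realType) (M : R) (P Q : pointed_data R) := MTunnel {
  mt_srcP : pointed_proper_qms P;
  mt_tgtP : pointed_proper_qms Q;
  mt_D : cstarAlgType R;
  mt_lip : lipschitz_data mt_D;
  mt_topo : set mt_D;
  mt_piA : mt_D -> P;
  mt_piB : mt_D -> Q;
  mt_e : mt_D;
  mt_DP : topographic_sqlcms mt_lip mt_topo;
  mt_eP : dom_sa mt_lip mt_e /\ mt_topo mt_e;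
  mt_piAP : quantum_Misometry M mt_lip (pd_lip P) mt_piA;
  mt_piBP : quantum_Misometry M mt_lip (pd_lip Q) mt_piB;
  mt_topoA : topographic mt_lip mt_topo (pd_lip P) (pd_topo P) mt_piA;
  mt_topoB : topographic mt_lip mt_topo (pd_lip Q) (pd_topo Q) mt_piB;
  mt_pin : pin mt_lip (pd_base P \o mt_piA)
}.

Arguments mt_D {R M P Q} m.
Arguments mt_lip {R M P Q} m.
Arguments mt_e {R M P Q} m.
Arguments mt_piA {R M P Q} m.
Arguments mt_piB {R M P Q} m.

Definition cutdown_quasi_states (R : realType) (D : cstarAlgType R) (e : D) :
    set (D -> R[i]) :=
  [set (fun a => phi (e ** a ** e)) | phi in quasi_state D].

Section Extent.
Context {R : realType} {M : R} {P Q : pointed_data R}.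
Variable t : Mtunnel M P Q.

Definition extent_states : \bar R :=
  let X := cutdown_quasi_states (mt_e t) in
  let d := bl (mt_lip t) M in
  ereal_inf [set eps%:E | eps in [set eps : R |
    [/\ 0 < eps,
        almost_subset d eps X (dual_image (mt_piA t) (quasi_state P)) &
        almost_subset d eps X
          (dual_image (mt_piB t) (quasi_state Q))]]].

Definition extent_base : \bar R :=
  mk (mt_lip t) (pd_base P \o mt_piA t)
                (pd_base Q \o mt_piB t).

Definition extent_cutoff : R :=
  Num.max (2 * M * mt_lip t (mt_e t))
    (Num.max (normc (1 - pd_base P (mt_piA t (mt_e t))))
             (normc (1 - pd_base Q (mt_piB t (mt_e t))))).

Definition extent : \bar R :=
  maxe extent_states (maxe extent_base extent_cutoff%:E).

End Extent.

Definition local_metametric (R : realType) (M : R) (P Q : pointed_data R) :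
    \bar R :=
  ereal_inf [set x | exists t : Mtunnel M P Q, x = extent t].

(* expeR -oo = 0. *)
Definition quantum_metametric (R : realType) (P Q : pointed_data R) : \bar R :=
  maxe
    (ereal_inf [set eps%:E | eps in [set eps : R | 0 < eps /\
       (esup [set local_metametric r P Q | r in
               [set r : R | (1 <= r <= eps^-1)%R]] < eps%:E)%E]])
    `|expeR (- qdiam (pd_lip P)) - expeR (- qdiam (pd_lip Q))|%E.

Definition qcms_pointed (R : realType) (A : qcms R) (mu : A -> R[i]) :
    pointed_data R :=
  @PointedData R A (qcms_lip A) (scalars A) mu.

(* Main.v *)
(** Let (D, L_D, pi, rho) be a compact tunnel from (A, L_A) to (B, L_B) of extent
less than chi. On D * (A * B) consider the seminorm
  L(d, a, b) = max (L_D d, L_A a, L_B b, |a - pi d| / chi, |b - rho d| / chi).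
With the unit as cut-off and the scalars as topography, the two projections to A
and B form an M-tunnel of extent at most 3 chi, for every M at once. The point is
that the projections are M-isometries although pi and rho need not be: an element
a with |a| <= M and L_A a <= 1 has a lift d with L_D d <= 1 and |d| <= M + chi
only, but d M / (M + chi) has norm at most M, and its image is chi-close to a.
If mu_n is chosen with mk(mu_n o pi, mu o rho) <= chi, all terms of the extent are
at most 3 chi; the diameters of A and B differ by at most 2 chi.

Everything rests on the fact that states detect the norm of self-adjoint elements.
It is obtained without spectral theory: call x positive when |t - x| <= t for some
t; such an x has approximate square roots (a contraction argument), b^* b is
positive, and the linear functionals below the sublinear functional sending x to
the infimum of |s + x| - s over s >= 0 are states. *)

Require Import Defs.
From HB Require Import structures.
From mathcomp Require Import all_boot all_order all_algebra.
From mathcomp Require Import complex.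
From mathcomp Require Import all_classical all_reals all_analysis.
From mathcomp Require Import ring lra.
Set Implicit Arguments.
Unset Strict Implicit.
Unset Printing Implicit Defensive.
Import Order.TTheory GRing.Theory Num.Theory.
Import numFieldNormedType.Exports.
Local Open Scope classical_set_scope.
Local Open Scope ring_scope.
Local Open Scope complex_scope.
Local Notation normc := ComplexField.Normc.normc.

(** * C*-algebras: norm, square roots and positivity *)

(** Why the bridge has three coordinates: a quantum isometry controls the Lipschitz seminorm alone,
    while an M-isometry must lift the norm bound too, and a lift of a to D may be longer than a. In
    the bridge the A coordinate of a lift is a itself and d is only near a lift of a, so that
    shortening d is paid for by the gap term; the factor 1 / chi makes this payment admissible. The
    Leibniz rule survives because pi and rho are multiplicative and contractive. The constant 3
    counts the moves from a to pi d, across D, and from rho d to b, each of cost chi. It is free of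
    M because these moves only use that the bridge seminorm is at most 1. The cut-off term vanishes,
    since the unit has seminorm 0 and states take the value 1 there. That the bridge is again a
    compact space is checked on its unit ball: [mk] induces the weak* topology as soon as this ball
    is bounded modulo scalars and its bounded parts are totally bounded, and conversely the balls of
    D, A and B have these properties. Both directions need the norm of a self-adjoint element to be
    a supremum over states. *)

Section Norm.
Context {R : realType} {A : cstarAlgType R}.
Implicit Types (a b : A) (z : R[i]) (r : R).

Lemma normr_cnorm a : `|a| = (cnorm a)%:C.
Proof.
rewrite /cnorm [LHS]complexE (ger0_Im (normr_ge0 a)).
by rewrite mulr0 addr0.
Qed.

Lemma cnorm_ge0 a : 0 <= cnorm a.
Proof. by rewrite -ler0c -normr_cnorm normr_ge0. Qed.

Lemma cnorm0 : cnorm (0 : A) = 0.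
Proof. by rewrite /cnorm normr0. Qed.

Lemma cnorm_eq0 a : cnorm a = 0 -> a = 0.
Proof. by move=> a0; apply: normr0_eq0; rewrite normr_cnorm a0. Qed.

Lemma cnormN a : cnorm (- a) = cnorm a.
Proof. by rewrite /cnorm normrN. Qed.

Lemma cnormBC a b : cnorm (a - b) = cnorm (b - a).
Proof. by rewrite -cnormN opprB. Qed.

Lemma cnormD a b : cnorm (a + b) <= cnorm a + cnorm b.
Proof. by move: (ler_normD a b); rewrite !normr_cnorm -rmorphD lecR. Qed.

Lemma cnormB a b : cnorm (a - b) <= cnorm a + cnorm b.
Proof. by rewrite -(cnormN b) cnormD. Qed.

Lemma cnorm_sub_triangle b a c : cnorm (a - c) <= cnorm (a - b) + cnorm (b - c).
Proof. by rewrite -(subrK b a) -addrA addrK cnormD. Qed.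

Lemma cnormZ z a : cnorm (z *: a) = normc z * cnorm a.
Proof.
have := normrZ z a; rewrite !normr_cnorm (_ : `|z| = (normc z)%:C); last first.
  by rewrite normc_def; case: z.
by rewrite -rmorphM => /complexI.
Qed.

Lemma normc_real r : normc r%:C = `|r|.
Proof. by rewrite /= expr0n addr0 sqrtr_sqr. Qed.

Lemma cnormZr r a : cnorm (r%:C *: a) = `|r| * cnorm a.
Proof. by rewrite cnormZ normc_real. Qed.

Lemma cnormM a b : cnorm (cmul a b) <= cnorm a * cnorm b.
Proof. by move: (cnormM_le a b); rewrite !normr_cnorm -rmorphM lecR. Qed.

Lemma cnorm_starM a : cnorm (cmul (cstar a) a) = cnorm a ^+ 2.
Proof.
by have := cnorm_star_mul a; rewrite !normr_cnorm -rmorphXn => /complexI.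
Qed.

Lemma cnorm_star a : cnorm (cstar a) = cnorm a.
Proof.
have le (x : A) : cnorm x <= cnorm (cstar x).
  have [x0|x0] := eqVneq (cnorm x) 0; first by rewrite x0 cnorm_ge0.
  have x_gt0 : 0 < cnorm x by rewrite lt_neqAle eq_sym x0 cnorm_ge0.
  by rewrite -(ler_pM2r x_gt0) -expr2 -cnorm_starM cnormM.
by apply/le_anti; rewrite le -{2}(cstarK a) le.
Qed.

Lemma cstar0 : cstar (0 : A) = 0.
Proof. by apply: (addrI (cstar 0)); rewrite -cstarD !addr0. Qed.

Lemma cstarN a : cstar (- a) = - cstar a.
Proof. by rewrite -scaleN1r cstarZ rmorphN1 scaleN1r. Qed.

Lemma cstarB a b : cstar (a - b) = cstar a - cstar b.
Proof. by rewrite cstarD cstarN. Qed.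

Lemma cstarZr r a : cstar (r%:C *: a) = r%:C *: cstar a.
Proof. by rewrite cstarZ conjc_real. Qed.

Lemma cmul0r a : cmul a 0 = 0.
Proof. by apply: (addrI (cmul a 0)); rewrite -cmulDr !addr0. Qed.

Lemma cmulBl a b c : cmul (a - b) c = cmul a c - cmul b c.
Proof. by rewrite -[- b]scaleN1r cmulDl cmulZl scaleN1r. Qed.
Lemma cmulBr a b c : cmul a (b - c) = cmul a b - cmul a c.
Proof. by rewrite -[- c]scaleN1r cmulDr cmulZr scaleN1r. Qed.

Lemma sa0 : sa A 0. Proof. exact: cstar0. Qed.
Lemma saD a b : sa A a -> sa A b -> sa A (a + b).
Proof. by move=> sa_a sa_b; rewrite /sa/= cstarD sa_a sa_b. Qed.
Lemma saN a : sa A a -> sa A (- a).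
Proof. by move=> sa_a; rewrite /sa/= cstarN sa_a. Qed.
Lemma saB a b : sa A a -> sa A b -> sa A (a - b).
Proof. by move=> sa_a sa_b; apply: saD => //; apply: saN. Qed.
Lemma saZ r a : sa A a -> sa A (r%:C *: a).
Proof. by move=> sa_a; rewrite /sa/= cstarZr sa_a. Qed.
Lemma sa_starM a : sa A (cmul (cstar a) a).
Proof. by rewrite /sa/= cstarM cstarK. Qed.

Definition rpart a : A := (2^-1)%:C *: (a + cstar a).
Definition ipart a : A := (2^-1)%:C *: ('i *: (cstar a - a)).

Lemma sa_rpart a : sa A (rpart a).
Proof. by apply: saZ; rewrite /sa/= cstarD cstarK addrC. Qed.

Lemma sa_ipart a : sa A (ipart a).
Proof.
apply: saZ; rewrite /sa/= cstarZ cstarB cstarK -[a - _]opprB scalerN -scaleNr.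
by congr (_ *: _); apply/eqP; rewrite eq_complex /= oppr0 opprK !eqxx.
Qed.

Lemma two_halves a : (2^-1)%:C *: (a + a) = a.
Proof.
rewrite scalerDr -scalerDl -rmorphD (_ : _ + _ = 1) ?scale1r//=.
by rewrite -div1r -splitr.
Qed.

Lemma parts_eq a : a = rpart a + 'i *: ipart a.
Proof.
rewrite /rpart /ipart [in RHS]scalerA [_ * (_)%:C]mulrC -scalerA -scalerDr.
rewrite scalerA -expr2 sqr_i scaleN1r opprB addrACA subrr addr0.
by rewrite two_halves.
Qed.

Lemma cnorm_rpart a : cnorm (rpart a) <= cnorm a.
Proof.
rewrite cnormZr ger0_norm ?invr_ge0// ler_pdivrMl// mulr2n mulrDl mul1r.
by rewrite (le_trans (cnormD _ _))// cnorm_star.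
Qed.

Lemma rpart_sa a : sa A a -> rpart a = a.
Proof. by move=> sa_a; rewrite /rpart sa_a two_halves. Qed.

Lemma sa_sqr_norm a : sa A a -> cnorm (cmul a a) = cnorm a ^+ 2.
Proof. by move=> sa_a; rewrite -{1}sa_a cnorm_starM. Qed.

End Norm.

(* [uring hu] is [A] seen as a ring with unit [u], so that the ring lemmas of the
   library apply to it. *)
Definition uring (R : realType) (A : cstarAlgType R) (u : A) (hu : is_one u) :
  Type := A.

Section UnitalRing.
Context {R : realType} {A : cstarAlgType R} {u : A} (hu : is_one u).

HB.instance Definition _ := CStarAlgebra.copy (uring hu) A.

Lemma uring_mul1 : left_id (u : uring hu) (@cmul R (uring hu)).
Proof. by move=> x; have [_ /(_ x) []] := hu. Qed.

Lemma uring_mulr1 : right_id (u : uring hu) (@cmul R (uring hu)).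
Proof. by move=> x; have [_ /(_ x) []] := hu. Qed.

Lemma uring_one_neq0 : (u : uring hu) != 0.
Proof. by have [/eqP] := hu. Qed.

HB.instance Definition _ := GRing.Zmodule_isNzRing.Build (uring hu)
  (@cmulA R (uring hu)) uring_mul1 uring_mulr1
  (@cmulDl R (uring hu)) (@cmulDr R (uring hu)) uring_one_neq0.

Lemma uring_scalerAl (z : R[i]) (a b : uring hu) : z *: (a * b) = z *: a * b.
Proof. by rewrite -[RHS]/(cmul (z *: a) b) cmulZl. Qed.

Lemma uring_scalerAr (z : R[i]) (a b : uring hu) : z *: (a * b) = a * (z *: b).
Proof. by rewrite -[RHS]/(cmul a (z *: b)) cmulZr. Qed.

HB.instance Definition _ :=
  GRing.Lmodule_isLalgebra.Build R[i] (uring hu) uring_scalerAl.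
HB.instance Definition _ :=
  GRing.Lalgebra_isAlgebra.Build R[i] (uring hu) uring_scalerAr.

End UnitalRing.

(** * Norm limits with real-valued error bounds *)

Lemma lerD_2 (R : realType) (x y z : R) : x <= z -> y <= z -> x + y <= 2 * z.
Proof. by move=> *; lra. Qed.

Section GeometricLimit.
Context {R : realType} {A : cstarAlgType R}.

(** Identities satisfied by limits are proved below by bounding their defect by a fixed multiple of
    every e. *)
Lemma cnorm_small_eq0 (a : A) K :
  (forall e, 0 < e -> cnorm a <= K * e) -> a = 0.
Proof.
move=> small; apply: cnorm_eq0; apply/le_anti; rewrite cnorm_ge0 andbT.
have K_ge0 : 0 <= K by rewrite -[K]mulr1 (le_trans (cnorm_ge0 a)) ?small.
apply/ler_addgt0Pr => e e_gt0; rewrite add0r.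
(* Dividing by K + 1 also covers K = 0. *)
have K1 : 0 < K + 1 by rewrite ltr_wpDl.
rewrite (le_trans (small (e / (K + 1)) _)) ?divr_gt0// mulrA ler_pdivrMr//.
by rewrite mulrC ler_pM2l// lerDl.
Qed.

(** The tail is bounded by the geometric series C q^n / (1 - q). The conclusion is in epsilon form
    because [cnorm] is real while the norm of the normed module has values in R[i]. *)
Lemma geometric_cvg (y : nat -> A) (C q : R) : 0 <= q -> q < 1 ->
  (forall n, cnorm (y n.+1 - y n) <= C * q ^+ n) ->
  exists l, forall e, 0 < e -> exists N, forall n, (N <= n)%N ->
    cnorm (y n - l) < e.
Proof.
move=> q_ge0 q_lt1 ystep.
have q1 : 0 < 1 - q by rewrite subr_gt0.
have tail m n : cnorm (y (n + m)%N - y n) <= C / (1 - q) * q ^+ n.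
  elim: m n => [|m IH] n.
    rewrite addn0 subrr cnorm0 mulr_ge0 ?exprn_ge0// divr_ge0 ?(ltW q1)//.
    by have := ystep 0%N; rewrite expr0 mulr1; apply: le_trans; exact: cnorm_ge0.
  rewrite addnS -addSn (le_trans (cnorm_sub_triangle (y n.+1) _ _))//.
  rewrite (le_trans (lerD (IH _) (ystep _)))// exprS.
  by rewrite le_eqVlt; apply/orP; left; apply/eqP; field; rewrite gt_eqF.
have small e : 0 < e -> exists N, forall n, (N <= n)%N -> C / (1 - q) * q ^+ n < e.
  move=> e_gt0.
  have /cvgrPdist_lt/(_ _ e_gt0)[N _ HN] : geometric (C / (1 - q)) q @ \oo --> (0 : R).
    by apply: cvg_geometric; rewrite ger0_norm.
  by exists N => n /HN; rewrite sub0r normrN; apply: le_lt_trans; exact: ler_norm.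
have yl : cvg (y @ \oo).
  apply: cauchy_cvg; apply: cauchy_exP => e e_gt0.
  have eE := RRe_real (ger0_real (ltW e_gt0)).
  have /small[N HN] : 0 < complex.Re e by rewrite -ltcR eE.
  exists (y N); exists N => // n /= leNn.
  rewrite -ball_normE/= normr_cnorm -eE ltcR cnormBC -(subnKC leNn).
  by rewrite (le_lt_trans (tail _ _))// HN.
exists (lim (y @ \oo)) => e e_gt0.
have /cvgrPdist_lt/(_ e%:C)[|N _ HN] := yl; first by rewrite ltcR.
by exists N => n /HN/=; rewrite normr_cnorm ltcR cnormBC.
Qed.

End GeometricLimit.

(** * Square roots near the unit *)

Section Sqrt.
Context {R : realType} {A : cstarAlgType R} {u : A} (hu : is_one u).
Local Notation B := (uring hu).
Implicit Types (x y z a b c d w : B) (r s t : R).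

Lemma ustarM x y : cstar (x * y) = cstar y * cstar x.
Proof. exact: cstarM. Qed.

Lemma ustar1 : cstar (1 : B) = 1.
Proof. by rewrite -[RHS]cstarK -{2}[cstar _]mulr1 ustarM cstarK mulr1. Qed.

Lemma unormM x y : cnorm (x * y) <= cnorm x * cnorm y.
Proof. exact: cnormM. Qed.

Lemma unorm_starM x : cnorm (cstar x * x) = cnorm x ^+ 2.
Proof. exact: cnorm_starM. Qed.

Lemma unorm1 : cnorm (1 : B) = 1.
Proof.
have := unorm_starM 1; rewrite ustar1 mulr1 => k2.
have k0 : cnorm (1 : B) != 0.
  by apply/eqP => /cnorm_eq0/eqP; rewrite oner_eq0.
by apply: (mulfI k0); rewrite mulr1 -expr2.
Qed.

Lemma unormr r : cnorm (r%:C%:A : B) = `|r|.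
Proof. by rewrite cnormZr unorm1 mulr1. Qed.

Lemma sau_r r : sa B r%:C%:A.
Proof. by rewrite /sa/= cstarZr ustar1. Qed.

Lemma sau_sqr x : sa B x -> sa B (x * x).
Proof. by move=> xs; rewrite /sa/= ustarM xs. Qed.

Lemma usa_norm x : sa B x -> cnorm (x * x) = cnorm x ^+ 2.
Proof. exact: sa_sqr_norm. Qed.

(** The equation (1 - y)^2 = 1 - x says that y is a fixed point of y -> (x + y^2) / 2, which maps
    the ball of radius |x| to itself and has Lipschitz constant |x| < 1 there. The iterates from 0
    are polynomials in x, whence self-adjointness and commutation pass to the limit. *)
Lemma sqrt_one_sub x : sa B x -> cnorm x < 1 ->
  exists y, [/\ sa B y, cnorm y <= cnorm x,
    forall w, GRing.comm w x -> GRing.comm w y & (1 - y) * (1 - y) = 1 - x].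
Proof.
move=> sx x1; set q := cnorm x in x1 *.
pose f y : B := (2^-1)%:C *: (x + y * y).
pose s n : B := iter n f 0.
have q0 : 0 <= q := cnorm_ge0 _.
have f_sub y z : f y - f z = (2^-1)%:C *: (y * (y - z) + (y - z) * z).
  rewrite /f -scalerBr opprD addrACA subrr add0r mulrBr mulrBl addrA.
  by rewrite subrK.
have fle y : cnorm y <= q -> cnorm (f y) <= q.
  move=> yq; rewrite cnormZr ger0_norm ?invr_ge0// ler_pdivrMl//.
  have qq : cnorm (y * y) <= q.
    rewrite (le_trans (unormM _ _))// -[leRHS]mulr1 ler_pM ?cnorm_ge0//.
    by rewrite (le_trans yq) ?ltW.
  by rewrite (le_trans (cnormD _ _))// mulr2n mulrDl mul1r lerD.
have f_lip y z : cnorm y <= q -> cnorm z <= q ->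
    cnorm (f y - f z) <= q * cnorm (y - z).
  move=> yq zq; rewrite f_sub cnormZr ger0_norm ?invr_ge0// ler_pdivrMl//.
  rewrite (le_trans (cnormD _ _))//.
  rewrite lerD_2// (le_trans (unormM _ _))//; first by rewrite ler_wpM2r ?cnorm_ge0.
  by rewrite mulrC ler_wpM2r ?cnorm_ge0.
have sq n : cnorm (s n) <= q by elim: n => [|n /fle//]; rewrite /s/= cnorm0.
have [|l sl] := @geometric_cvg _ B s (cnorm (s 1%N - s 0%N)) q q0 x1.
  elim=> [|n IH]; first by rewrite expr0 mulr1.
  rewrite exprS mulrCA; have h := f_lip _ _ (sq n.+1) (sq n).
  by apply: le_trans h _; rewrite ler_wpM2l.
have lq : cnorm l <= q.
  apply/ler_addgt0Pr => e /sl[N /(_ _ (leqnn N))]; rewrite cnormBC => /ltW lN.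
  by rewrite -(subrK (s N) l) (le_trans (cnormD _ _))// addrC lerD.
have lf : l - f l = 0.
  apply: (@cnorm_small_eq0 _ _ _ 2) => e /sl[N HN].
  have := HN _ (leqnSn N); rewrite cnormBC => /ltW leS.
  rewrite (le_trans (cnorm_sub_triangle (s N.+1) _ _))//.
  rewrite lerD_2//; apply: le_trans (f_lip _ _ (sq _) lq) _.
  rewrite -[leRHS]mul1r ler_pM ?cnorm_ge0//; first exact: ltW.
  exact/ltW/HN.
exists l; split=> //.
- have ss n : sa B (s n).
    elim: n => [|n IH]; first exact: sa0.
    by apply: saZ; apply: saD => //; exact: sau_sqr.
  apply/eqP; rewrite -subr_eq0; apply/eqP.
  apply: (@cnorm_small_eq0 _ _ _ 2) => e /sl[N /(_ _ (leqnn N))/ltW HN].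
  rewrite (le_trans (cnorm_sub_triangle (s N) _ _))//.
  rewrite lerD_2// -(ss N) -cstarB cnorm_star.
  by rewrite cnormBC.
- move=> w wx.
  have ws n : GRing.comm w (s n).
    elim: n => [|n IH]; first exact: commr0.
    rewrite /GRing.comm/= -scalerAr -scalerAl; congr (_ *: _).
    by apply: commrD => //; apply: commrM.
  apply/eqP; rewrite -subr_eq0; apply/eqP.
  apply: (@cnorm_small_eq0 _ _ _ (2 * cnorm w)) => e /sl[N /(_ _ (leqnn N))/ltW HN].
  have -> : w * l - l * w = w * (l - s N) - (l - s N) * w.
    by rewrite mulrBr mulrBl ws opprB addrA subrK.
  rewrite (le_trans (cnormB _ _))// -mulrA lerD_2//.
    by rewrite (le_trans (unormM _ _))// ler_wpM2l ?cnorm_ge0// cnormBC.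
  by rewrite (le_trans (unormM _ _))// mulrC ler_wpM2l ?cnorm_ge0// cnormBC.
- have {lf} : (2%:R)%:C *: l = x + l * l.
    move/eqP: lf; rewrite subr_eq0 => /eqP {1}->.
    by rewrite scalerA -rmorphM mulfV ?scale1r.
  rewrite mulr2n rmorphD scalerDl !scale1r => ll.
  have -> : x = l + l - l * l by rewrite ll addrK.
  rewrite mulrBl mul1r mulrBr mulr1 !opprB opprD !addrA; congr (_ - _).
  by rewrite addrAC.
Qed.

End Sqrt.

Lemma rpart_cartesian (R : realType) (A : cstarAlgType R) (a b : A) :
  sa A a -> sa A b -> rpart (a + 'i *: b) = a.
Proof.
move=> sa_a sa_b; rewrite /rpart cstarD cstarZ sa_a sa_b addrACA -scalerDl.
rewrite (_ : 'i + _ = 0) ?scale0r ?addr0 ?two_halves//.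
by apply/eqP; rewrite eq_complex /= addr0 subrr !eqxx.
Qed.

(** * Positivity expressed through the norm *)

Section Positivity.
Context {R : realType} {A : cstarAlgType R} {u : A} (hu : is_one u).
Local Notation B := (uring hu).
Implicit Types (x y z a b c d w : B) (r s t e : R).

Lemma commZ w x (k : R[i]) : GRing.comm w x -> GRing.comm w (k *: x).
Proof. by move=> wx; rewrite /GRing.comm/= -scalerAr -scalerAl wx. Qed.

Lemma comm_scalar w (k : R[i]) : GRing.comm w k%:A.
Proof. by apply: commZ; exact: commr1. Qed.

(** Rescaling of [sqrt_one_sub] by t. The second clause says that the root again satisfies the
    hypothesis, so roots can be iterated: [npos_starM] takes a root of a root. *)
Lemma sqrt_near x t : sa B x -> 0 < t -> cnorm (t%:C%:A - x) < t ->
  exists c, [/\ sa B c, exists2 s, 0 < s & cnorm (s%:C%:A - c) < s,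
    forall w, GRing.comm w x -> GRing.comm w c & c * c = x].
Proof.
move=> sx t0 xt; pose z : B := t^-1%:C *: (t%:C%:A - x).
have z1 : cnorm z < 1.
  by rewrite cnormZr ger0_norm ?invr_ge0 ?ltW// ltr_pdivrMl// mulr1.
have [|y [sy yz yw ye]] := @sqrt_one_sub _ _ _ hu z _ z1.
  by apply/saZ/saB => //; exact: sau_r.
have s0 : 0 < Num.sqrt t by rewrite sqrtr_gt0.
exists ((Num.sqrt t)%:C *: (1 - y)); split.
- by apply/saZ/saB => //; exact: ustar1.
- exists (Num.sqrt t) => //.
  rewrite -scalerBr opprB addrC subrK cnormZr ger0_norm ?ltW//.
  by rewrite -[ltRHS]mulr1 ltr_pM2l// (le_lt_trans yz).
- move=> w wx; apply/commZ/commrB; first exact: commr1.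
  by apply/yw/commZ/commrB => //; exact: comm_scalar.
- rewrite -scalerAl -scalerAr scalerA -rmorphM -expr2 sqr_sqrtr ?ltW// ye.
  rewrite /z scalerBr scalerA -rmorphM mulfV ?gt_eqF// scale1r.
  by rewrite opprB addrC subrK.
Qed.

(** For v = c + i d commutation gives v^* v = c^2 + d^2. Moreover c is the real part of v and c^2 -
    d^2 that of v^2, and taking real parts does not increase the norm. *)
Lemma comm_sq_norm c d : sa B c -> sa B d -> GRing.comm c d ->
  cnorm c ^+ 2 <= cnorm (c * c + d * d) /\
  cnorm (c * c - d * d) <= cnorm (c * c + d * d).
Proof.
move=> sc sd cd; pose v : B := c + 'i *: d.
have vE : cstar v = c - 'i *: d.
  rewrite /v cstarD cstarZ sc sd -scaleNr; congr (_ + _ *: _).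
  by apply/eqP; rewrite eq_complex /= oppr0 !eqxx.
have vv : cstar v * v = c * c + d * d.
  rewrite vE /v mulrBl !mulrDr -!scalerAl -!scalerAr scalerA -(expr2 'i) sqr_i.
  by rewrite scaleN1r cd opprD opprK addrA addrK.
have v2 : v * v = (c * c - d * d) + 'i *: (c * d + d * c).
  rewrite /v mulrDl !mulrDr -!scalerAl -!scalerAr scalerA -(expr2 'i) sqr_i.
  rewrite scaleN1r scalerDr -!addrA; congr (_ + _).
  by rewrite [RHS]addrC -addrA.
have nv : cnorm v ^+ 2 = cnorm (c * c + d * d) by rewrite -vv unorm_starM.
split; rewrite -nv.
  by rewrite ler_pXn2r ?nnegrE ?cnorm_ge0// -{1}(rpart_cartesian sc sd) cnorm_rpart.
have {1}<- : rpart (v * v) = c * c - d * d.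
  rewrite v2; apply: rpart_cartesian; first by apply: saB; exact: sau_sqr.
  by rewrite /sa/= cstarD !ustarM sc sd addrC.
by rewrite (le_trans (cnorm_rpart _))// expr2 unormM.
Qed.

(* Positivity of the spectrum, expressed through the norm alone. *)
Definition npos x : Prop := sa B x /\ exists t, cnorm (t%:C%:A - x) <= t.

Lemma nposD x y : npos x -> npos y -> npos (x + y).
Proof.
move=> [sx [t xt]] [sy [s ys]]; split; first exact: saD.
exists (t + s); rewrite rmorphD scalerDl opprD addrACA.
by rewrite (le_trans (cnormD _ _))// lerD.
Qed.

Lemma nposZ x r : 0 <= r -> npos x -> npos (r%:C *: x).
Proof.
move=> r0 [sx [t xt]]; split; first exact: saZ.
exists (r * t); rewrite rmorphM -scalerA -scalerBr cnormZr ger0_norm//.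
by rewrite ler_wpM2l.
Qed.

Lemma npos_scalar r : npos r%:C%:A <-> 0 <= r.
Proof.
split=> [[_ [t]]|r0]; last by split; [exact: sau_r|exists r; rewrite subrr cnorm0].
by rewrite -scalerBl -rmorphB unormr => /(le_trans (ler_norm _)); rewrite gerBl.
Qed.

Lemma npos_normB x t : sa B x -> cnorm x <= t -> npos (t%:C%:A - x).
Proof.
move=> sx xt; split; first by apply: saB => //; exact: sau_r.
by exists t; rewrite opprB addrC subrK.
Qed.

Lemma npos_normD x t : sa B x -> cnorm x <= t -> npos (t%:C%:A + x).
Proof. by move=> sx xt; rewrite -[x]opprK; apply: npos_normB; [exact: saN|rewrite cnormN]. Qed.

(** Adding e to both x and t turns |t - x| <= t into the strict inequality that [sqrt_near] asks
    for. *)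
Lemma npos_sqrt x e : npos x -> 0 < e ->
  exists c, [/\ sa B c, forall w, GRing.comm w x -> GRing.comm w c &
    c * c = x + e%:C%:A].
Proof.
move=> [sx [t xt]] e0; have t0 : 0 <= t by apply: le_trans xt; exact: cnorm_ge0.
have [|||c [sc _ cw ce]] := @sqrt_near (x + e%:C%:A) (t + e).
- by apply: saD => //; exact: sau_r.
- by rewrite ltr_wpDl.
- rewrite rmorphD scalerDl opprD addrACA subrr addr0.
  by rewrite (le_lt_trans xt)// ltrDl.
exists c; split=> // w wx; apply: cw; apply: commrD => //.
exact: comm_scalar.
Qed.

(** If c is a root of t - x^2, then c commutes with x and c^2 + x^2 = t, so the first half of
    [comm_sq_norm] gives |t - x^2| = |c|^2 <= t. *)
Lemma npos_sqr x : sa B x -> npos (x * x).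
Proof.
move=> sx; split; first exact: sau_sqr.
pose t := cnorm (x * x) + 1.
have t0 : 0 < t by rewrite ltr_wpDl ?cnorm_ge0.
have [|||c [sc _ cw ce]] := @sqrt_near (t%:C%:A - x * x) t.
- by apply: saB; [exact: sau_r|exact: sau_sqr].
- by [].
- by rewrite opprB addrC subrK ltrDl.
have cx : GRing.comm c x.
  apply/commr_sym/cw/commrB; first exact: comm_scalar.
  exact: commrM.
have [+ _] := comm_sq_norm sc sx cx; rewrite ce subrK unormr gtr0_norm//.
by rewrite -usa_norm// ce; exists t.
Qed.

(** The roots b of t + d + e and c of t - d + e commute; their squares differ by 2 d and add up to 2
    (t + e), so the second half of [comm_sq_norm] applies. *)
Lemma npos_norm_le d t : npos (t%:C%:A - d) -> npos (t%:C%:A + d) ->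
  cnorm d <= t.
Proof.
move=> n1 n2; have sd : sa B d.
  by rewrite -[d](addKr t%:C%:A) addrC; apply: saB n2.1 _; exact: sau_r.
have t0 : 0 <= t.
  have := nposD n1 n2; rewrite addrACA addNr addr0 -scalerDl -rmorphD.
  by move/npos_scalar; rewrite -mulr2n pmulrn_lge0.
apply/ler_addgt0Pr => e e0.
have [c [sc cw ce]] := npos_sqrt n1 e0.
have [b [sb bw be]] := npos_sqrt n2 e0.
have comm_d w : GRing.comm w (t%:C%:A - d) -> GRing.comm w d.
  move=> wd; rewrite -[d]opprK; apply: commrN.
  by rewrite -[- d](addKr t%:C%:A); apply: commrD wd; apply/commrN/comm_scalar.
have cb : GRing.comm b c.
  apply/cw/commrB; first exact: comm_scalar.
  apply/commr_sym/bw/commrD; first exact: comm_scalar.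
  exact: commr_refl.
have [_] := comm_sq_norm sb sc cb; rewrite be ce.
have -> : t%:C%:A + d + e%:C%:A - (t%:C%:A - d + e%:C%:A) = d + d.
  by rewrite opprD addrACA subrr addr0 opprB [d - _]addrC addrACA subrr add0r.
have -> : t%:C%:A + d + e%:C%:A + (t%:C%:A - d + e%:C%:A) = ((t + e) + (t + e))%:C%:A.
  rewrite !rmorphD !scalerDl addrACA [_ + d + _]addrACA subrr addr0.
  by rewrite addrACA.
rewrite unormr ger0_norm; last by rewrite !addr_ge0// ltW.
have -> : d + d = 2%:C *: d by rewrite mulr2n rmorphD scalerDl !scale1r.
by rewrite cnormZr ger0_norm// => h; lra.
Qed.

(** With k = |x + s|, the element k - (x + s) is positive, so x lies between 0 and k - s, and
    [npos_norm_le] bounds its norm. *)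
Lemma npos_norm_shift x s : npos x -> 0 <= s ->
  s + cnorm x <= cnorm (x + s%:C%:A).
Proof.
move=> nx s0; set k := cnorm (x + _).
have nk : npos ((k - s)%:C%:A - x).
  rewrite rmorphB scalerBl -addrA -opprD (addrC _ x); apply: npos_normB => //.
  by apply: saD; [exact: nx.1|exact: sau_r].
have ks : 0 <= k - s.
  by have := nposD nk nx; rewrite subrK => /npos_scalar.
rewrite addrC -lerBrDr; apply: npos_norm_le => //.
by apply: nposD => //; apply/npos_scalar.
Qed.

End Positivity.

Lemma double_inj (R : realType) (A : cstarAlgType R) (a b : A) :
  a + a = b + b -> a = b.
Proof. by move=> ab; rewrite -[LHS]two_halves ab two_halves. Qed.

(** * Positivity of b^* b *)

Section StarPositive.
Context {R : realType} {A : cstarAlgType R} {u : A} (hu : is_one u).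
Local Notation B := (uring hu).
Implicit Types (x y z a b c d w : B) (r s t e : R).

Let i2 : 'i * 'i = -1 :> R[i].
Proof. by rewrite -expr2 sqr_i. Qed.

(* [w w^*] and [w^* w] sum to a sum of two squares of self-adjoint elements, so
   an upper bound on [w^* w] makes [w w^*] almost positive; then
   [(w w^* + s)^2 = s^2 + w (w^* w + 2 s) w^*] is too small unless [w] is. *)
Lemma star_upper_bound w r : 0 <= r -> npos (r%:C%:A - cstar w * w) ->
  cnorm w ^+ 2 <= 9 * r.
Proof.
move=> r0 nw; pose p := w * cstar w; pose q := cstar w * w.
set n := cnorm w ^+ 2.
have n0 : 0 <= n by rewrite exprn_ge0// cnorm_ge0.
have sp : sa B p by rewrite /sa/= ustarM cstarK.
have pn : cnorm p = n by rewrite /p -{1}[w]cstarK unorm_starM cnorm_star.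
have qn : cnorm q = n by rewrite unorm_starM.
have sq : sa B q by exact: sa_starM.
have np : npos (p + r%:C%:A).
  pose h : B := w + cstar w; pose k : B := 'i *: (w - cstar w).
  have sh : sa B h by rewrite /sa/= cstarD cstarK addrC.
  have sk : sa B k.
    rewrite /sa/= cstarZ cstarB cstarK -[cstar w - w]opprB scalerN -scaleNr.
    by congr (_ *: _); apply/eqP; rewrite eq_complex /= oppr0 opprK !eqxx.
  have hk : h * h + k * k = (p + q) + (p + q).
    rewrite /k -scalerAl -scalerAr scalerA i2 scaleN1r.
    have -> : h * h = w * w + cstar w * cstar w + (p + q).
      by rewrite /h mulrDl !mulrDr (addrC (cstar w * w)) addrACA.
    have -> : (w - cstar w) * (w - cstar w) = w * w + cstar w * cstar w - (p + q).
      by rewrite mulrBl !mulrBr opprB addrACA -opprD.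
    by rewrite opprB addrC addrA subrK.
  have -> : p + r%:C%:A = 2^-1%:C *: (h * h) + 2^-1%:C *: (k * k) + (r%:C%:A - q).
    by rewrite -scalerDr hk two_halves addrACA subrr addr0.
  by do 2?apply: nposD => //; apply: nposZ; rewrite ?invr_ge0//; exact: npos_sqr.
have lo := npos_norm_shift np n0.
have lo1 : n <= cnorm (p + r%:C%:A) + r.
  rewrite -[in leLHS]pn -{1}[p](addrK r%:C%:A) (le_trans (cnormB _ _))//.
  by rewrite unormr ger0_norm.
have lo2 : cnorm (p + r%:C%:A + n%:C%:A) <= cnorm (p + n%:C%:A) + r.
  by rewrite addrAC (le_trans (cnormD _ _))// unormr ger0_norm.
have up : cnorm (q + (2 * n)%:C%:A) <= 2 * n + r.
  apply: npos_norm_le.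
    by rewrite rmorphD scalerDl opprD [- q - _]addrC addrACA subrr add0r.
  rewrite addrC -addrA -scalerDl -rmorphD addrC; apply: npos_normD => //.
  by rewrite qn; lra.
have sq2 : cnorm (p + n%:C%:A) ^+ 2 <= n ^+ 2 + n * (2 * n + r).
  have sn : sa B (p + n%:C%:A) by apply: saD => //; exact: sau_r.
  rewrite -usa_norm//.
  have -> : (p + n%:C%:A) * (p + n%:C%:A) =
      (n ^+ 2)%:C%:A + w * (q + (2 * n)%:C%:A) * cstar w.
    rewrite mulrDr mulrDl mulrDl !mulr_algl !mulr_algr scalerA -rmorphM -(expr2 n).
    rewrite [w * (_ + _)]mulrDr mulrDl mulr_algr -scalerAl -/p addrA [RHS]addrC.
    congr (_ + _); rewrite -addrA; congr (_ + _); first by rewrite /p /q !mulrA.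
    by rewrite mulr2n mulrDl mul1r rmorphD scalerDl.
  rewrite (le_trans (cnormD _ _))// lerD//.
    by rewrite unormr ger0_norm// exprn_ge0.
  rewrite (le_trans (unormM _ _))// cnorm_star.
  rewrite (le_trans (ler_wpM2r _ (unormM _ _))) ?cnorm_ge0//.
  by rewrite mulrAC -expr2 ler_wpM2l.
(* The bounds [lo], [lo1], [lo2] give |p + n| >= 2 n - 2 r. If n > r, squaring and comparing with 3
   n^2 + n r leaves n^2 + 4 r^2 <= 9 n r. *)
have [|rn] := leP n (9 * r) => //; nra.
Qed.

(** The number |x| can serve as t in [npos] for every x + e at once, up to an error e, so the
    witness survives e -> 0. *)
Lemma npos_closed x : sa B x -> (forall e, 0 < e -> npos (x + e%:C%:A)) ->
  npos x.
Proof.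
move=> sx nx; split=> //; exists (cnorm x); apply/ler_addgt0Pr => e e0.
apply: npos_norm_le.
  by rewrite rmorphD scalerDl opprB addrC addrA subrK; exact: nx.
rewrite addrA -scalerDl -rmorphD; apply: npos_normB => //.
by have := cnorm_ge0 x; lra.
Qed.

(** The factor 19 is the one met in [npos_starM], and 5 is the first integer whose square exceeds
    it. *)
Lemma cubic_le n e : 0 <= n -> 0 < e -> n ^+ 3 <= 19 * e ^+ 2 * n -> n <= 5 * e.
Proof.
move=> n0 e0; have [//|ne] := leP n (5 * e).
have n_gt0 : 0 < n by lra.
by rewrite exprSr ler_pM2r// => h; nra.
Qed.

(* With [x = b^* b], [y = sqrt (x^2 + e^2)] and [a = y - x], the element
   [w = b a] has [w^* w = e^2 a - y a^2 <= e^2 |a|], so [w], hence [a], is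
   small: the spectrum of [x] cannot reach far below [0]. *)
Lemma npos_starM b : npos (cstar b * b).
Proof.
have [x xE] : exists x, x = cstar b * b by exists (cstar b * b).
have sx : sa B x by rewrite xE; exact: sa_starM.
rewrite -xE.
suff small e : 0 < e -> npos (x + (5 * e)%:C%:A).
  apply: npos_closed => // e e0.
  by rewrite (_ : e = 5 * (e / 5)); [apply: small; rewrite divr_gt0|field].
move=> e0; have e2 : 0 < e ^+ 2 by rewrite exprn_gt0.
have [_ [t xt]] := npos_sqr sx.
have t0 : 0 <= t by apply: le_trans xt; exact: cnorm_ge0.
have [|||y [sy [s s0 ys] yw ye]] := @sqrt_near _ _ _ hu (x * x + (e ^+ 2)%:C%:A) (t + e ^+ 2).
- by apply: saD; [exact: sau_sqr|exact: sau_r].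
- by rewrite ltr_wpDl.
- rewrite rmorphD scalerDl opprD addrACA subrr addr0.
  by rewrite (le_lt_trans xt)// ltrDl.
have [c [sc _ cw ce]] := sqrt_near sy s0 ys.
have yx : y * x = x * y.
  by apply/esym/yw; apply: commrD; [exact: commrM|exact: comm_scalar].
pose a := y - x; have sa_a : sa B a by exact: saB.
have ya : y * a = a * y by rewrite /a mulrBr mulrBl yx.
have ca : c * a = a * c by apply/esym/cw; rewrite /GRing.comm ya.
have e2E : (e ^+ 2)%:C%:A = a * (y + x).
  by rewrite mulrBl !mulrDr yx opprD addrA addrK ye addrC addKr.
have ax : a * x + a * x = (e ^+ 2)%:C%:A - a * a.
  have -> : a * a = a * (y + x) - (a * x + a * x).
    by rewrite -!mulrDr -mulrBr opprD addrACA subrr addr0.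
  by rewrite opprB addrCA -e2E subrr addr0.
have a2y : a * a + (e ^+ 2)%:C%:A = y * a + y * a.
  rewrite ya e2E -!mulrDr addrCA; congr (_ * (_ + _)).
  by rewrite subrK.
have xya : x = y - a by rewrite subKr.
clearbody a; pose w := b * a.
have wax : cstar w * w = a * x * a by rewrite ustarM sa_a xE !mulrA.
have wE : cstar w * w = (e ^+ 2)%:C *: a - c * a * (c * a).
  have -> : c * a * (c * a) = y * a * a by rewrite -ce -!mulrA [a * (c * a)]mulrA -ca -mulrA.
  rewrite wax.
  apply: (@double_inj _ B); rewrite -mulrDl ax addrACA -opprD -[_ * a + _ * a]mulrDl -a2y.
  rewrite mulrBl [_ * a in RHS]mulrDl !mulr_algl.
  by rewrite opprD [- _ - _]addrC addrACA subrr add0r.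
have sca : sa B (c * a) by rewrite /sa/= ustarM sc sa_a.
have nw : cnorm w ^+ 2 <= 9 * (e ^+ 2 * cnorm a).
  apply: star_upper_bound; first by rewrite mulr_ge0 ?cnorm_ge0// ltW.
  rewrite wE opprB addrCA rmorphM -scalerA -scalerBr; apply: nposD.
    exact: npos_sqr.
  by apply: nposZ; [exact: ltW|exact: npos_normB].
have a3 : a * a * a = (e ^+ 2)%:C *: a - 2%:C *: (cstar w * w).
  have -> : 2%:C *: (cstar w * w) = cstar w * w + cstar w * w.
    by rewrite mulr2n rmorphD scalerDl !scale1r.
  rewrite wax -mulrDl ax.
  by rewrite mulrBl mulr_algl subKr.
(* Here 19 = 1 + 2 * 9, from the formula for a^3 and the bound on |w|^2. Since a is self-adjoint,
   |a|^4 = |a^4| <= |a^3| |a|, which bounds |a|^3 by |a^3|. *)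
have na3 : cnorm a ^+ 3 <= 19 * e ^+ 2 * cnorm a.
  have le1 : cnorm (a * a * a) <= 19 * e ^+ 2 * cnorm a.
    rewrite a3 (le_trans (cnormB _ _))// !cnormZr unorm_starM.
    by rewrite (ger0_norm (ltW e2)) ger0_norm//; lra.
  apply: le_trans le1; have [a0|a0] := eqVneq (cnorm a) 0.
    by rewrite a0 expr0n cnorm_ge0.
  have a_gt0 : 0 < cnorm a by rewrite lt_neqAle eq_sym a0 cnorm_ge0.
  rewrite -(ler_pM2r a_gt0) -exprSr -[4%N]/(2 * 2)%N exprM -usa_norm//.
  by rewrite -usa_norm ?mulrA ?unormM//; exact: sau_sqr.
have a5 : cnorm a <= 5 * e by apply: cubic_le => //; exact: cnorm_ge0.
rewrite xya -addrA; apply: nposD; last by rewrite addrC; exact: npos_normB.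
by split=> //; exists s; exact: ltW.
Qed.
End StarPositive.

(** * States *)

Section Sublinear.
Context {R : realType} {V : lmodType R[i]}.
Implicit Types (p q f : V -> R) (x y : V) (r s t : R).

(** The space is complex but only real scalars act, so the linear functionals obtained are
    real-linear. The reverse inequality in the second clause follows by rescaling with 1 / t; see
    [sublinearZ_ge]. *)
Definition sublinear q : Prop :=
  (forall x y, q (x + y) <= q x + q y) /\
  (forall t x, 0 <= t -> q (t%:C *: x) <= t * q x).

Lemma sublinear0 q : sublinear q -> q 0 = 0.
Proof.
move=> [qD qZ]; apply/le_anti/andP; split.
  by have := qZ 0 0 (lexx 0); rewrite scaler0 mul0r.
by have := qD 0 0; rewrite addr0 lerDl.
Qed.

Lemma sublinearN q x : sublinear q -> - q (- x) <= q x.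
Proof.
move=> sq; rewrite -subr_ge0 opprK -(sublinear0 sq) -(subrr x).
exact: sq.1.
Qed.

Lemma sublinearZ_ge q t x : sublinear q -> 0 <= t -> t * q x <= q (t%:C *: x).
Proof.
move=> sq; rewrite le_eqVlt => /predU1P[<-|t0].
  by rewrite mul0r scale0r sublinear0.
have := sq.2 t^-1 (t%:C *: x); rewrite scalerA -rmorphM mulVf ?gt_eqF// scale1r.
by rewrite ler_pdivlMl// => -> //; rewrite invr_ge0 ltW.
Qed.

(** For sublinear q this lies below q and its value at - y is at most - q y, so a linear functional
    below it takes the value q y at y. *)
Definition sublinear_shift q y x : R :=
  inf [set r | exists2 t, 0 <= t & r = q (x + t%:C *: y) - t * q y].

(** This bound makes the infimum genuine: on a set without lower bound [inf] has a default value. *)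
Lemma sublinear_shift_lb q y x : sublinear q ->
  lbound [set r | exists2 t, 0 <= t & r = q (x + t%:C *: y) - t * q y]
    (- q (- x)).
Proof.
move=> sq _ [t t0 ->]; rewrite lerBrDr addrC.
rewrite (le_trans (lerB (sublinearZ_ge _ sq t0) (lexx _)))//.
by rewrite lerBlDr (le_trans _ (sq.1 _ _))// addrAC subrr add0r.
Qed.

Lemma sublinear_shift_le q y x t : sublinear q -> 0 <= t ->
  sublinear_shift q y x <= q (x + t%:C *: y) - t * q y.
Proof.
move=> sq t0; apply: ge_inf; last by exists t.
by exists (- q (- x)); exact: sublinear_shift_lb.
Qed.

Lemma le_sublinear_shift q y x r :
  (forall t, 0 <= t -> r <= q (x + t%:C *: y) - t * q y) ->
  r <= sublinear_shift q y x.
Proof.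
move=> h; apply: lb_le_inf; last by move=> _ [t t0 ->]; exact: h.
by exists (q (x + 0%:C *: y) - 0 * q y); exists 0.
Qed.

Lemma sublinear_shift_sublinear q y : sublinear q ->
  sublinear (sublinear_shift q y).
Proof.
move=> sq; split=> [x z|s x s0].
  rewrite -lerBlDr; apply: le_sublinear_shift => t t0.
  rewrite lerBlDr -lerBlDl; apply: le_sublinear_shift => s s0.
  rewrite lerBlDl (le_trans (sublinear_shift_le _ _ sq (addr_ge0 t0 s0)))//.
  rewrite rmorphD scalerDl addrACA.
  by have := sq.1 (x + t%:C *: y) (z + s%:C *: y); lra.
move: s0; rewrite le_eqVlt => /predU1P[<-|s0].
  rewrite scale0r mul0r (le_trans (sublinear_shift_le _ _ sq (lexx 0)))//.
  by rewrite add0r scale0r sublinear0// mul0r subrr.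
rewrite -ler_pdivrMl//; apply: le_sublinear_shift => t t0.
rewrite ler_pdivrMl// (le_trans (sublinear_shift_le _ _ sq (mulr_ge0 (ltW s0) t0)))//.
rewrite rmorphM -scalerA -scalerDr.
by have := sq.2 s (x + t%:C *: y) (ltW s0); lra.
Qed.

Lemma minimal_sublinear p : sublinear p ->
  exists q, [/\ sublinear q, forall x, q x <= p x &
    forall q', sublinear q' -> (forall x, q' x <= q x) -> q' = q].
Proof.
move=> sp.
pose T := {q | sublinear q /\ forall x, q x <= p x}.
(* The order is reversed, so that a maximal element for Zorn's lemma is a minimal functional. *)
pose le (q1 q2 : T) := `[< forall x, sval q2 x <= sval q1 x >].
have [||||[q [sq qp]] qmin] := @Zorn T le.
- by move=> q; apply/asboolP.
- move=> q1 q2 q3 /asboolP h1 /asboolP h2; apply/asboolP => x.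
  exact: le_trans (h2 x) (h1 x).
- move=> [q1 h1] [q2 h2] /asboolP/= le1 /asboolP/= le2; apply: eq_exist.
  by apply/funext => x; apply/le_anti; rewrite le1 le2.
- move=> C totC; have [[q0 Cq0]|C0] := pselect (C !=set0); last first.
    have sp' : sublinear p /\ forall x, p x <= p x by [].
    by exists (exist _ p sp') => q Cq; exfalso; apply: C0; exists q.
  pose m x := inf [set sval q x | q in C].
  have mlb x : has_lbound [set sval q x | q in C].
    exists (- p (- x)) => _ [[q [sq qp]] _ <-] /=.
    by rewrite (le_trans _ (sublinearN x sq))// lerN2.
  have m_le (q : T) x : C q -> m x <= sval q x by move=> Cq; apply: ge_inf => //; exists q.
  have le_m x r : (forall q : T, C q -> r <= sval q x) -> r <= m x.
    move=> h; apply: lb_le_inf; first by exists (sval q0 x); exists q0.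
    by move=> _ [q Cq <-]; exact: h.
  (* Subadditivity of a pointwise infimum uses the chain: of two members, the smaller one bounds the
     value at x + y by the sum of the two given values. *)
  have sm : sublinear m.
    split=> [x y|t x t0].
      rewrite -lerBlDr; apply: (le_m) => q1 Cq1.
      rewrite lerBlDr -lerBlDl; apply: (le_m) => q2 Cq2.
      rewrite lerBlDl.
      have [/asboolP le12|/asboolP le21] := totC _ _ Cq1 Cq2.
        rewrite (le_trans (m_le _ _ Cq2))// (le_trans ((svalP q2).1.1 _ _))//.
        by rewrite lerD2r.
      rewrite (le_trans (m_le _ _ Cq1))// (le_trans ((svalP q1).1.1 _ _))//.
      by rewrite lerD2l.
    move: t0; rewrite le_eqVlt => /predU1P[<-|t0].
      rewrite scale0r mul0r (le_trans (m_le _ _ Cq0))//.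
      by rewrite (sublinear0 (svalP q0).1).
    rewrite -ler_pdivrMl//; apply: (le_m) => q Cq; rewrite ler_pdivrMl//.
    by rewrite (le_trans (m_le _ _ Cq))// (svalP q).1.2// ltW.
  have mp x : m x <= p x by rewrite (le_trans (m_le _ _ Cq0))// (svalP q0).2.
  exists (exist _ m (conj sm mp)) => q Cq; apply/asboolP => x /=; exact: m_le.
exists q; split=> // q' sq' q'q.
have q'p x : q' x <= p x by exact: le_trans (q'q x) (qp x).
by have /(congr1 sval) := qmin (exist _ q' (conj sq' q'p)) (asboolT q'q).
Qed.

(* A sublinear functional that is minimal is linear; minimality below the shift
   of [p] along [y] forces the value at [y]. *)
Lemma hahn_banach p y : sublinear p -> exists f,
  [/\ forall x z, f (x + z) = f x + f z, forall t x, f (t%:C *: x) = t * f x,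
      forall x, f x <= p x & f y = p y].
Proof.
move=> sp; have [f [sf fle fmin]] := minimal_sublinear (sublinear_shift_sublinear y sp).
have fp x : f x <= p x.
  rewrite (le_trans (fle x))// (le_trans (sublinear_shift_le _ _ sp (lexx 0)))//.
  by rewrite scale0r addr0 mul0r subr0.
have shiftN q z : sublinear q -> sublinear_shift q z (- z) <= - q z.
  move=> sq; rewrite (le_trans (sublinear_shift_le _ _ sq ler01))//.
  by rewrite scale1r addNr sublinear0// mul1r sub0r.
(* By minimality f equals its own shift along every x, so f (- x) <= - f x; subadditivity gives the
   other inequality. *)
have fN x : f (- x) = - f x.
  have fE : sublinear_shift f x = f.
    apply: fmin; first exact: sublinear_shift_sublinear.
    move=> z; rewrite (le_trans (sublinear_shift_le _ _ sf (lexx 0)))//.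
    by rewrite scale0r addr0 mul0r subr0.
  apply/le_anti; rewrite -{1}fE shiftN//=.
  by have := sublinearN (- x) sf; rewrite opprK.
have fD x z : f (x + z) = f x + f z.
  apply/le_anti; rewrite sf.1 /= -lerN2 -fN !opprD -!fN.
  exact: sf.1.
have fZ0 t x : 0 <= t -> f (t%:C *: x) = t * f x.
  by move=> t0; apply/le_anti; rewrite sf.2//= sublinearZ_ge.
exists f; split => //.
  move=> t x; have [/fZ0//|t0] := leP 0 t.
  rewrite -[t]opprK rmorphN scaleNr fN fZ0 ?mulNr// oppr_ge0; exact: ltW.
apply/le_anti; rewrite fp /= -lerN2 -fN (le_trans (fle _))//.
exact: shiftN.
Qed.

End Sublinear.

Lemma normr_normc (R : realType) (z : R[i]) : `|z| = (normc z)%:C.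
Proof. by rewrite normc_def; case: z. Qed.

Lemma Re_realM (R : realType) (t : R) (z : R[i]) :
  complex.Re (t%:C * z) = t * complex.Re z.
Proof. by case: z => p q /=; ring. Qed.

Lemma Im_realM (R : realType) (t : R) (z : R[i]) :
  complex.Im (t%:C * z) = t * complex.Im z.
Proof. by case: z => p q /=; ring. Qed.

Lemma Re_iM (R : realType) (z : R[i]) : complex.Re ('i * z) = - complex.Im z.
Proof. by case: z => p q /=; ring. Qed.

Lemma Re_add (R : realType) (z w : R[i]) :
  complex.Re (z + w) = complex.Re z + complex.Re w.
Proof. by case: z; case: w. Qed.

Lemma normc_ge0 (R : realType) (z : R[i]) : 0 <= normc z.
Proof. by case: z => p q; rewrite sqrtr_ge0. Qed.

Lemma normc_conj (R : realType) (z : R[i]) : normc z^* = normc z.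
Proof. by case: z => p q; rewrite /= sqrrN. Qed.

(** * Positive functionals on a unital algebra *)

Section PositiveFunctionals.
Context {R : realType} {A : cstarAlgType R}.
Implicit Types (a b h x : A) (phi : A -> R[i]).

Lemma scalarD phi a b : scalar phi -> phi (a + b) = phi a + phi b.
Proof. by move=> lphi; have := lphi 1 a b; rewrite scale1r mul1r. Qed.

Lemma scalar_fun0 phi : scalar phi -> phi 0 = 0.
Proof. by move=> lphi; apply: (addrI (phi 0)); rewrite -scalarD// !addr0. Qed.

Lemma scalar_funZ phi z a : scalar phi -> phi (z *: a) = z * phi a.
Proof.
by move=> lphi; have := lphi z a 0; rewrite !addr0 scalar_fun0// addr0.
Qed.

Lemma scalar_funN phi a : scalar phi -> phi (- a) = - phi a.
Proof. by move=> lphi; rewrite -scaleN1r scalar_funZ// mulN1r. Qed.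

Lemma scalar_funB phi a b : scalar phi -> phi (a - b) = phi a - phi b.
Proof. by move=> lphi; rewrite scalarD// scalar_funN. Qed.

Lemma ipart_cartesian a b : sa A a -> sa A b -> ipart (a + 'i *: b) = b.
Proof.
move=> sa_a sa_b; rewrite /ipart cstarD cstarZ sa_a sa_b opprD addrACA subrr add0r.
have -> : 'i^* *: b - 'i *: b = ('i^* - 'i) *: b by rewrite scalerBl.
rewrite [X in _ *: X]scalerA (_ : _ * _ = 1 + 1); last first.
  by apply/eqP; rewrite eq_complex /=; apply/andP; split; apply/eqP; ring.
by rewrite scalerDl !scale1r two_halves.
Qed.

(** This reads off the real and imaginary parts of z a + b, from which the complex linearity of the
    state built in [spectral_state] is checked. *)
Lemma cartesianZD z a b : z *: a + b =
  ((complex.Re z)%:C *: rpart a - (complex.Im z)%:C *: ipart a + rpart b) +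
  'i *: ((complex.Im z)%:C *: rpart a + (complex.Re z)%:C *: ipart a + ipart b).
Proof.
rewrite {1}(parts_eq a) {1}(parts_eq b).
set a1 := rpart a; set a2 := ipart a; set b1 := rpart b; set b2 := ipart b.
have zE : z = (complex.Re z)%:C + 'i * (complex.Im z)%:C := complexE z.
move: (complex.Re z) (complex.Im z) zE => r t zE.
move: a1 a2 b1 b2 => a1 a2 b1 b2.
have ziE : z * 'i = - t%:C + 'i * r%:C.
  rewrite zE mulrDl mulrAC -(expr2 'i) sqr_i mulN1r addrC.
  by congr (_ + _); rewrite mulrC.
rewrite [in RHS]scalerDr addrACA; congr (_ + _).
rewrite scalerDr scalerA ziE {1}zE !scalerDl scaleNr -!scalerA.
by rewrite [in RHS]scalerDr addrACA.
Qed.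

Lemma rpartZD z a b : rpart (z *: a + b) =
  (complex.Re z)%:C *: rpart a - (complex.Im z)%:C *: ipart a + rpart b.
Proof.
rewrite {1}cartesianZD rpart_cartesian//.
  by apply: saD (sa_rpart b); apply: saB; apply: saZ; [exact: sa_rpart|exact: sa_ipart].
by apply: saD (sa_ipart b); apply: saD; apply: saZ; [exact: sa_rpart|exact: sa_ipart].
Qed.

Lemma ipartZD z a b : ipart (z *: a + b) =
  (complex.Im z)%:C *: rpart a + (complex.Re z)%:C *: ipart a + ipart b.
Proof.
rewrite {1}cartesianZD ipart_cartesian//.
  by apply: saD (sa_rpart b); apply: saB; apply: saZ; [exact: sa_rpart|exact: sa_ipart].
by apply: saD (sa_ipart b); apply: saD; apply: saZ; [exact: sa_rpart|exact: sa_ipart].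
Qed.

Context {u : A} (hu : is_one u).

Lemma sa_one : sa A u. Proof. exact: (ustar1 hu). Qed.

Lemma cnorm_one : cnorm u = 1. Proof. exact: (unorm1 hu). Qed.

(** If |x| < t then t - x = c^* c for a self-adjoint c, so t phi(1) - phi(x) is a nonnegative real.
    Its being real kills the imaginary part; t tending to |x| gives the bound. *)
Lemma positive_functional_sa phi h : positive_functional phi -> sa A h ->
  complex.Im (phi h) = 0 /\ `|complex.Re (phi h)| <= complex.Re (phi u) * cnorm h.
Proof.
move=> [lphi phi0] sh.
have phi_u : 0 <= phi u.
  have := phi0 u; rewrite sa_one (_ : cmul u u = u)//.
  by have [_ /(_ u) []] := hu.
have key x t : sa A x -> cnorm x < t -> 0 <= t%:C * phi u - phi x.
  move=> sx xt; have t0 : 0 < t by apply: le_lt_trans xt; exact: cnorm_ge0.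
  have [|||c [sc _ _ ce]] := @sqrt_near _ _ _ hu (t%:C *: u - x) t.
  - by apply: saB => //; apply: saZ; exact: sa_one.
  - by [].
  - by rewrite opprB addrC subrK.
  rewrite -scalar_funZ// -scalar_funB//.
  suff <- : @cmul R A (@cstar R A c) c = t%:C *: u - x by exact: phi0.
  have -> : @cstar R A c = c by exact: sc.
  exact: ce.
have im0 : complex.Im (phi h) = 0.
  have := key h (cnorm h + 1) sh; rewrite ltrDl ltr01 => /(_ isT).
  move=> /ger0_Im; rewrite raddfB/= => /eqP; rewrite subr_eq0 => /eqP <-.
  by rewrite Im_realM (ger0_Im phi_u) mulr0.
have phi_re : 0 <= complex.Re (phi u) by move: phi_u; rewrite lecE => /andP[].
have bound x t : sa A x -> cnorm x < t -> complex.Re (phi x) <= t * complex.Re (phi u).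
  move=> sx /(key _ _ sx); rewrite lecE => /andP[_]; rewrite raddfB/= subr_ge0.
  by rewrite Re_realM.
have bound1 x : sa A x -> complex.Re (phi x) <= complex.Re (phi u) * cnorm x.
  move=> sx; apply/ler_addgt0Pr => e e0.
  have d0 : 0 < e / (complex.Re (phi u) + 1) by rewrite divr_gt0// ltr_wpDl.
  have := bound x (cnorm x + e / (complex.Re (phi u) + 1)) sx.
  rewrite ltrDl d0 => /(_ isT)/le_trans; apply.
  rewrite mulrDl mulrC lerD2l mulrAC -mulrA ler_piMr ?(ltW e0)//.
  by rewrite ler_pdivrMr ?mul1r ?lerDl// ltr_wpDl.
split => //; rewrite ler_norml bound1// andbT.
rewrite lerNl -raddfN -scalar_funN//= -(cnormN h) bound1//; exact: saN.
Qed.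

Lemma positive_functional_real phi h : positive_functional phi -> sa A h ->
  phi h = (complex.Re (phi h))%:C.
Proof.
move=> pphi sh; rewrite {1}[phi h]complexE (positive_functional_sa pphi sh).1.
by rewrite mulr0 addr0.
Qed.

(** Multiplying a by a phase z makes phi (z a) = |phi a|. Then phi (z a) is the value at the
    self-adjoint real part of z a, where the bound is known; no Cauchy-Schwarz inequality is
    involved. *)
Lemma positive_functional_bound phi a : positive_functional phi ->
  normc (phi a) <= complex.Re (phi u) * cnorm a.
Proof.
move=> pphi; have lphi := pphi.1.
have [->|a0] := eqVneq (phi a) 0.
  rewrite ComplexField.Normc.normc0.
  have [_ h] := positive_functional_sa pphi sa_one.
  by rewrite mulr_ge0 ?cnorm_ge0// -[leRHS]mulr1 -cnorm_one (le_trans _ h).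
pose n := normc (phi a).
have n0 : 0 < n.
  rewrite lt_neqAle normc_ge0 andbT eq_sym.
  by apply: contra a0 => /eqP/ComplexField.Normc.eq0_normc ->.
pose z : R[i] := (n%:C)^-1 * (phi a)^*.
have z1 : normc z = 1.
  rewrite ComplexField.Normc.normcM ComplexField.Normc.normcV normc_conj.
  by rewrite normc_real gtr0_norm// mulVf ?gt_eqF.
have phiz : phi (z *: a) = n%:C.
  rewrite scalar_funZ// /z -mulrA [_^* * _]mulrC -sqr_normc normr_normc -/n.
  rewrite expr2 mulrA mulVf ?mul1r//.
  by rewrite eq_complex /= negb_and gt_eqF.
have [im_i _] := positive_functional_sa pphi (sa_ipart (z *: a)).
have [_ re_r] := positive_functional_sa pphi (sa_rpart (z *: a)).
have phi_u : 0 <= complex.Re (phi u).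
  have [_ h] := positive_functional_sa pphi sa_one.
  by rewrite -[leRHS]mulr1 -cnorm_one (le_trans _ h).
have nE : n = complex.Re (phi (rpart (z *: a))).
  rewrite -[LHS]/(complex.Re n%:C) -phiz {1}(parts_eq (z *: a)) scalarD// (scalar_funZ 'i)//.
  by rewrite Re_add Re_iM im_i oppr0 addr0.
rewrite -/n nE (le_trans (ler_norm _))// (le_trans re_r)// ler_wpM2l//.
by rewrite (le_trans (cnorm_rpart _))// cnormZ z1 mul1r.
Qed.

Lemma positive_functional_one_ge0 phi : positive_functional phi ->
  phi u = (complex.Re (phi u))%:C /\ 0 <= complex.Re (phi u).
Proof.
move=> pphi; have [im0 h] := positive_functional_sa pphi sa_one; split.
  by rewrite {1}[phi u]complexE im0 mulr0 addr0.
by rewrite -[leRHS]mulr1 -cnorm_one (le_trans _ h).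
Qed.

(** The supremum is attained at the unit, so the states and quasi-states of a unital algebra are
    recognized by one value. *)
Lemma functional_normE phi : positive_functional phi ->
  functional_norm phi = (complex.Re (phi u))%:E.
Proof.
move=> pphi; have [phi_u u0] := positive_functional_one_ge0 pphi.
apply/le_anti/andP; split.
  apply: ge_ereal_sup => _ [->|[a /= a1 <-]]; first by rewrite lee_fin.
  rewrite lee_fin (le_trans (positive_functional_bound a pphi))//.
  by rewrite -[leRHS]mulr1 ler_wpM2l.
apply: ereal_sup_ubound; right; exists u; first by rewrite /= cnorm_one.
by rewrite {1}phi_u normc_real ger0_norm.
Qed.

Lemma stateP phi : state A phi <-> positive_functional phi /\ phi u = 1.
Proof.
split=> [[pphi]|[pphi phi1]]; last by split; rewrite // functional_normE// phi1.
rewrite functional_normE// => -[] h; split=> //.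
by have [-> _] := positive_functional_one_ge0 pphi; rewrite h.
Qed.

Lemma quasi_stateP phi : quasi_state A phi <->
  positive_functional phi /\ complex.Re (phi u) <= 1.
Proof.
split=> [[pphi]|[pphi phi1]]; last by split; rewrite // functional_normE.
by rewrite functional_normE// lee_fin.
Qed.

Lemma state_bound phi a : state A phi -> normc (phi a) <= cnorm a.
Proof.
move=> /stateP[pphi phi1]; rewrite (le_trans (positive_functional_bound a pphi))//.
by rewrite phi1 mul1r.
Qed.

End PositiveFunctionals.

(** * States attaining the spectral bound *)

Section States.
Context {R : realType} {A : cstarAlgType R} {u : A} (hu : is_one u).
Implicit Types (a b d x : A) (phi : A -> R[i]).
Local Notation B := (uring hu).

(* The upper end of the spectrum of a self-adjoint element. *)
Let spec : B -> R := sublinear_shift (@cnorm R B) 1.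

Let cnorm_sublinear : sublinear (@cnorm R B).
Proof.
by split=> [x y|t x t0]; [exact: cnormD|rewrite cnormZr ger0_norm].
Qed.

Let spec_le (x : B) t : 0 <= t -> spec x <= cnorm (x + t%:C%:A) - t.
Proof.
move=> t0; have := sublinear_shift_le 1 x cnorm_sublinear t0.
by rewrite unorm1 mulr1.
Qed.

(** A linear f below [spec] with f d = spec d is normalized because spec 1 <= 1 and spec (- 1) <= -
    1. It is nonnegative on positive x, because |t - x| <= t means spec (- x) <= 0. *)
Lemma spectral_state (d : B) : sa B d -> exists2 phi, state A phi & phi d = (spec d)%:C.
Proof.
move=> sd.
have [f [fD fZ f_le fd]] :=
  hahn_banach d (sublinear_shift_sublinear 1 cnorm_sublinear).
have f1 : f 1 = 1.
  apply/le_anti; apply/andP; split.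
    rewrite (le_trans (f_le _))// (le_trans (spec_le _ (lexx 0)))//.
    by rewrite scale0r addr0 unorm1 subr0.
  have := fZ (-1) 1; rewrite rmorphN scaleN1r mulN1r => f1.
  rewrite -lerN2 -f1 (le_trans (f_le _))// (le_trans (spec_le _ ler01))//.
  by rewrite scale1r addNr cnorm0 sub0r.
have f0 : f 0 = 0 by apply: (addrI (f 0)); rewrite -fD !addr0.
have fN x : f (- x) = - f x.
  by apply: (addrI (f x)); rewrite -fD !subrr f0.
have f_pos (x : B) : npos x -> 0 <= f x.
  move=> [sx [t xt]]; rewrite -oppr_le0 -fN (le_trans (f_le _))//.
  have t0 : 0 <= t by apply: le_trans xt; exact: cnorm_ge0.
  rewrite (le_trans (spec_le _ t0))// subr_le0 [- x + _]addrC; exact: xt.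
(* Only the restriction of f to the self-adjoint part is kept, and extended complex-linearly. *)
pose phi (x : A) : R[i] := (f (rpart x))%:C + 'i * (f (ipart x))%:C.
have phi_sa x : sa A x -> phi x = (f x)%:C.
  move=> sx; rewrite /phi rpart_sa// /ipart sx subrr !scaler0 f0.
  by rewrite mulr0 addr0.
exists phi; last by rewrite phi_sa// fd.
apply/(stateP hu); split; last by rewrite phi_sa ?f1//; exact: (ustar1 hu).
split=> [[p q] a b|a].
  rewrite /phi rpartZD ipartZD !fD fN !fZ.
  by apply/eqP; rewrite eq_complex /=; apply/andP; split; apply/eqP; ring.
rewrite phi_sa ?ler0c; last exact: sa_starM.
exact/f_pos/(@npos_starM _ _ _ hu).
Qed.

Lemma unital_state : exists phi, state A phi.
Proof. by have [phi sphi _] := spectral_state (@sa0 _ B); exists phi. Qed.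

(** States attain the spectral bounds of d and - d, so both are at most t. This makes t + e - d and
    t + e + d positive, and [npos_norm_le] concludes. *)
Lemma sa_norm_le d t : sa A d ->
  (forall phi, state A phi -> normc (phi d) <= t) -> cnorm d <= t.
Proof.
move=> sd dt; apply/ler_addgt0Pr => e e0.
have half (x : B) : sa B x -> (forall phi, state A phi -> normc (phi x) <= t) ->
    npos ((t + e)%:C%:A - x).
  move=> sx xt; have [phi sphi phix] := spectral_state sx.
  have : spec x < t + e.
    rewrite (@le_lt_trans _ _ t) ?ltrDl//.
    by have := xt _ sphi; rewrite phix normc_real; apply: le_trans; exact: ler_norm.
  case/inf_lt.
    by exists (cnorm (x + 0%:C%:A) - 0 * cnorm (1 : B)); exists 0.
  move=> _ [s s0 ->]; rewrite unorm1 mulr1 ltrBlDr => /ltW h.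
  split; first by apply: saB => //; exact: sau_r.
  (* With this witness the element whose norm is to be bounded becomes s + x. *)
  exists (s + (t + e)); rewrite rmorphD scalerDl opprB addrACA subrr addr0.
  by rewrite [_ + x]addrC (addrC s).
apply: (@npos_norm_le _ _ _ hu); first exact: half.
rewrite -[d]opprK; apply: half; first exact: saN.
move=> phi sphi; have [pphi _] := sphi.
by rewrite (scalar_funN d pphi.1) (normcN (phi d)) dt.
Qed.

End States.

(** * Quantum compact metric spaces *)

Section StarMorphisms.
Context {R : realType} {D A : cstarAlgType R}.
Implicit Types (pi : D -> A).

Lemma is_one_uniq (u v : A) : is_one u -> is_one v -> u = v.
Proof.
by move=> [_ hu] [_ hv]; have [<- _] := hv u; have [_ ->] := hu v.
Qed.

Lemma star_epimorphism_one pi (uD : D) (uA : A) :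
  is_one uD -> is_one uA -> star_epimorphism pi -> pi uD = uA.
Proof.
move=> hD [_ hA] [[_ piM _] surj].
have [d _ dE] := surj uA I.
have [_ <-] := hA (pi uD); rewrite -dE -piM.
by have [_ /(_ d) [->]] := hD.
Qed.

Context {uD : D} {uA : A} (hD : is_one uD) (hA : is_one uA).
Context (pi : D -> A) (piP : star_morphism pi) (pi1 : pi uD = uA).

Lemma star_morphismD a b : pi (a + b) = pi a + pi b.
Proof. by case: piP => lpi _ _; have := lpi 1 a b; rewrite !scale1r. Qed.

Lemma star_morphism0 : pi 0 = 0.
Proof. by apply: (addrI (pi 0)); rewrite -star_morphismD !addr0. Qed.

Lemma star_morphismZ z a : pi (z *: a) = z *: pi a.
Proof.
by case: piP => lpi _ _; have := lpi z a 0; rewrite star_morphism0 !addr0.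
Qed.

Lemma star_morphismB a b : pi (a - b) = pi a - pi b.
Proof. by rewrite star_morphismD -scaleN1r star_morphismZ scaleN1r. Qed.

Lemma star_morphism_sa d : sa D d -> sa A (pi d).
Proof. by case: piP => _ _ piS sd; rewrite /sa/= -piS sd. Qed.

(** If |y| < t then t - y is a square, and so is its image t - pi y. For self-adjoint x this applies
    to x and - x; the general case follows from the C*-identity. *)
Lemma star_morphism_contractive d : cnorm (pi d) <= cnorm d.
Proof.
have [_ piM piS] := piP.
have sa_le x : sa D x -> cnorm (pi x) <= cnorm x.
  move=> sx; apply/ler_addgt0Pr => e e0; set t := cnorm x + e.
  have half y : sa D y -> cnorm y < t -> npos (hu := hA) (t%:C *: uA - pi y).
    move=> sy yt.
    have t0 : 0 < t by apply: le_lt_trans yt; exact: cnorm_ge0.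
    have [|||c [sc _ _ ce]] := @sqrt_near _ _ _ hD (t%:C *: uD - y) t.
    - by apply: saB => //; apply: saZ; exact: (sa_one hD).
    - by [].
    - by rewrite opprB addrC subrK.
    have <- : cmul (pi c) (pi c) = t%:C *: uA - pi y.
      rewrite -piM -pi1 -star_morphismZ -star_morphismB; congr pi; exact: ce.
    by apply: (@npos_sqr _ _ _ hA); exact: star_morphism_sa.
  apply: (@npos_norm_le _ _ _ hA); first by apply: half => //; rewrite ltrDl.
  have -> : pi x = - pi (- x).
    by rewrite -[- x]scaleN1r star_morphismZ scaleN1r opprK.
  by apply: half; [exact: saN|rewrite cnormN ltrDl].
rewrite -(ler_pXn2r (n := 2))// ?nnegrE ?cnorm_ge0//.
rewrite -!cnorm_starM -piS -piM; apply: sa_le; exact: sa_starM.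
Qed.

Lemma positive_functional_comp psi :
  positive_functional psi -> positive_functional (psi \o pi).
Proof.
have [_ piM piS] := piP.
move=> [lpsi psi0]; split=> [z a b|a] /=.
  by rewrite star_morphismD star_morphismZ lpsi.
by rewrite piM piS psi0.
Qed.

Lemma state_comp psi : state A psi -> state D (psi \o pi).
Proof.
move=> /(stateP hA)[ppsi psi1]; apply/(stateP hD); rewrite /= pi1; split=> //.
exact: positive_functional_comp.
Qed.

End StarMorphisms.

(** * Lipschitz seminorms and the distances they induce on states *)

Section Lipschitz.
Context {R : realType} {A : cstarAlgType R}.
Implicit Types (L : lipschitz_data A) (a b x : A) (phi psi mu : A -> R[i]) (r : R).

Lemma esup_ge0 (X : set (\bar R)) : (0 <= esup X)%E.
Proof. by apply: ereal_sup_ubound; left. Qed.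

Lemma esup_ubound (X : set (\bar R)) (x : \bar R) : X x -> (x <= esup X)%E.
Proof. by move=> Xx; apply: ereal_sup_ubound; right. Qed.

Lemma ge_esup (X : set (\bar R)) (x : \bar R) : (0 <= x)%E -> (forall y, X y -> (y <= x)%E) ->
  (esup X <= x)%E.
Proof. by move=> x0 Xx; apply: ge_ereal_sup => y [->//|/Xx]. Qed.

Lemma mk_leP L phi psi r : 0 <= r -> (mk L phi psi <= r%:E)%E <->
  forall a, sa_ball L a -> normc (phi a - psi a) <= r.
Proof.
move=> r0; split=> [h a La|h].
  by rewrite -lee_fin; apply: le_trans h; apply: esup_ubound; exists a.
by apply: ge_esup => [|_ [a La <-]]; rewrite lee_fin// h.
Qed.

Lemma bl_leP L M phi psi r : 0 <= r -> (bl L M phi psi <= r%:E)%E <->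
  forall a, dom_sa L a -> norm_LM L M a <= 1 -> normc (phi a - psi a) <= r.
Proof.
move=> r0; split=> [h a La La1|h].
  by rewrite -lee_fin; apply: le_trans h; apply: esup_ubound; exists a.
by apply: ge_esup => [|_ [a [La La1] <-]]; rewrite lee_fin// h.
Qed.

Lemma bl_le_mk L M phi psi : (bl L M phi psi <= mk L phi psi)%E.
Proof.
apply: ge_esup => [|_ [a [La /= La1] <-]]; first exact: esup_ge0.
apply: esup_ubound; exists a => //; split=> //.
by rewrite (le_trans _ La1)// le_max lexx orbT.
Qed.

Lemma normc_dist_triangle (x y z : R[i]) :
  normc (x - z) <= normc (x - y) + normc (y - z).
Proof. by rewrite -(subrK y x) -addrA addrK; exact: le_normcD. Qed.

Lemma normc_distC (x y : R[i]) : normc (x - y) = normc (y - x).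
Proof. by rewrite -(normcN (x - y)) opprB. Qed.

Lemma mkC L phi psi : mk L phi psi = mk L psi phi.
Proof.
congr (esup _); rewrite eqEsubset; split=> _ [a La <-]; exists a => //;
  by rewrite normc_distC.
Qed.

Lemma mk_triangle L phi psi mu : (mk L phi mu <= mk L phi psi + mk L psi mu)%E.
Proof.
apply: ge_esup => [|_ [a La <-]]; first by rewrite adde_ge0// esup_ge0.
have h1 : ((normc (phi a - psi a))%:E <= mk L phi psi)%E.
  by apply: esup_ubound; exists a.
have h2 : ((normc (psi a - mu a))%:E <= mk L psi mu)%E.
  by apply: esup_ubound; exists a.
apply: le_trans (leeD h1 h2); rewrite -EFinD lee_fin.
exact: normc_dist_triangle.
Qed.

Lemma seminormZr L (t : R) a : seminorm L -> dom_sa L a -> 0 <= t ->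
  dom_sa L (t%:C *: a) /\ L (t%:C *: a) = t * L a.
Proof.
move=> [_ _ LZ _] [La sa_a] t0; have [Lta ->] := LZ t%:C a La.
by rewrite normc_real ger0_norm//; split=> //; split=> //; exact: saZ.
Qed.

(** The bound k is used for scaling in place of L a, which may vanish. *)
Lemma mk_le_scaled L phi psi r a k : seminorm L -> scalar phi -> scalar psi ->
  0 <= r -> (mk L phi psi <= r%:E)%E -> dom_sa L a -> 0 < k -> L a <= k ->
  normc (phi a - psi a) <= k * r.
Proof.
move=> sL lphi lpsi r0 /(mk_leP _ _ _ r0) h La k0 Lak.
have k1 : 0 < k^-1 by rewrite invr_gt0.
have [Lka LkaE] := seminormZr sL La (ltW k1).
have /h : sa_ball L (k^-1%:C *: a).
  by split=> //; rewrite LkaE ler_pdivrMl// mulr1.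
rewrite !scalar_funZ// -mulrBr ComplexField.Normc.normcM normc_real.
by rewrite (ger0_norm (ltW k1)) ler_pdivrMl.
Qed.

Context {u : A} (hu : is_one u).

Lemma scalarsP a : scalars A a <-> exists z, a = z *: u.
Proof.
split=> [[z [v [hv ->]]]|[z ->]]; last by exists z, u.
by exists z; rewrite (is_one_uniq hu hv).
Qed.

Lemma unital_of_one : unital A. Proof. by exists u. Qed.

Lemma lip_scalar L z : leibniz_hermitian_norm L -> dom L (z *: u) /\ L (z *: u) = 0.
Proof.
move=> [_ _ [_ /(_ unital_of_one) h] _ _].
have : scalars A (z *: u) by apply/scalarsP; exists z.
by rewrite -h.
Qed.

Lemma lip_sub_scalar L a r : leibniz_hermitian_norm L -> sa_ball L a ->
  sa_ball L (a - r%:C *: u).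
Proof.
move=> LL [[La sa_a] La1]; have [[L0 LD LZ Lpos] _ _ _ _] := LL.
have [Lu Lu0] := lip_scalar (- r%:C) LL.
have [Lau Lau1] := LD _ _ La Lu; rewrite -scaleNr; split.
  split=> //; apply: saD => //; rewrite -rmorphN; apply: saZ; exact: (sa_one hu).
by rewrite (le_trans Lau1)// Lu0 addr0.
Qed.

Lemma state_sub_scalar phi psi a (z : R[i]) : state A phi -> state A psi ->
  phi (a - z *: u) - psi (a - z *: u) = phi a - psi a.
Proof.
move=> /(stateP hu)[[lphi _] phi1] /(stateP hu)[[lpsi _] psi1].
rewrite !scalar_funB// !scalar_funZ// phi1 psi1; ring.
Qed.

Lemma dom_rpart L a : seminorm L -> Defs.hermitian L -> dom L a -> dom_sa L (rpart a).
Proof.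
move=> [_ LD LZ _] LH La; split; last exact: sa_rpart.
have [Las _] := LH _ La; have [Lsum _] := LD _ _ La Las.
by have [] := LZ (2^-1)%:C _ Lsum.
Qed.

Lemma dom_ipart L a : seminorm L -> Defs.hermitian L -> dom L a -> dom_sa L (ipart a).
Proof.
move=> [_ LD LZ _] LH La; split; last exact: sa_ipart.
have [Las _] := LH _ La; have [LN _] := LZ (-1) _ La.
have [Lsum _] := LD _ _ Las LN; rewrite scaleN1r in Lsum.
have [Li _] := LZ 'i _ Lsum.
by have [] := LZ (2^-1)%:C _ Li.
Qed.

(** Balls of A have radii in R[i]; a positive radius is real, so the topology can be described with
    [cnorm]. *)
Lemma nbhs_cnorm (x : A) (U : set A) :
  nbhs x U <-> exists2 e, 0 < e & forall y, cnorm (x - y) < e -> U y.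
Proof.
split=> [/nbhs_ballP[e /= e0 eU]|[e e0 eU]].
  have eE := RRe_real (ger0_real (ltW e0)).
  exists (complex.Re e); first by rewrite -ltcR eE.
  by move=> y xy; apply: eU; rewrite -ball_normE /= normr_cnorm -eE ltcR.
apply/nbhs_ballP; exists e%:C; first by rewrite /= ltcR.
by move=> y; rewrite -ball_normE /= normr_cnorm ltcR; exact: eU.
Qed.

Lemma dense_cnorm (X : set A) : dense X <->
  forall x e, 0 < e -> exists2 y, X y & cnorm (x - y) < e.
Proof.
split=> [dX x e e0|h O [x Ox] oO].
  have xe : nbhs x [set y | cnorm (x - y) < e] by apply/nbhs_cnorm; exists e.
  have [|y [/interior_subset xy Xy]] := dX _ _ (open_interior [set y | cnorm (x - y) < e]).
    by exists x; exact: xe.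
  by exists y.
have /nbhs_cnorm[e e0 eO] : nbhs x O by apply: open_nbhs_nbhs.
by have [y Xy xy] := h x e e0; exists y; split=> //; exact: eO.
Qed.

Lemma closed_cnorm (X : set A) : closed X <->
  forall x, (forall e, 0 < e -> exists2 y, X y & cnorm (x - y) < e) -> X x.
Proof.
split=> [/closure_id clX x h|h].
  rewrite clX => U /nbhs_cnorm[e e0 eU]; have [y Xy xy] := h _ e0.
  by exists y; split=> //; exact: eU.
apply/closure_id; apply/seteqP; split; first exact: subset_closure.
move=> x clx; apply: h => e e0.
have [|y [Xy xy]] := clx [set y | cnorm (x - y) < e].
  by apply/nbhs_cnorm; exists e.
by exists y.
Qed.

End Lipschitz.

(** * Weak* compactness of the state space *)

Lemma normc_ge_ReIm (R : realType) (z : R[i]) :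
  `|complex.Re z| <= normc z /\ `|complex.Im z| <= normc z.
Proof.
case: z => x y /=; rewrite -!sqrtr_sqr !ler_wsqrtr// ?lerDl ?lerDr sqr_ge0//.
Qed.

Lemma compact_square (R : realType) (r : R) : compact
  ([set z | `|complex.Re z| <= r /\ `|complex.Im z| <= r] : set (R[i]^o)).
Proof.
pose f (p : R^o * R^o) : R[i]^o := p.1%:C + 'i * p.2%:C.
have fc : continuous f.
  move=> [x y]; apply/cvgrPdist_lt => e e0.
  have eE := RRe_real (ger0_real (ltW e0)).
  have e2 : 0 < complex.Re e / 2 by rewrite divr_gt0// -ltcR eE.
  near=> p.
  have h1 : `|x - p.1| < complex.Re e / 2.
    near: p; apply: (@cvgr_dist_lt _ _ _ _ _ (fun p : R^o * R^o => p.1) x) => //.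
    exact: cvg_fst.
  have h2 : `|y - p.2| < complex.Re e / 2.
    near: p; apply: (@cvgr_dist_lt _ _ _ _ _ (fun p : R^o * R^o => p.2) y) => //.
    exact: cvg_snd.
  rewrite -eE normr_normc ltcR.
  rewrite (_ : f (x, y) - f p = (x - p.1)%:C + 'i * (y - p.2)%:C); last first.
    by rewrite /f !rmorphB /=; ring.
  rewrite (le_lt_trans (le_normcD _ _))// ComplexField.Normc.normcM !normc_real.
  by rewrite /= expr0n add0r expr1n sqrtr1 mul1r [ltRHS]splitr ltrD.
have <- : f @` (`[-r, r] `*` `[-r, r]) =
    [set z | `|complex.Re z| <= r /\ `|complex.Im z| <= r].
  apply/seteqP; split=> [_ [[x y] /= [xr yr] <-]|z [/= xr yr]].
    move: xr yr; rewrite !in_itv /= -!ler_norml => xr yr.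
    by split; rewrite /= !(mul0r, mul1r, mulr0, subr0, addr0, add0r).
  exists (complex.Re z, complex.Im z); last by rewrite /f /= -complexE.
  by split; rewrite /= in_itv /= -ler_norml.
apply: continuous_compact; first exact: continuous_subspaceT.
by apply: compact_setX; exact: segment_compact.
Unshelve. all: by end_near. Qed.

Section WeakStar.
Context {R : realType} {A : cstarAlgType R} {u : A} (hu : is_one u).
Implicit Types (phi psi mu : A -> R[i]) (e r : R).

Lemma ptws_near phi (a : A) e : 0 < e ->
  nbhs (phi : {ptws A -> R[i]^o}) [set psi | normc (phi a - psi a) < e].
Proof.
move=> e0; have [h _] := @pointwise_cvgP A R[i]^o (nbhs (phi : {ptws A -> R[i]^o})) phi _.
have ha : (fun g : A -> R[i]^o => g a) @ nbhs (phi : {ptws A -> R[i]^o}) --> (phi a : R[i]^o).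
  have h0 : {ptws, nbhs (phi : {ptws A -> R[i]^o}) --> (phi : A -> R[i]^o)} by move=> U.
  exact: (h h0 a).
have e0' : 0 < e%:C by rewrite ltcR.
have := @cvgr_dist_lt _ R[i]^o _ _ _ _ _ ha _ e0'.
have FF := nbhs_filter (phi : {ptws A -> R[i]^o}).
move=> /(_ FF); apply: (@filterS _ _ FF) => psi /=.
by rewrite normr_normc ltcR.
Qed.

Lemma ptws_near_seq phi (s : seq A) e : 0 < e ->
  nbhs (phi : {ptws A -> R[i]^o})
    [set psi | forall a, a \in s -> normc (phi a - psi a) < e].
Proof.
move=> e0; have FF := nbhs_filter (phi : {ptws A -> R[i]^o}).
elim: s => [|a s IH].
  by apply: (@filterS _ _ FF setT); [move=> psi _ a; rewrite in_nil|exact: filterT].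
have := @filterI _ _ FF _ _ (ptws_near phi a e0) IH.
apply: (@filterS _ _ FF) => psi [h1 h2] b.
by rewrite inE => /predU1P[->//|]; exact: h2.
Qed.

(** Each axiom of a state involves finitely many values, so it passes to pointwise limits. *)
Lemma state_closed : closed (state A : set {ptws A -> R[i]^o}).
Proof.
apply/closure_id; apply/seteqP; split; first exact: subset_closure.
move=> phi cl.
have near (s : seq A) e : 0 < e -> exists2 psi, state A psi &
    forall a, a \in s -> normc (phi a - psi a) < e.
  by move=> e0; have [psi [spsi h]] := cl _ (ptws_near_seq phi s e0); exists psi.
have eq_small (z : R[i]) K : (forall e, 0 < e -> normc z <= K * e) -> z = 0.
  move=> h; apply: ComplexField.Normc.eq0_normc; apply/le_anti.
  rewrite normc_ge0 andbT; apply/ler_addgt0Pr => e e0; rewrite add0r.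
  have K0 : 0 <= K by rewrite -[K]mulr1 (le_trans (normc_ge0 z)) ?h.
  have K1 : 0 < K + 1 by rewrite ltr_wpDl.
  rewrite (le_trans (h (e / (K + 1)) _)) ?divr_gt0// mulrA ler_pdivrMr//.
  by rewrite mulrC ler_pM2l// lerDl.
apply/(stateP hu); split; last first.
  apply/eqP; rewrite -subr_eq0; apply/eqP; apply: (eq_small _ 1) => e e0.
  have [psi /(stateP hu)[_ <-] h] := near [:: u] e e0.
  by rewrite mul1r ltW// h// inE.
split=> [z a b|a].
  (* The errors at z a + b, at b, and at a multiplied by z add up to this constant. *)
  apply/eqP; rewrite -subr_eq0; apply/eqP; apply: (eq_small _ (2 + normc z)) => e e0.
  have [psi [[lpsi _] _] h] := near [:: z *: a + b; a; b] e e0.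
  have -> : phi (z *: a + b) - (z * phi a + phi b) =
      (phi (z *: a + b) - psi (z *: a + b)) - z * (phi a - psi a) - (phi b - psi b).
    by rewrite lpsi; ring.
  have h1 : normc (phi (z *: a + b) - psi (z *: a + b)) < e by apply: h; rewrite !inE eqxx.
  have h2 : normc (phi a - psi a) < e by apply: h; rewrite !inE eqxx orbT.
  have h3 : normc (phi b - psi b) < e by apply: h; rewrite !inE eqxx !orbT.
  rewrite (le_trans (le_normcD _ _))// normcN.
  rewrite (le_trans (lerD (le_normcD _ _) (lexx _)))// normcN ComplexField.Normc.normcM.
  have := ler_wpM2l (normc_ge0 z) (ltW h2); lra.
rewrite lecE; apply/andP; split.
  apply/eqP; apply: (@complexI R); apply: (eq_small _ 1) => e e0; rewrite mul1r normc_real.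
  have [psi [[_ psi0] _] h] := near [:: cmul (cstar a) a] e e0.
  have /ltW := h _ (mem_head _ _); apply: le_trans.
  apply: le_trans (normc_ge_ReIm _).2; rewrite raddfB/= (ger0_Im (psi0 a)).
  by rewrite subr0.
rewrite /=; apply/ler_addgt0Pr => e e0.
have [psi [[_ psi0] _] h] := near [:: cmul (cstar a) a] e e0.
have := le_lt_trans (normc_ge_ReIm _).1 (h _ (mem_head _ _)).
have : 0 <= complex.Re (psi (cmul (cstar a) a)).
  by have := psi0 a; rewrite lecE => /andP[].
by rewrite raddfB/= ltr_norml => h0 /andP[h1 _]; lra.
Qed.

(** The Banach-Alaoglu argument: states form a closed part of a product of squares, the one at a
    having half-side |a|. *)
Lemma state_compact : compact (state A : set {ptws A -> R[i]^o}).
Proof.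
have cK := @tychonoff A (fun=> R[i]^o)
  (fun a => [set z | `|complex.Re z| <= cnorm a /\ `|complex.Im z| <= cnorm a])
  (fun a => @compact_square R (cnorm a)).
apply: (subclosed_compact state_closed cK) => phi sphi a /=.
have b := state_bound hu a sphi; have [h1 h2] := normc_ge_ReIm (phi a).
by split; [exact: le_trans h1 b|exact: le_trans h2 b].
Qed.

End WeakStar.

(** * From compactness of the states to total boundedness of Lipschitz balls *)

Definition totally_bounded (R : realType) (A : cstarAlgType R) (E : set A) : Prop :=
  forall e : R, 0 < e -> exists s : seq A,
    forall x, E x -> exists2 y, y \in s & cnorm (x - y) < e.

Lemma same_cell (R : realType) (x y d k : R) : 0 < d ->
  k <= x / d < k + 1 -> k <= y / d < k + 1 -> `|x - y| <= d.
Proof.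
move=> d0; rewrite !(ler_pdivlMr, ltr_pdivrMr)// mulrDl mul1r ler_norml.
by move=> /andP[? ?] /andP[? ?]; apply/andP; split; lra.
Qed.

Section FiniteNets.
Context {R : realType} {A : cstarAlgType R} {u : A} (hu : is_one u).
Context (L : lipschitz_data A).
Implicit Types (phi psi mu : A -> R[i]) (e r K : R) (a x : A).

(** Weak* compactness gives total boundedness for [mk]. The net is indexed by an ordinal so that its
    values can be recorded as a finite function. *)
Lemma state_net e : induces_weakstar (mk L) -> 0 < e ->
  exists n (s : 'I_n -> A -> R[i]), (forall i, state A (s i)) /\
    forall psi, state A psi -> exists i, (mk L (s i) psi < e%:E)%E.
Proof.
move=> Lw e0; apply: contrapT => nonet.
(* Without a finite net the complements of finite unions of balls generate a proper filter. It has a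
   cluster point, whose own ball is excluded by the filter. *)
pose F : set_system {ptws A -> R[i]^o} := fun U => exists2 s : seq (A -> R[i]),
  (forall phi, phi \in s -> state A phi) &
  forall psi, state A psi ->
    (forall phi, phi \in s -> ~ (mk L phi psi < e%:E)%E) -> U psi.
have FF : ProperFilter F.
  apply: Build_ProperFilter_ex.
    move=> U [s ss sU]; apply: contrapT => U0; apply: nonet.
    exists (size s), (fun i => nth (fun=> 0) s i); split=> [i|psi spsi].
      by apply: ss; exact: mem_nth.
    apply: contrapT => far; apply: U0; exists psi; apply: sU => // phi phis near.
    have it : (index phi s < size s)%N by rewrite index_mem.
    by apply: far; exists (Ordinal it); rewrite /= nth_index.
  split.
  - by exists [::].
  - move=> U V [s ss sU] [t ts tV]; exists (s ++ t).
      by move=> phi; rewrite mem_cat => /orP[/ss|/ts].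
    move=> psi spsi far; split; [apply: sU => //|apply: tV => //] => phi phis;
      by apply: far; rewrite mem_cat phis ?orbT.
  - by move=> U V UV [s ss sU]; exists s => // psi spsi far; exact/UV/sU.
have [|psi [spsi cl]] := state_compact hu FF; first by exists [::].
have near : nbhs (psi : {ptws A -> R[i]^o})
    [set psi' | state A psi' -> (mk L psi psi' < e%:E)%E].
  by apply/(Lw psi spsi [set psi' | (mk L psi psi' < e%:E)%E]); exists e.
have far : F [set psi' | state A psi' /\ ~ (mk L psi psi' < e%:E)%E].
  exists [:: psi] => [phi|psi' spsi' h]; first by rewrite inE => /eqP ->.
  by split=> //; apply: h; rewrite inE.
by have [psi' [[spsi' h] /(_ spsi')]] := cl _ _ far near.
Qed.

(** The deviation of x from mu x is tested on states. Each is within 1 of one of finitely many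
    states, all at finite distance from mu. *)
Lemma sa_ball_bounded mu : metrizes_weakstar (mk L) -> leibniz_hermitian_norm L ->
  state A mu -> exists K, forall x, sa_ball L x ->
    cnorm (x - (complex.Re (mu x))%:C *: u) <= K.
Proof.
move=> [[mkfin _ _ _] Lw] LL smu.
have [n [s [ss net]]] := state_net Lw ltr01.
pose k i := fine (mk L (s i) mu).
have kE i : mk L (s i) mu = (k i)%:E.
  have [h0 h1] := mkfin _ _ (ss i) smu; rewrite fineK// ge0_fin_numE//.
have k0 i : 0 <= k i by have [h0 _] := mkfin _ _ (ss i) smu; rewrite fine_ge0.
(* The sum only serves to dominate every distance k i. *)
exists (1 + \sum_i k i) => x Lx; have sx : sa A x := Lx.1.2.
apply: (sa_norm_le hu).
  by apply: saB => //; apply: saZ; exact: (sa_one hu).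
move=> psi spsi.
have /(stateP hu)[pmu mu1] := smu; have /(stateP hu)[ppsi psi1] := spsi.
rewrite (scalar_funB _ _ ppsi.1) (scalar_funZ _ _ ppsi.1) psi1 mulr1.
have -> : (complex.Re (mu x))%:C = mu x.
  by rewrite -(positive_functional_real hu pmu sx).
have [i /ltW hi] := net psi spsi.
rewrite (le_trans (normc_dist_triangle _ (s i x) _))// lerD//.
  by rewrite normc_distC; move/(mk_leP _ _ _ ler01): hi; apply.
have : (mk L (s i) mu <= (k i)%:E)%E by rewrite kE.
move/(mk_leP _ _ _ (k0 i)) => /(_ x Lx)/le_trans; apply.
by rewrite (bigD1 i)//= lerDl sumr_ge0.
Qed.

(** An element of the ball is determined up to a small norm error by its values on a finite net of
    states. These values lie in [-K, K], so rounding them leaves finitely many codes. *)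
Lemma sa_ball_totally_bounded K : induces_weakstar (mk L) ->
  totally_bounded (sa_ball L `&` [set a | cnorm a <= K]).
Proof.
move=> Lw e e0; set E := _ `&` _.
have d0 : 0 < e / 4 by rewrite divr_gt0.
have [n [s [ss net]]] := state_net Lw d0.
pose m := (Num.trunc ((K + K) / (e / 4))).+1.
pose code x : {ffun 'I_n -> 'I_m.+1} :=
  [ffun i => inord (Num.trunc ((complex.Re (s i x) + K) / (e / 4)))].
(* One element is chosen for each code that occurs; the default 0 for the other codes merely
   enlarges the finite list. *)
pose rep c : A := xget 0 [set x | E x /\ code x = c].
exists (codom rep) => x Ex.
have [Ey cy] : E (rep (code x)) /\ code (rep (code x)) = code x.
  by apply: (@xgetPex _ 0 [set y | E y /\ code y = code x]); exists x.
exists (rep (code x)); first exact: codom_f.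
set y := rep _ in Ey cy *.
(* One quarter for each passage from psi to the net state, at x and at y, and one for sharing a
   cell. *)
rewrite (@le_lt_trans _ _ (3 * (e / 4)))//; last lra.
have [[[_ sx] Lx1] xK] := Ex; have [[[_ sy] Ly1] yK] := Ey.
apply: (sa_norm_le hu); first exact: saB.
move=> psi spsi; have [i /ltW hi] := net psi spsi.
have [ppsi _] := spsi; have [pphi _] := ss i.
rewrite (scalar_funB _ _ ppsi.1).
move/(mk_leP _ _ _ (ltW d0)): hi => hi.
have h1 := hi _ Ex.1; have h2 := hi _ Ey.1.
have rng z : E z -> 0 <= (complex.Re (s i z) + K) / (e / 4) <= (K + K) / (e / 4).
  move=> [_ zK]; have := le_trans (state_bound hu z (ss i)) zK.
  move=> /(le_trans (normc_ge_ReIm _).1); rewrite ler_norml => /andP[g1 g2].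
  rewrite divr_ge0 ?(ltW d0)//=; last lra.
  by rewrite ler_pM2r ?invr_gt0// lerD2r.
have h3 : normc (s i x - s i y) <= e / 4.
  have /andP[x0 x1] := rng _ Ex; have /andP[y0 y1] := rng _ Ey.
  have trunc_lt (z : R) : z <= (K + K) / (e / 4) -> (Num.trunc z < m.+1)%N.
    by move=> zK; rewrite ltnS ltnW// /m ltnS le_truncn.
  move: cy => /ffunP/(_ i); rewrite !ffunE => /(congr1 val) /=.
  rewrite !inordK ?trunc_lt// => txy.
  have cx := truncn_itv x0; have cy' := truncn_itv y0.
  rewrite txy -[(Num.trunc _).+1%:R]natr1 in cx cy'.
  have -> : s i x - s i y = (complex.Re (s i x) - complex.Re (s i y))%:C.
    rewrite {1}(positive_functional_real hu pphi sx).
    by rewrite {1}(positive_functional_real hu pphi sy) rmorphB.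
  rewrite normc_real; have := same_cell d0 cx cy'.
  by rewrite opprD addrACA subrr addr0.
have := normc_dist_triangle (psi x) (s i x) (psi y).
have := normc_dist_triangle (s i x) (s i y) (psi y).
by rewrite normc_distC in h1; lra.
Qed.

End FiniteNets.

(** * From totally bounded Lipschitz balls to quantum compactness *)

Section QuantumCompact.
Context {R : realType} {A : cstarAlgType R} {u : A} (hu : is_one u).
Context (L : lipschitz_data A).
Implicit Types (phi psi mu : A -> R[i]) (e r K k M : R) (a x t : A).

Lemma bl_le_scaled M phi psi r a k : seminorm L -> scalar phi -> scalar psi ->
  0 <= r -> (bl L M phi psi <= r%:E)%E -> dom_sa L a -> 0 < k ->
  norm_LM L M a <= k -> normc (phi a - psi a) <= k * r.
Proof.
move=> sL lphi lpsi r0 /(bl_leP _ _ _ _ r0) h La k0 Lak.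
have k1 : 0 < k^-1 by rewrite invr_gt0.
have [Lka LkaE] := seminormZr sL La (ltW k1).
have := h _ Lka; rewrite /norm_LM LkaE cnormZr (ger0_norm (ltW k1)) mulrCA.
rewrite -maxr_pMr ?(ltW k1)// ler_pdivrMl// mulr1 => /(_ Lak).
rewrite !scalar_funZ// -mulrBr ComplexField.Normc.normcM normc_real.
by rewrite (ger0_norm (ltW k1)) ler_pdivrMl.
Qed.

(** The domain is dense: t is replaced by some y in it at cost e / 2 for each state, and the two
    self-adjoint parts of y are controlled linearly by the distance. *)
Lemma bl_controls t e : leibniz_hermitian_norm L -> 0 < e ->
  exists2 k, 0 < k & forall phi psi r, state A phi -> state A psi -> 0 <= r ->
    (bl L 1 phi psi <= r%:E)%E -> normc (phi t - psi t) <= e + k * r.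
Proof.
move=> [sL LH _ _ /dense_cnorm dL] e0.
have e2 : 0 < e / 2 by rewrite divr_gt0.
have [y Ly ty] := dL t _ e2.
have La := dom_rpart sL LH Ly; have Lb := dom_ipart sL LH Ly.
set a := rpart y in La; set b := ipart y in Lb.
pose ka := norm_LM L 1 a + 1; pose kb := norm_LM L 1 b + 1.
have kpos x : 0 < norm_LM L 1 x + 1.
  by rewrite ltr_wpDl// /norm_LM le_max mulr_ge0 ?cnorm_ge0// invr_ge0.
exists (ka + kb); first by apply: addr_gt0; exact: kpos.
move=> phi psi r sphi spsi r0 h.
have lphi := sphi.1.1; have lpsi := spsi.1.1.
have ha : normc (phi a - psi a) <= ka * r.
  by apply: bl_le_scaled h _ _ _ => //; rewrite ?kpos ?lerDl.
have hb : normc (phi b - psi b) <= kb * r.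
  by apply: bl_le_scaled h _ _ _ => //; rewrite ?kpos ?lerDl.
have -> : phi t - psi t =
    phi (t - y) - psi (t - y) + ((phi a - psi a) + 'i * (phi b - psi b)).
  rewrite (scalar_funB _ _ lphi) (scalar_funB _ _ lpsi) [in RHS](parts_eq y) -/a -/b.
  by rewrite !(scalarD _ _ lphi, scalarD _ _ lpsi, scalar_funZ 'i _ lphi, scalar_funZ 'i _ lpsi); ring.
have h1 := state_bound hu (t - y) sphi; have h2 := state_bound hu (t - y) spsi.
have h3 := le_normcD (phi (t - y) - psi (t - y)) ((phi a - psi a) + 'i * (phi b - psi b)).
have h4 := le_normcD (phi (t - y)) (- psi (t - y)).
have h5 := le_normcD (phi a - psi a) ('i * (phi b - psi b)).
have i1 : normc ('i : R[i]) = 1 by rewrite /= expr0n add0r expr1n sqrtr1.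
rewrite ComplexField.Normc.normcM i1 mul1r in h5.
rewrite normcN in h4.
rewrite mulrDl; lra.
Qed.

(** The weak* topology is that of pointwise convergence, so it is enough that the filter of
    [bl]-balls around phi converges pointwise, which [bl_controls] provides. *)
Lemma weakstar_nbhs_bl phi (U : set (A -> R[i])) : leibniz_hermitian_norm L ->
  state A phi -> weakstar_nbhs phi U ->
  exists2 eps, 0 < eps &
    forall psi, state A psi -> (bl L 1 phi psi < eps%:E)%E -> U psi.
Proof.
move=> LL sphi.
pose G : set_system (A -> R[i]^o) := fun V => exists2 eps, 0 < eps &
  forall psi, state A psi -> (bl L 1 phi psi < eps%:E)%E -> V psi.
have GF : Filter G.
  split.
  - by exists 1.
  - move=> V W [e1 e10 h1] [e2 e20 h2]; exists (Num.min e1 e2).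
      by rewrite lt_min e10.
    move=> psi spsi h; split; [apply: h1 => //|apply: h2 => //];
      by apply: lt_le_trans h _; rewrite lee_fin ge_min lexx ?orbT.
  - by move=> V W VW [eps eps0 h]; exists eps => // psi spsi hpsi; apply: VW; exact: h.
have cv : {ptws, G --> (phi : A -> R[i]^o)}.
  apply/(@pointwise_cvgP A R[i]^o G phi GF) => t.
  apply/(@cvgrPdist_lt _ R[i]^o) => e e0.
  have eE := RRe_real (ger0_real (ltW e0)).
  have e2 : 0 < complex.Re e / 2 by rewrite divr_gt0// -ltcR eE.
  have [k k0 hk] := bl_controls t LL e2.
  exists (complex.Re e / 4 / k); first by rewrite divr_gt0//; lra.
  move=> psi spsi /ltW/(hk _ _ _ sphi spsi); rewrite normr_normc -[e]eE ltcR.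
  have r0 : 0 <= complex.Re e / 4 / k by apply: divr_ge0; [lra|exact: ltW].
  move=> /(_ r0) h; apply: le_lt_trans h _.
  by rewrite mulrCA mulfV ?gt_eqF// mulr1; lra.
move=> /cv [eps eps0 h]; exists eps => // psi spsi hpsi.
exact: h.
Qed.

(** Modulo scalars, which states do not distinguish, the Lipschitz ball has a finite eps / 4 net.
    Closeness of two states on the net is a weak* condition and makes them close on the whole
    ball. *)
Lemma mk_nbhs phi eps K : leibniz_hermitian_norm L -> state A phi -> 0 < eps ->
  (forall x, sa_ball L x -> exists r, cnorm (x - r%:C *: u) <= K) ->
  totally_bounded (sa_ball L `&` [set a | cnorm a <= K]) ->
  weakstar_nbhs phi [set psi | (mk L phi psi < eps%:E)%E].
Proof.
move=> LL sphi eps0 bdd tb.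
have d0 : 0 < eps / 4 by rewrite divr_gt0.
have [s net] := tb _ d0.
rewrite /weakstar_nbhs /within /=.
apply: (@filterS _ _ (nbhs_filter (phi : {ptws A -> R[i]^o})) _ _ _
  (ptws_near_seq phi s d0)) => psi h spsi.
apply: (@le_lt_trans _ _ (3 * (eps / 4))%:E); last by rewrite lte_fin; lra.
apply/mk_leP; first by lra.
move=> x Lx; have [r xr] := bdd x Lx.
have Lx' := lip_sub_scalar hu r LL Lx.
rewrite -(state_sub_scalar hu x r%:C sphi spsi); set z := x - _ in xr Lx' *.
have [y ys zy] := net z (conj Lx' xr).
have h1 := state_bound hu (z - y) sphi; have h2 := state_bound hu (z - y) spsi.
have h3 := h y ys.
have -> : phi z - psi z = phi (z - y) + (phi y - psi y) - psi (z - y).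
  by rewrite (scalar_funB _ _ sphi.1.1) (scalar_funB _ _ spsi.1.1); ring.
have h4 := le_normcD (phi (z - y) + (phi y - psi y)) (- psi (z - y)).
have h5 := le_normcD (phi (z - y)) (phi y - psi y).
rewrite normcN in h4; lra.
Qed.

(** Rieffel's criterion. Since [bl] is below [mk], [bl_controls] separates states and one comparison
    of topologies is [weakstar_nbhs_bl]; the other is [mk_nbhs]. Boundedness modulo scalars makes
    [mk] finite. *)
Lemma quantum_compact_of_totally_bounded K : leibniz_hermitian_norm L ->
  closed (sa_ball L) ->
  (forall x, sa_ball L x -> exists r, cnorm (x - r%:C *: u) <= K) ->
  totally_bounded (sa_ball L `&` [set a | cnorm a <= K]) ->
  quantum_compact L.
Proof.
move=> LL cL bdd tb; split=> //; first by exists u.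
split.
  split=> [phi psi sphi spsi|phi psi sphi spsi|phi psi sphi spsi|*].
  - split; first exact: esup_ge0.
    have K0 : 0 <= K.
      have [|r h] := bdd 0; last by apply: le_trans h; exact: cnorm_ge0.
      have [[L0 _ LZ _] _ _ _ _] := LL; split; first by split=> //; exact: sa0.
      by have := LZ 0 _ L0; rewrite scale0r ComplexField.Normc.normc0 mul0r => -[_ ->].
    apply: (@le_lt_trans _ _ (K + K)%:E); last exact: ltry.
    apply/mk_leP; first by rewrite addr_ge0.
    move=> x Lx; have [r xr] := bdd x Lx.
    rewrite -(state_sub_scalar hu x r%:C sphi spsi).
    rewrite (le_trans (le_normcD _ _))// normcN lerD// (le_trans (state_bound hu _ _))//.
  - split=> [h|->].
      apply/funext => t; apply/eqP; rewrite -subr_eq0; apply/eqP.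
      apply: ComplexField.Normc.eq0_normc; apply/le_anti; rewrite normc_ge0 andbT.
      apply/ler_addgt0Pr => e e0; have [k k0 hk] := bl_controls t LL e0.
      have := hk _ _ 0 sphi spsi (lexx 0).
      rewrite mulr0 addr0 add0r; apply.
      by apply: le_trans (bl_le_mk _ _ _ _) _; rewrite h.
    apply/le_anti; rewrite esup_ge0 andbT; apply/mk_leP => // a _.
    by rewrite subrr ComplexField.Normc.normc0.
  - exact: mkC.
  - exact: mk_triangle.
move=> phi sphi U; split=> [h|[eps eps0 h]].
  have [eps eps0 hU] := weakstar_nbhs_bl LL sphi h.
  exists eps => // psi spsi hpsi; apply: hU => //.
  exact: le_lt_trans (bl_le_mk _ _ _ _) hpsi.
have := mk_nbhs LL sphi eps0 bdd tb; rewrite /weakstar_nbhs /within /=.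
apply: (@filterS _ _ (nbhs_filter (phi : {ptws A -> R[i]^o}))) => psi hpsi spsi.
by apply: h => //; exact: hpsi.
Qed.

End QuantumCompact.

(** * Quantum compact spaces as pointed proper spaces *)

Section PointedProper.
Context {R : realType} {A : cstarAlgType R} {u : A} (hu : is_one u).
Context (L : lipschitz_data A).
Implicit Types (phi psi mu : A -> R[i]) (e r K k M : R) (a x t : A).

Lemma separable_of_totally_bounded : seminorm L -> Defs.hermitian L ->
  dense (dom L) -> totally_bounded (sa_ball L `&` [set a | cnorm a <= 1]) ->
  separable A.
Proof.
move=> sL LH /dense_cnorm dL tb.
have /choice[net netP] : forall n : nat, exists s : seq A, forall x,
    (sa_ball L `&` [set a | cnorm a <= 1]) x ->
    exists2 y, y \in s & cnorm (x - y) < n.+1%:R^-1.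
  by move=> n; apply: tb; rewrite invr_gt0.
(* Natural multiples suffice: for k above |a| and L a the element a / k lies in the unit ball, and a
   net of precision 1 / (n + 1) with n + 1 > k / e gives a up to e. *)
pose pt (q : nat * nat * nat) : A := (q.1.1%:R)%:C *: nth 0 (net q.1.2) q.2.
pose pt2 (q : (nat * nat * nat) * (nat * nat * nat)) : A := pt q.1 + 'i *: pt q.2.
have approx a e : dom_sa L a -> 0 < e -> exists q, cnorm (a - pt q) < e.
  move=> La e0; pose k := (Num.trunc (Num.max (cnorm a) (L a))).+1.
  have k0 : 0 < k%:R :> R by rewrite ltr0n.
  have lek : Num.max (cnorm a) (L a) <= k%:R by apply/ltW; exact: truncnS_gt.
  have [ak Lak] : cnorm a <= k%:R /\ L a <= k%:R by move: lek; rewrite ge_max => /andP.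
  have k1 : 0 < (k%:R : R)^-1 by rewrite invr_gt0.
  have [Lka LkaE] := seminormZr sL La (ltW k1).
  pose n := Num.trunc (k%:R / e).
  have nk : k%:R * n.+1%:R^-1 < e.
    by rewrite ltr_pdivrMr// mulrC -ltr_pdivrMr//; exact: truncnS_gt.
  have [|c cs hc] := netP n ((k%:R)^-1%:C *: a).
    split; first by split=> //; rewrite LkaE ler_pdivrMl// mulr1.
    by rewrite /= cnormZr (ger0_norm (ltW k1)) ler_pdivrMl// mulr1.
  exists (k, n, index c (net n)); rewrite /pt /= nth_index//.
  have -> : a = k%:R%:C *: ((k%:R)^-1%:C *: a).
    by rewrite scalerA -rmorphM mulfV ?gt_eqF// scale1r.
  rewrite -scalerBr cnormZr (ger0_norm (ltW k0)) (lt_trans _ nk)//.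
  by rewrite ltr_pM2l.
exists (range pt2).
  by apply: (sub_countable (card_image_le _ _)); exact: countableP.
apply/dense_cnorm => x e e0; have e3 : 0 < e / 3 by rewrite divr_gt0.
have [y Ly xy] := dL x _ e3.
have [q1 h1] := approx _ _ (dom_rpart sL LH Ly) e3.
have [q2 h2] := approx _ _ (dom_ipart sL LH Ly) e3.
exists (pt2 (q1, q2)); first by exists (q1, q2).
apply: le_lt_trans (cnorm_sub_triangle y _ _) _.
have -> : y - pt2 (q1, q2) = (rpart y - pt q1) + 'i *: (ipart y - pt q2).
  by rewrite {1}(parts_eq y) /pt2 /= scalerBr opprD addrACA.
have h3 := cnormD (rpart y - pt q1) ('i *: (ipart y - pt q2)).
have i1 : normc ('i : R[i]) = 1 by rewrite /= expr0n add0r expr1n sqrtr1.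
rewrite (cnormZ 'i) i1 mul1r in h3; lra.
Qed.

Lemma bounded_cutdown_one mu K :
  (forall x, sa_ball L x -> cnorm (x - (complex.Re (mu x))%:C *: u) <= K) ->
  bounded_cutdown L u mu.
Proof.
move=> bdd; exists K => b t Lb mub.
have hl x : cmul u x = x by have [_ /(_ x) []] := hu.
have hr x : cmul x u = x by have [_ /(_ x) []] := hu.
rewrite hl !hr.
by have := bdd b Lb; rewrite mub /= rmorphN scaleNr opprK.
Qed.

Lemma strictly_positive_one : strictly_positive u.
Proof.
split; first exact: (sa_one hu).
by move=> phi /(stateP hu)[_ ->]; rewrite ltr01.
Qed.

Lemma scalars_abelian : abelian_cstar_subalgebra (scalars A).
Proof.
have h1 z w : cmul (z *: u) (w *: u) = (z * w) *: u.
  by rewrite cmulZl cmulZr scalerA; have [_ /(_ u) [->]] := hu.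
split; last by move=> a b /(scalarsP hu)[z ->] /(scalarsP hu)[w ->]; rewrite !h1 mulrC.
  split.
  - by apply/(scalarsP hu); exists 0; rewrite scale0r.
  - move=> a b /(scalarsP hu)[z ->] /(scalarsP hu)[w ->]; apply/(scalarsP hu).
    by exists (z + w); rewrite scalerDl.
  - by move=> w a /(scalarsP hu)[z ->]; apply/(scalarsP hu); exists (w * z); rewrite scalerA.
  - move=> a b /(scalarsP hu)[z ->] /(scalarsP hu)[w ->]; apply/(scalarsP hu).
    by exists (z * w).
  - move=> a /(scalarsP hu)[z ->]; apply/(scalarsP hu).
    by exists z^*; rewrite cstarZ (sa_one hu : cstar u = u).
(* For closedness, a state recovers the scalar: if x is close to z 1, then z is close to mu x, so x
   = mu x 1. *)
have [mu smu] := unital_state hu; have /(stateP hu)[[lmu _] mu1] := smu.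
apply/closed_cnorm => x h; apply/(scalarsP hu); exists (mu x).
apply/eqP; rewrite -subr_eq0; apply/eqP; apply: (@cnorm_small_eq0 _ _ _ 2) => e /h.
move=> [y /(scalarsP hu)[z ->] /ltW xz].
rewrite (le_trans (cnorm_sub_triangle (z *: u) _ _))// lerD_2//.
rewrite -scalerBl cnormZ (cnorm_one hu) mulr1.
have -> : z - mu x = mu (z *: u - x).
  by rewrite (scalar_funB _ _ lmu) (scalar_funZ _ _ lmu) mu1 mulr1.
by rewrite (le_trans (state_bound hu _ smu))// cnormBC.
Qed.

Lemma state_character mu : state A mu -> restricts_to_character mu (scalars A).
Proof.
move=> /(stateP hu)[[lmu _] mu1]; split.
  move=> a b /(scalarsP hu)[z ->] /(scalarsP hu)[w ->].
  rewrite cmulZl cmulZr; have [_ /(_ u) [-> _]] := hu.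
  by rewrite !(scalar_funZ _ _ lmu) mu1 !mulr1.
exists u; first by apply/(scalarsP hu); exists 1; rewrite scale1r.
by rewrite mu1; apply/eqP; exact: oner_neq0.
Qed.

(** The unit is the strictly positive element, and the constant sequence at the unit is exhaustive.
    Any state is a pin because [mk] is finite. *)
Lemma quantum_compact_pointed_proper mu : quantum_compact L -> state A mu ->
  pointed_proper L (scalars A) mu.
Proof.
move=> [_ LL cL mkL] smu.
have [sL LH _ _ dL] := LL; have [mkm Lw] := mkL; have [mkfin _ _ _] := mkm.
have /(stateP hu)[pmu mu1] := smu.
have [K bdd] := sa_ball_bounded hu mkL LL smu.
have cut := bounded_cutdown_one bdd.
have [Lu Lu0] : dom L u /\ L u = 0.
  by have := lip_scalar hu 1 LL; rewrite scale1r.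
have su : scalars A u by apply/(scalarsP hu); exists 1; rewrite scale1r.
split; first split.
- split=> //.
  + apply: separable_of_totally_bounded => //.
    exact: (sa_ball_totally_bounded hu).
  + move=> phi sphi U; split=> [h|[eps eps0 h]].
      have [eps eps0 hU] := weakstar_nbhs_bl hu LL sphi h.
      by exists eps.
    apply/(Lw phi sphi U); exists eps => // psi spsi hpsi; apply: h => //.
    exact: le_lt_trans (bl_le_mk _ _ _ _) hpsi.
  + by exists u, mu; split=> //; exact: strictly_positive_one.
- split; first exact: scalars_abelian.
  by exists u, mu; split=> //; [exact: strictly_positive_one|split=> //; exact: state_character].
- split=> // phi sphi; have [_ fin] := mkfin _ _ sphi smu.
  exact: (@subset_closure {ptws A -> R[i]^o} _ phi (conj sphi fin)).
- exact: state_character.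
- exists (fun=> u); split=> [|//]; split.
  + by move=> _; split=> //; exact: (sa_one hu).
  + by rewrite Lu0; exact: cvg_cst.
  + by rewrite mu1; exact: (@cvg_cst R[i]^o).
  + by rewrite (cnorm_one hu); exact: cvg_cst.
Qed.

End PointedProper.

(** * The bridge between two quantum compact metric spaces *)

Section ProductComplete.
Context {K : numFieldType} {U V : completeNormedModType K}.

HB.instance Definition _ := Pointed.on (U * V)%type.

Lemma prod_cauchy_cvg (F : set_system (U * V)) :
  ProperFilter F -> cauchy F -> cvg F.
Proof.
move=> FF /cauchyP cF.
have c1 : cvg (fst @ F).
  apply: cauchy_cvg; apply: cauchy_exP => e e0; have [x Fx] := cF e e0.
  exists x.1; apply: (@filterS _ F _ (ball x e) (fst @^-1` ball x.1 e) _ Fx).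
  by move=> y [].
have c2 : cvg (snd @ F).
  apply: cauchy_cvg; apply: cauchy_exP => e e0; have [x Fx] := cF e e0.
  exists x.2; apply: (@filterS _ F _ (ball x e) (snd @^-1` ball x.2 e) _ Fx).
  by move=> y [].
have h : F --> (lim (fst @ F), lim (snd @ F)).
  move=> S [[P Q] /= [aP bQ] PQ].
  have F1 : F (fst @^-1` P) := c1 _ aP.
  have F2 : F (snd @^-1` Q) := c2 _ bQ.
  apply: (@filterS _ F _ _ S _ (@filterI _ F _ _ _ F1 F2)) => -[x y] [px qy].
  exact: PQ.
by apply: (@cvgP _ F _ h).
Qed.

HB.instance Definition _ := Uniform_isComplete.Build (U * V)%type prod_cauchy_cvg.

End ProductComplete.

Section ProductCStar.
Context {R : realType} {A B : cstarAlgType R}.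
Implicit Types (x y z : A * B).

Definition prod_cmul x y : A * B := (cmul x.1 y.1, cmul x.2 y.2).
Definition prod_cstar x : A * B := (cstar x.1, cstar x.2).

Lemma prod_cmulA : associative prod_cmul.
Proof. by move=> x y z; congr (_, _); exact: cmulA. Qed.
Lemma prod_cmulDl : left_distributive prod_cmul +%R.
Proof. by move=> x y z; congr (_, _); exact: cmulDl. Qed.
Lemma prod_cmulDr : right_distributive prod_cmul +%R.
Proof. by move=> x y z; congr (_, _); exact: cmulDr. Qed.
Lemma prod_cmulZl (k : R[i]) x y : prod_cmul (k *: x) y = k *: prod_cmul x y.
Proof. by congr (_, _); exact: cmulZl. Qed.
Lemma prod_cmulZr (k : R[i]) x y : prod_cmul x (k *: y) = k *: prod_cmul x y.
Proof. by congr (_, _); exact: cmulZr. Qed.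
Lemma prod_cstarK : involutive prod_cstar.
Proof. by case=> a b; congr (_, _); exact: cstarK. Qed.
Lemma prod_cstarD : {morph prod_cstar : x y / x + y}.
Proof. by move=> x y; congr (_, _); exact: cstarD. Qed.
Lemma prod_cstarZ (k : R[i]) x : prod_cstar (k *: x) = k^* *: prod_cstar x.
Proof. by congr (_, _); exact: cstarZ. Qed.
Lemma prod_cstarM x y :
  prod_cstar (prod_cmul x y) = prod_cmul (prod_cstar y) (prod_cstar x).
Proof. by congr (_, _); exact: cstarM. Qed.

Lemma prod_normr x : `|x| = (Num.max (cnorm x.1) (cnorm x.2))%:C.
Proof.
rewrite prod_normE !normr_cnorm; have [h|h] := leP (cnorm x.1) (cnorm x.2).
  by rewrite max_r// lecR.
by rewrite max_l// lecR ltW.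
Qed.

Lemma prod_cnormM_le x y : `|prod_cmul x y| <= `|x| * `|y|.
Proof.
rewrite !prod_normr -rmorphM lecR ge_max; apply/andP; split => /=.
  rewrite (le_trans (cnormM _ _))// ler_pM ?cnorm_ge0// le_max lexx ?orbT//.
rewrite (le_trans (cnormM _ _))// ler_pM ?cnorm_ge0// le_max lexx ?orbT//.
Qed.

Lemma prod_cnorm_star_mul x : `|prod_cmul (prod_cstar x) x| = `|x| ^+ 2.
Proof.
rewrite !prod_normr -rmorphXn /= !cnorm_starM; congr (_%:C).
have [h|h] := leP (cnorm x.1) (cnorm x.2).
  by rewrite max_r// ler_pXn2r// ?nnegrE ?cnorm_ge0.
by rewrite max_l// ltW// ltr_pXn2r// ?nnegrE ?cnorm_ge0.
Qed.

HB.instance Definition _ := isCStarAlgebra.Build R (A * B)%type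
  prod_cmulA prod_cmulDl prod_cmulDr prod_cmulZl prod_cmulZr prod_cstarK
  prod_cstarD prod_cstarZ prod_cstarM prod_cnormM_le prod_cnorm_star_mul.

Lemma prod_cnormE (x : (A * B)%type) : cnorm x = Num.max (cnorm x.1) (cnorm x.2).
Proof. by rewrite /cnorm prod_normr. Qed.

Lemma prod_cnorm_lt (x : (A * B)%type) (r : R) :
  cnorm x < r <-> cnorm x.1 < r /\ cnorm x.2 < r.
Proof. by rewrite prod_cnormE gt_max; split=> /andP. Qed.

Lemma prod_cnorm_le (x : (A * B)%type) (r : R) :
  cnorm x <= r <-> cnorm x.1 <= r /\ cnorm x.2 <= r.
Proof. by rewrite prod_cnormE ge_max; split=> /andP. Qed.

Lemma prod_is_one (u : A) (v : B) : is_one u -> is_one v ->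
  is_one ((u, v) : (A * B)%type).
Proof.
move=> [u0 hu] [_ hv]; split=> [[/u0]//|[a b]].
by have [h1 h2] := hu a; have [h3 h4] := hv b; split; congr (_, _).
Qed.

End ProductCStar.

(** * The bridge seminorm *)

Definition states_within (R : realType) (D A : cstarAlgType R)
    (LD : lipschitz_data D) (pi : D -> A) (chi : R) : Prop :=
  forall phi, state D phi ->
    exists2 psi, state A psi & (mk LD phi (psi \o pi) <= chi%:E)%E.

Section Leg.
Context {R : realType} {D A : cstarAlgType R} {uD : D} (hD : is_one uD).
Context (LD : lipschitz_data D) (pi : D -> A) (chi : R).
Implicit Types (k : R) (d : D).

(** States detect the norm of d, and each of them is chi-close to one of the form psi o pi, whose
    value at d is at most |pi d|. *)
Lemma leg_norm k d : seminorm LD -> 0 <= chi -> states_within LD pi chi ->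
  (exists uA : A, is_one uA) -> star_epimorphism pi ->
  dom_sa LD d -> 0 < k -> LD d <= k -> cnorm d <= cnorm (pi d) + k * chi.
Proof.
move=> sL chi0 near [uA hA] piP Ld k0 Ldk.
apply: (sa_norm_le hD); first exact: Ld.2.
move=> phi sphi; have [psi spsi h] := near phi sphi.
have pi1 := star_epimorphism_one hD hA piP.
have spsipi := state_comp hD hA piP.1 pi1 spsi.
have h1 := mk_le_scaled sL sphi.1.1 spsipi.1.1 chi0 h Ld k0 Ldk.
have h2 := state_bound hA (pi d) spsi.
have h3 := le_normcD (phi d - (psi \o pi) d) ((psi \o pi) d).
rewrite subrK in h3; apply: le_trans h3 _; rewrite addrC lerD//.
Qed.

End Leg.

Section Bridge.
Context {R : realType} {D A B : cstarAlgType R}.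
Context {uD : D} {uA : A} {uB : B}.
Context (hD : is_one uD) (hA : is_one uA) (hB : is_one uB).
Context (LD : lipschitz_data D) (LA : lipschitz_data A) (LB : lipschitz_data B).
Context (LLD : leibniz_hermitian_norm LD) (LLA : leibniz_hermitian_norm LA)
  (LLB : leibniz_hermitian_norm LB).
Context (pi : D -> A) (rho : D -> B).
Context (piP : star_epimorphism pi) (rhoP : star_epimorphism rho).
Context (chi : R) (chi0 : 0 < chi).

Definition bridge_gap (x : (D * (A * B))%type) : R :=
  Num.max (cnorm (x.2.1 - pi x.1)) (cnorm (x.2.2 - rho x.1)).

Definition bridge : lipschitz_data (D * (A * B))%type :=
  @LipschitzData R (D * (A * B))%type
    [set x | [/\ dom LD x.1, dom LA x.2.1 & dom LB x.2.2]]
    (fun x => Num.max (LD x.1) (Num.max (Num.max (LA x.2.1) (LB x.2.2))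
       (chi^-1 * bridge_gap x))).

Implicit Types (x y : (D * (A * B))%type) (k r e : R).

Lemma bridge_leP x k : bridge x <= k <->
  [/\ LD x.1 <= k, LA x.2.1 <= k, LB x.2.2 <= k,
      cnorm (x.2.1 - pi x.1) <= chi * k & cnorm (x.2.2 - rho x.1) <= chi * k].
Proof.
rewrite /bridge /bridge_gap /= !ge_max ler_pdivrMl// ge_max.
split=> [/andP[-> /andP[/andP[-> ->] /andP[-> ->]]]//|[-> -> -> -> ->]//].
Qed.

Definition bridge_one : (D * (A * B))%type := (uD, (uA, uB)).

Lemma bridge_is_one : is_one bridge_one.
Proof. by apply: prod_is_one => //; exact: prod_is_one. Qed.

Let pi1 := star_epimorphism_one hD hA piP.
Let rho1 := star_epimorphism_one hD hB rhoP.

Lemma bridge_seminorm : seminorm bridge.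
Proof.
have [[D0 DD DZ Dp] _ _ _ _] := LLD.
have [[A0 AD AZ Ap] _ _ _ _] := LLA.
have [[B0 BD BZ Bp] _ _ _ _] := LLB.
split.
- by split.
- move=> x y [x1 x2 x3] [y1 y2 y3].
  have [d1 d2] := DD _ _ x1 y1; have [a1 a2] := AD _ _ x2 y2.
  have [b1 b2] := BD _ _ x3 y3; split; first by split.
  have /bridge_leP[p1 p2 p3 p4 p5] := lexx (bridge x).
  have /bridge_leP[q1 q2 q3 q4 q5] := lexx (bridge y).
  apply/bridge_leP; split.
  + by apply: le_trans d2 _; exact: lerD.
  + by apply: le_trans a2 _; exact: lerD.
  + by apply: le_trans b2 _; exact: lerD.
  + rewrite /= (star_morphismD piP.1) opprD addrACA mulrDr.
    by rewrite (le_trans (cnormD _ _))// lerD.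
  + rewrite /= (star_morphismD rhoP.1) opprD addrACA mulrDr.
    by rewrite (le_trans (cnormD _ _))// lerD.
- move=> z x [x1 x2 x3].
  have [d1 d2] := DZ z _ x1; have [a1 a2] := AZ z _ x2; have [b1 b2] := BZ z _ x3.
  split; first by split.
  have z0 := normc_ge0 z.
  rewrite /bridge /bridge_gap /= d2 a2 b2.
  rewrite (star_morphismZ piP.1) (star_morphismZ rhoP.1) -!scalerBr !cnormZ.
  by rewrite -!maxr_pMr// mulrCA -!maxr_pMr.
- by move=> x [x1 x2 x3]; rewrite /bridge /= le_max Dp.
Qed.

Lemma bridge_hermitian : Defs.hermitian bridge.
Proof.
have [_ Dh _ _ _] := LLD; have [_ Ah _ _ _] := LLA; have [_ Bh _ _ _] := LLB.
have [[_ _ piS] _] := piP; have [[_ _ rhoS] _] := rhoP.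
move=> x [x1 x2 x3]; have [d1 d2] := Dh _ x1; have [a1 a2] := Ah _ x2.
have [b1 b2] := Bh _ x3; split; first by split.
rewrite /bridge /bridge_gap /= d2 a2 b2 piS rhoS -!cstarB.
by rewrite !cnorm_star.
Qed.

(** Vanishing of the seminorm makes d a scalar, and vanishing of the two gaps forces the same scalar
    in the other coordinates. *)
Lemma bridge_norm_modulo_constants : norm_modulo_constants bridge.
Proof.
have hx := bridge_is_one; split=> [nu|_]; first by exfalso; apply: nu; exists bridge_one.
apply/seteqP; split=> [x [[x1 x2 x3] Lx]|x /(scalarsP hx)[z ->]].
  have /bridge_leP[p1 p2 p3 p4 p5] : bridge x <= 0 by rewrite Lx.
  have [[_ _ _ Dp] _ [_ /(_ (unital_of_one hD)) Dc] _ _] := LLD.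
  have /(scalarsP hD)[z dz] : scalars D x.1.
    by rewrite -Dc; split=> //; apply/le_anti; rewrite p1 Dp.
  have nul (C : cstarAlgType R) (c c' : C) : cnorm (c - c') <= chi * 0 -> c = c'.
    move=> h; apply/eqP; rewrite -subr_eq0; apply/eqP/cnorm_eq0/le_anti.
    by rewrite cnorm_ge0 andbT -(mulr0 chi).
  apply/(scalarsP hx); exists z.
  rewrite [LHS]surjective_pairing [x.2]surjective_pairing (nul _ _ _ p4) (nul _ _ _ p5) dz.
  by rewrite (star_morphismZ piP.1) (star_morphismZ rhoP.1) pi1 rho1.
have [d1 d2] := lip_scalar hD z LLD; have [a1 a2] := lip_scalar hA z LLA.
have [b1 b2] := lip_scalar hB z LLB; split; first by split.
have [_ _ _ Lp] := bridge_seminorm.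
apply/le_anti; rewrite Lp ?andbT; last by split.
apply/bridge_leP; split; rewrite /= ?d2 ?a2 ?b2//.
  by rewrite (star_morphismZ piP.1) pi1 subrr cnorm0 mulr0.
by rewrite (star_morphismZ rhoP.1) rho1 subrr cnorm0 mulr0.
Qed.

(** Write a b - f (d d') = a (b - f d') + (a - f d) f d' and use |f d'| <= |d'|. This is the Leibniz
    rule for the gap term. *)
Lemma leibniz_gap (C : cstarAlgType R) (uC : C) (f : D -> C) (a b : C) (d d' : D)
    (r s p q : R) : is_one uC -> star_epimorphism f ->
  cnorm a <= r -> cnorm d' <= s ->
  cnorm (a - f d) <= chi * p -> cnorm (b - f d') <= chi * q -> 0 <= p -> 0 <= q ->
  cnorm (cmul a b - f (cmul d d')) <= chi * (r * q + p * s).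
Proof.
move=> hC fP ar ds ap bq p0 q0.
have f1 := star_epimorphism_one hD hC fP; have [[_ fM _] _] := fP.
have fc := star_morphism_contractive hD hC fP.1 f1 d'.
have -> : cmul a b - f (cmul d d') = cmul a (b - f d') + cmul (a - f d) (f d').
  by rewrite fM cmulBr cmulBl addrA subrK.
rewrite (le_trans (cnormD _ _))// mulrDr lerD//.
  by rewrite (le_trans (cnormM _ _))// mulrCA ler_pM ?cnorm_ge0.
rewrite (le_trans (cnormM _ _))// mulrA ler_pM ?cnorm_ge0//.
exact: le_trans fc ds.
Qed.

Lemma bridge_leibniz : leibniz bridge.
Proof.
have [_ _ _ Dl _] := LLD; have [_ _ _ Al _] := LLA; have [_ _ _ Bl _] := LLB.
move=> x y xL yL; have [x1 x2 x3] := xL; have [y1 y2 y3] := yL.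
have [d1 d2] := Dl _ _ x1 y1; have [a1 a2] := Al _ _ x2 y2.
have [b1 b2] := Bl _ _ x3 y3; split; first by split.
have [_ _ _ Lp] := bridge_seminorm; have Lx := Lp _ xL; have Ly := Lp _ yL.
have /bridge_leP[p1 p2 p3 p4 p5] := lexx (bridge x).
have /bridge_leP[q1 q2 q3 q4 q5] := lexx (bridge y).
have /prod_cnorm_le[nx1 /prod_cnorm_le[nx2 nx3]] := lexx (cnorm x).
have /prod_cnorm_le[ny1 /prod_cnorm_le[ny2 ny3]] := lexx (cnorm y).
have [[_ _ _ Dp] _ _ _ _] := LLD; have [[_ _ _ Ap] _ _ _ _] := LLA.
have [[_ _ _ Bp] _ _ _ _] := LLB.
apply/bridge_leP; split.
- by apply: le_trans d2 _; rewrite lerD// ler_pM ?cnorm_ge0 ?Dp.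
- by apply: le_trans a2 _; rewrite lerD// ler_pM ?cnorm_ge0 ?Ap.
- by apply: le_trans b2 _; rewrite lerD// ler_pM ?cnorm_ge0 ?Bp.
- exact: (leibniz_gap hA piP nx2 ny1 p4 q4).
- exact: (leibniz_gap hB rhoP nx3 ny1 p5 q5).
Qed.

Lemma bridge_dense : dense (dom bridge).
Proof.
have [_ _ _ _ /dense_cnorm Dd] := LLD; have [_ _ _ _ /dense_cnorm Ad] := LLA.
have [_ _ _ _ /dense_cnorm Bd] := LLB.
apply/dense_cnorm => x e e0.
have [d Ld dx] := Dd x.1 e e0; have [a La ax] := Ad x.2.1 e e0.
have [b Lb bx] := Bd x.2.2 e e0; exists (d, (a, b)); first by split.
by apply/prod_cnorm_lt; split=> //; apply/prod_cnorm_lt.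
Qed.

Lemma bridge_leibniz_hermitian_norm : leibniz_hermitian_norm bridge.
Proof.
split; [exact: bridge_seminorm|exact: bridge_hermitian|
  exact: bridge_norm_modulo_constants|exact: bridge_leibniz|exact: bridge_dense].
Qed.

Lemma bridge_sa x : sa (D * (A * B))%type x <-> [/\ sa D x.1, sa A x.2.1 & sa B x.2.2].
Proof.
case: x => d [a b]; rewrite /sa/=; split=> [[-> -> ->]//|[da aa bb]].
by congr (_, (_, _)).
Qed.

Lemma bridge_sa_ball x : sa_ball bridge x ->
  [/\ sa_ball LD x.1, sa_ball LA x.2.1, sa_ball LB x.2.2,
      cnorm (x.2.1 - pi x.1) <= chi & cnorm (x.2.2 - rho x.1) <= chi].
Proof.
move=> [[[x1 x2 x3] /bridge_sa[s1 s2 s3]] /bridge_leP[p1 p2 p3]].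
by rewrite mulr1 => p4 p5; split.
Qed.

Lemma bridge_closed : closed (sa_ball LD) -> closed (sa_ball LA) ->
  closed (sa_ball LB) -> closed (sa_ball bridge).
Proof.
move=> /closed_cnorm cD /closed_cnorm cA /closed_cnorm cB.
apply/closed_cnorm => x h.
have h' e : 0 < e -> exists y, [/\ sa_ball bridge y, cnorm (x.1 - y.1) < e,
    cnorm (x.2.1 - y.2.1) < e & cnorm (x.2.2 - y.2.2) < e].
  move=> /h[y yL /prod_cnorm_lt[/= xy1 /prod_cnorm_lt[/= xy2 xy3]]].
  by exists y.
have dx : sa_ball LD x.1.
  by apply: cD => e /h'[y [/bridge_sa_ball[]]]; exists y.1.
have ax : sa_ball LA x.2.1.
  by apply: cA => e /h'[y [/bridge_sa_ball[]]]; exists y.2.1.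
have bx : sa_ball LB x.2.2.
  by apply: cB => e /h'[y [/bridge_sa_ball[]]]; exists y.2.2.
(* One e for replacing a by c, another for replacing d by d', as f is contractive. *)
have gap (C : cstarAlgType R) (uC : C) (f : D -> C) (a c : C) (d d' : D) e :
    is_one uC -> star_epimorphism f -> cnorm (c - f d') <= chi ->
    cnorm (d - d') < e -> cnorm (a - c) < e -> cnorm (a - f d) <= chi + 2 * e.
  move=> hC fP cd dd ac.
  have f1 := star_epimorphism_one hD hC fP.
  have := star_morphism_contractive hD hC fP.1 f1 (d' - d).
  rewrite (star_morphismB fP.1) cnormBC (cnormBC d' d) => fdd.
  have := cnorm_sub_triangle c a (f d).
  have := cnorm_sub_triangle (f d') c (f d); rewrite (cnormBC (f d') (f d)); lra.
split; first by split; [split; [exact: dx.1.1|exact: ax.1.1|exact: bx.1.1]|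
  apply/bridge_sa; split; [exact: dx.1.2|exact: ax.1.2|exact: bx.1.2]].
apply/bridge_leP; rewrite mulr1; split; [exact: dx.2|exact: ax.2|exact: bx.2| |].
  apply/ler_addgt0Pr => e e0; have e2 : 0 < e / 2 by rewrite divr_gt0.
  have [y [/bridge_sa_ball[_ _ _ p4 p5] y1 y2 y3]] := h' _ e2.
  by have := gap _ _ _ _ _ _ _ _ hA piP p4 y1 y2; lra.
apply/ler_addgt0Pr => e e0; have e2 : 0 < e / 2 by rewrite divr_gt0.
have [y [/bridge_sa_ball[_ _ _ p4 p5] y1 y2 y3]] := h' _ e2.
by have := gap _ _ _ _ _ _ _ _ hB rhoP p5 y1 y3; lra.
Qed.

End Bridge.

(** * Lifts along quantum isometries *)

Section Isometry.
Context {R : realType} {D A : cstarAlgType R} {uD : D} {uA : A}.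
Context (hD : is_one uD) (hA : is_one uA).
Context (LD : lipschitz_data D) (LA : lipschitz_data A) (pi : D -> A).
Context (sLD : seminorm LD) (sLA : seminorm LA).
Implicit Types (k M chi : R) (d : D) (a : A).

Lemma isometry_le d : quantum_isometry LD LA pi -> dom_sa LD d -> LA (pi d) <= LD d.
Proof.
move=> [[piM _] pidom iso] Ld.
have Lpd : dom_sa LA (pi d).
  by split; [exact: pidom|exact: star_morphism_sa Ld.2].
by rewrite -lee_fin (iso _ Lpd); apply: ereal_inf_lbound; exists d.
Qed.

Lemma isometry_lift a k : quantum_isometry LD LA pi -> dom_sa LA a -> LA a < k ->
  exists d, [/\ dom_sa LD d, pi d = a & LD d < k].
Proof.
move=> [_ _ iso] La; rewrite -lte_fin (iso _ La) => /ereal_inf_lt[_ [d [Ld pid] <-]].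
by rewrite lte_fin => Ldk; exists d.
Qed.

(* The exact lift [d0] of [a] has norm at most [|a| + k chi]; scaling it by
   [M / (M + chi)] restores the norm bound [k M] and moves [pi d0] by at most
   [k chi]. *)
Lemma isometry_approx_lift a k M chi : quantum_isometry LD LA pi ->
  0 < chi -> states_within LD pi chi -> 0 < M -> 0 < k -> dom_sa LA a ->
  norm_LM LA M a < k ->
  exists d, [/\ dom_sa LD d, M^-1 * cnorm d <= k, LD d <= k &
    cnorm (a - pi d) <= chi * k].
Proof.
move=> iso chi0 near M0 k0 La; rewrite /norm_LM gt_max ltr_pdivrMl// => /andP[na Lak].
have [d0 [Ld0 pid0 Ld0k]] := isometry_lift iso La Lak.
have [piP _ _] := iso.
have := leg_norm hD sLD (ltW chi0) near (ex_intro _ uA hA) piP Ld0 k0 (ltW Ld0k).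
rewrite pid0 => nd0.
pose s := M / (M + chi).
have Mc : 0 < M + chi by rewrite addr_gt0.
have s0 : 0 <= s by rewrite divr_ge0 ?ltW.
have s1 : 1 - s = chi / (M + chi).
  by rewrite /s -[X in X - _](divff (lt0r_neq0 Mc)) -mulrBl addrC addKr.
have s1' : s <= 1 by rewrite -subr_ge0 s1 divr_ge0 ?ltW.
have [Lsd LsdE] := seminormZr sLD Ld0 s0.
have [_ _ _ Lpos] := sLD.
exists (s%:C *: d0); split => //.
- rewrite cnormZr ger0_norm// ler_pdivrMl// /s mulrAC.
  rewrite (ler_pdivrMr _ _ Mc) -mulrA ler_pM2l//.
  by rewrite mulrDr; lra.
- rewrite LsdE (le_trans _ (ltW Ld0k))// ler_piMl// Lpos//; exact: Ld0.1.
(* The scaled lift is mapped to s a, at distance (1 - s) |a| <= (chi / (M + chi)) M k <= chi k from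
   a. *)
- rewrite (star_morphismZ piP.1) pid0 -[X in X - _]scale1r.
  rewrite -(rmorph1 (real_complex R)) -scalerBl -rmorphB cnormZr s1.
  rewrite (ger0_norm (divr_ge0 (ltW chi0) (ltW Mc))) mulrAC (ler_pdivrMr _ _ Mc).
  rewrite -mulrA ler_pM2l//.
  have := mulr_ge0 (ltW k0) (ltW chi0); rewrite mulrDr; lra.
Qed.

End Isometry.

Section ApproximateUnit.
Context {R : realType}.

Lemma approximate_unit_one (A : cstarAlgType R) (u : A) : is_one u ->
  approximate_unit (globally [set u]).
Proof.
move=> hu; have hl x : cmul u x = x by have [_ /(_ x) []] := hu.
have hr x : cmul x u = x by have [_ /(_ x) []] := hu.
split; first exact: globally_properfilter.
- move=> _ ->; split; last by rewrite (cnorm_one hu).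
  by exists u; rewrite hr (sa_one hu : cstar u = u).
- by move=> a U aU _ -> /=; rewrite hl; exact: nbhs_singleton aU.
- by move=> a U aU _ -> /=; rewrite hr; exact: nbhs_singleton aU.
Qed.

Lemma unital_proper_morphism (D A : cstarAlgType R) (uD : D) (uA : A) (pi : D -> A) :
  is_one uD -> is_one uA -> pi uD = uA -> proper_morphism pi.
Proof.
move=> hD hA pi1; exists (globally [set uD]); split; first exact: approximate_unit_one.
have -> : pi @ globally [set uD] = globally [set uA].
  apply/funext => U; apply/propext; split=> [h _ ->|h _ ->] /=; first by rewrite -pi1; exact: h.
  by rewrite pi1; exact: h.
exact: approximate_unit_one.
Qed.

Lemma scalars_topographic (D A : cstarAlgType R) (uD : D) (uA : A)
    (LD : lipschitz_data D) (LA : lipschitz_data A) (pi : D -> A) :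
  is_one uD -> is_one uA -> leibniz_hermitian_norm LD -> leibniz_hermitian_norm LA ->
  star_morphism pi -> pi uD = uA ->
  topographic LD (scalars D) LA (scalars A) pi.
Proof.
move=> hD hA LLD LLA piM pi1; split.
  move=> _ [_ /(scalarsP hD)[z ->] <-]; apply/(scalarsP hA); exists z.
  by rewrite (star_morphismZ piM) pi1.
move=> a eps [_ sa_a] /(scalarsP hA)[z az] eps0.
(* The scalar has to be real for its multiple of the unit of D to be self-adjoint. *)
have zz : z^* = z.
  have := sa_a; rewrite /sa/= az cstarZ (sa_one hA : cstar uA = uA) => /eqP.
  rewrite -subr_eq0 -scalerBl scaler_eq0 subr_eq0 => /orP[/eqP//|/eqP u0].
  by have [] := hA.
have e1 : 1 <= expR eps by rewrite -expR0 ler_expR ltW.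
have [Lz Lz0] := lip_scalar hD z LLD; have [_ La0] := lip_scalar hA z LLA.
exists (z *: uD); split.
- split; first by apply/(scalarsP hD); exists z.
  by split=> //; rewrite /sa/= cstarZ zz (sa_one hD : cstar uD = uD).
- by rewrite (star_morphismZ piM) pi1 az.
- by rewrite az !cnormZ (cnorm_one hD) (cnorm_one hA) mulr1 ler_peMl// normc_ge0.
- by rewrite Lz0 az La0 mulr0.
Qed.

End ApproximateUnit.

(** * Moving quasi-states across the tunnel *)

Section QuasiStates.
Context {R : realType} {D A B : cstarAlgType R}.
Context {uD : D} {uA : A} {uB : B}.
Context (hD : is_one uD) (hA : is_one uA) (hB : is_one uB).
Context (LD : lipschitz_data D) (pi : D -> A) (rho : D -> B).
Context (piP : star_epimorphism pi) (rhoP : star_epimorphism rho).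
Context (chi : R) (chi0 : 0 < chi).

(** Closeness is given for states only, so phi is divided by its mass phi(1) and the nearby state is
    multiplied back. *)
Lemma positive_functional_within phi : states_within LD pi chi ->
  positive_functional phi -> exists psi, [/\ positive_functional psi,
    psi uA = phi uD &
    forall d, sa_ball LD d ->
      normc (phi d - psi (pi d)) <= complex.Re (phi uD) * chi].
Proof.
move=> near pphi; have [phi1 phi0] := positive_functional_one_ge0 hD pphi.
set s := complex.Re (phi uD) in phi1 phi0 *.
(* A positive functional of mass 0 vanishes, and 0 is its companion. *)
have [s0|s0] := eqVneq s 0.
  exists (fun=> 0); split.
  - by split=> [z a b|a]; rewrite ?mulr0 ?addr0.
  - by rewrite phi1 s0.
  - move=> d _; rewrite subr0 (le_trans (positive_functional_bound hD d pphi))//.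
    by rewrite -/s s0 !mul0r.
have spos : 0 < s by rewrite lt_neqAle eq_sym s0.
have sC0 : s%:C != 0 by rewrite eq_complex /= negb_and s0.
pose nphi d := (s%:C)^-1 * phi d.
have snphi : state D nphi.
  apply/(stateP hD); split; last by rewrite /nphi phi1 mulVf.
  split=> [z a b|a]; first by rewrite /nphi pphi.1 mulrDr mulrCA.
  by rewrite mulr_ge0 ?invr_ge0 ?ler0c// pphi.2.
have [psi /(stateP hA)[ppsi psi1] h] := near _ snphi.
exists (fun a => s%:C * psi a); split.
- split=> [z a b|a]; first by rewrite ppsi.1 mulrDr mulrCA.
  by rewrite mulr_ge0 ?ler0c// ppsi.2.
- by rewrite psi1 mulr1 phi1.
- move=> d Ld; have := (mk_leP _ _ _ (ltW chi0)).1 h d Ld.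
  have -> : phi d - s%:C * psi (pi d) = s%:C * (nphi d - (psi \o pi) d).
    by rewrite mulrBr /nphi mulrA mulfV// mul1r.
  rewrite ComplexField.Normc.normcM normc_real ger0_norm// => ?.
  by rewrite ler_pM2l.
Qed.

Lemma positive_functional_dist (C : cstarAlgType R) (uC : C) phi (a b : C) r :
  is_one uC -> positive_functional phi -> cnorm (a - b) <= r ->
  normc (phi a - phi b) <= complex.Re (phi uC) * r.
Proof.
move=> hC pphi ab; have [_ phi0] := positive_functional_one_ge0 hC pphi.
rewrite -(scalar_funB _ _ pphi.1) (le_trans (positive_functional_bound hC _ pphi))//.
by rewrite ler_wpM2l.
Qed.

Lemma positive_functionalD (C : cstarAlgType R) (phi psi : C -> R[i]) :
  positive_functional phi -> positive_functional psi ->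
  positive_functional (fun a => phi a + psi a).
Proof.
move=> pphi ppsi; split=> [z a b|a]; last by rewrite addr_ge0 ?pphi.2 ?ppsi.2.
by rewrite pphi.1 ppsi.1 mulrDr addrACA.
Qed.

(** A quasi-state of the bridge is a sum of three parts. The A part stays; the D part is replaced
    through pi and moved from pi d to a, at cost 2 chi times its mass. The B part is moved from b to
    rho d, through D, and from pi d to a, at cost 3 chi times its mass. The masses add up to at most
    1. *)
Lemma quasi_state_transport phiD phiA phiB :
  states_within LD pi chi ->
  positive_functional phiD -> positive_functional phiA -> positive_functional phiB ->
  complex.Re (phiD uD) + complex.Re (phiA uA) + complex.Re (phiB uB) <= 1 ->
  exists2 psi, quasi_state A psi & forall d a b, sa_ball LD d ->
    cnorm (a - pi d) <= chi -> cnorm (b - rho d) <= chi ->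
    normc (phiD d + phiA a + phiB b - psi a) <= 3 * chi.
Proof.
move=> near pD pA pB mass.
have rho1 := star_epimorphism_one hD hB rhoP.
have pBD := positive_functional_comp rhoP.1 pB.
have [psiD [ppsiD psiD1 hpsiD]] := positive_functional_within near pD.
have [psiB [ppsiB psiB1 hpsiB]] := positive_functional_within near pBD.
rewrite /= rho1 in psiB1 hpsiB.
have [_ sD] := positive_functional_one_ge0 hD pD.
have [_ sA] := positive_functional_one_ge0 hA pA.
have [_ sB] := positive_functional_one_ge0 hB pB.
exists (fun a => (phiA a + psiD a) + psiB a).
  apply/(quasi_stateP hA); split; first by do 2?apply: positive_functionalD.
  by rewrite !Re_add psiD1 psiB1; lra.
move=> d a b Ld ad bd.
have g1 := hpsiD d Ld; have g2 := hpsiB d Ld.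
have g3 : normc (psiD (pi d) - psiD a) <= complex.Re (psiD uA) * chi.
  by apply: positive_functional_dist; rewrite // cnormBC.
have g4 : normc (psiB (pi d) - psiB a) <= complex.Re (psiB uA) * chi.
  by apply: positive_functional_dist; rewrite // cnormBC.
have g5 : normc (phiB b - phiB (rho d)) <= complex.Re (phiB uB) * chi.
  exact: positive_functional_dist.
rewrite psiD1 in g3; rewrite psiB1 in g4.
have -> : phiD d + phiA a + phiB b - (phiA a + psiD a + psiB a) =
   ((phiD d - psiD (pi d)) + (psiD (pi d) - psiD a)) +
   (((phiB b - phiB (rho d)) + (phiB (rho d) - psiB (pi d))) + (psiB (pi d) - psiB a)).
  by ring.
have f1 := le_normcD (phiD d - psiD (pi d)) (psiD (pi d) - psiD a).
have f2 := le_normcD (phiB b - phiB (rho d)) (phiB (rho d) - psiB (pi d)).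
have f3 := le_normcD ((phiB b - phiB (rho d)) + (phiB (rho d) - psiB (pi d)))
  (psiB (pi d) - psiB a).
have f4 := le_normcD ((phiD d - psiD (pi d)) + (psiD (pi d) - psiD a))
   (((phiB b - phiB (rho d)) + (phiB (rho d) - psiB (pi d))) + (psiB (pi d) - psiB a)).
set sd := complex.Re (phiD uD) in mass sD g1 g3 *.
set sb := complex.Re (phiB uB) in mass sB g2 g4 g5 *.
have m1 : 0 <= sd * chi by rewrite mulr_ge0// ltW.
have m2 : (sd + sb) * chi <= 1 * chi by rewrite ler_pM2r//; lra.
rewrite mulrDl mul1r in m2; lra.
Qed.

End QuasiStates.

(** * Compactness of the bridge and its two M-isometries *)

Section CompactBridge.
Context {R : realType} {D A B : qcms R} {uD : D} {uA : A} {uB : B}.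
Context (hD : is_one uD) (hA : is_one uA) (hB : is_one uB).
Context (pi : D -> A) (rho : D -> B).
Context (piP : quantum_isometry (qcms_lip D) (qcms_lip A) pi)
  (rhoP : quantum_isometry (qcms_lip D) (qcms_lip B) rho).
Context (chi : R) (chi0 : 0 < chi).
Context (nearA : states_within (qcms_lip D) pi chi)
  (nearB : states_within (qcms_lip D) rho chi).

Let LD := qcms_lip D.
Let LA := qcms_lip A.
Let LB := qcms_lip B.

Let LLD : leibniz_hermitian_norm LD. Proof. by case: (qcmsP D). Qed.
Let LLA : leibniz_hermitian_norm LA. Proof. by case: (qcmsP A). Qed.
Let LLB : leibniz_hermitian_norm LB. Proof. by case: (qcmsP B). Qed.
Let epi : star_epimorphism pi. Proof. by case: piP. Qed.
Let erho : star_epimorphism rho. Proof. by case: rhoP. Qed.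
Let pi1 : pi uD = uA. Proof. exact: star_epimorphism_one. Qed.
Let rho1 : rho uD = uB. Proof. exact: star_epimorphism_one. Qed.

Local Notation C := (D * (A * B))%type.
Local Notation L := (bridge LD LA LB pi rho chi).
Local Notation u := (@bridge_one R D A B uD uA uB).

Let hu : is_one (u : C). Proof. exact: bridge_is_one. Qed.

Lemma bridge_LHN : leibniz_hermitian_norm L.
Proof. exact: (bridge_leibniz_hermitian_norm hD hA hB). Qed.

Lemma bridge_bounded : exists K, forall x : C, sa_ball L x ->
  exists r, cnorm (x - r%:C *: (u : C)) <= K.
Proof.
have [mu smu] := unital_state hA.
have [_ _ _ mkA] := qcmsP A.
have [K bdd] := sa_ball_bounded hA mkA LLA smu.
(* The coordinate in A is within K of the scalar r, its neighbour pi d within K + chi. By [leg_norm]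
   d is within K + 2 chi, hence so is rho d, and the coordinate in B is within K + 3 chi. *)
exists (K + 3 * chi) => x /(bridge_sa_ball chi0)[x1 x2 x3 x4 x5].
exists (complex.Re (mu x.2.1)); set r := complex.Re _.
have b2 : cnorm (x.2.1 - r%:C *: uA) <= K := bdd _ x2.
have Ld := lip_sub_scalar hD r LLD x1.
have pid : pi (x.1 - r%:C *: uD) = pi x.1 - r%:C *: uA.
  by rewrite (star_morphismB epi.1) (star_morphismZ epi.1) pi1.
have rhod : rho (x.1 - r%:C *: uD) = rho x.1 - r%:C *: uB.
  by rewrite (star_morphismB erho.1) (star_morphismZ erho.1) rho1.
have [sLD _ _ _ _] := LLD.
have b1 := leg_norm hD sLD (ltW chi0) nearA (ex_intro _ uA hA) epi Ld.1 ltr01 Ld.2.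
rewrite mul1r pid in b1.
have t1 := cnorm_sub_triangle x.2.1 (pi x.1) (r%:C *: uA).
rewrite (cnormBC (pi x.1) x.2.1) in t1.
have c3 := star_morphism_contractive hD hB erho.1 rho1 (x.1 - r%:C *: uD).
rewrite rhod in c3.
have t3 := cnorm_sub_triangle (rho x.1) x.2.2 (r%:C *: uB).
have c0 := chi0.
have f1 : cnorm (x.1 - r%:C *: uD) <= K + 3 * chi by lra.
have f2 : cnorm (x.2.1 - r%:C *: uA) <= K + 3 * chi by lra.
have f3 : cnorm (x.2.2 - r%:C *: uB) <= K + 3 * chi by lra.
by apply/prod_cnorm_le; split=> //; apply/prod_cnorm_le; split.
Qed.

Lemma bridge_totally_bounded K :
  totally_bounded (sa_ball L `&` [set x | cnorm x <= K]).
Proof.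
move=> e e0.
have [_ _ _ [_ mkD]] := qcmsP D; have [_ _ _ [_ mkA]] := qcmsP A.
have [_ _ _ [_ mkB]] := qcmsP B.
have [s1 n1] := sa_ball_totally_bounded hD K mkD e0.
have [s2 n2] := sa_ball_totally_bounded hA K mkA e0.
have [s3 n3] := sa_ball_totally_bounded hB K mkB e0.
exists [seq (p, q) | p <- s1, q <- [seq (p, q) | p <- s2, q <- s3]].
move=> x [/(bridge_sa_ball chi0)[x1 x2 x3 _ _] /prod_cnorm_le[k1 /prod_cnorm_le[k2 k3]]].
have [d ds xd] := n1 _ (conj x1 k1); have [a sa xa] := n2 _ (conj x2 k2).
have [b bs xb] := n3 _ (conj x3 k3).
exists (d, (a, b)).
  by apply: allpairs_f => //; exact: allpairs_f.
by apply/prod_cnorm_lt; split=> //; apply/prod_cnorm_lt.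
Qed.

Lemma bridge_quantum_compact : quantum_compact L.
Proof.
have [K bdd] := bridge_bounded.
have [_ _ cD _] := qcmsP D; have [_ _ cA _] := qcmsP A; have [_ _ cB _] := qcmsP B.
apply: (quantum_compact_of_totally_bounded hu (K := K)) => //.
- exact: bridge_LHN.
- exact: (bridge_closed hD hA hB).
- exact: bridge_totally_bounded.
Qed.

Definition bridge_src (x : C) : A := x.2.1.
Definition bridge_tgt (x : C) : B := x.2.2.

Lemma bridge_src_epi : star_epimorphism bridge_src.
Proof. by split=> // a _; exists (0, (a, 0)). Qed.

Lemma bridge_tgt_epi : star_epimorphism bridge_tgt.
Proof. by split=> // b _; exists (0, (0, b)). Qed.

(** Common to both legs: contractivity gives one inequality, and lifts for every k above the norm
    give the other, as the quotient norm is an infimum. *)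
Lemma quotient_norm_LM (E : cstarAlgType R) (LE : lipschitz_data E) (f : C -> E) M :
  (forall x, dom_sa L x -> LE (f x) <= L x) -> (forall x, cnorm (f x) <= cnorm x) ->
  0 < M -> (forall a, dom_sa LE a -> 0 <= LE a) ->
  (forall a k, dom_sa LE a -> 0 < k -> norm_LM LE M a < k ->
    exists x, [/\ dom_sa L x, f x = a & norm_LM L M x <= k]) ->
  forall a, dom_sa LE a -> (norm_LM LE M a)%:E =
    ereal_inf [set (norm_LM L M x)%:E | x in [set x | dom_sa L x /\ f x = a]].
Proof.
move=> Lf nf M0 LE0 lift a La; apply/le_anti/andP; split.
  apply: le_ereal_inf_tmp => _ [x [Lx <-] <-]; rewrite lee_fin /norm_LM ge_max.
  apply/andP; split; rewrite le_max; last by rewrite Lf ?orbT.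
  by rewrite ler_pM2l ?invr_gt0// nf.
have n0 : 0 <= norm_LM LE M a by rewrite /norm_LM le_max LE0 ?orbT.
apply/lee_addgt0Pr => e e0.
have [||x [Lx xa xk]] := lift a (norm_LM LE M a + e) La.
- by rewrite ltr_wpDl.
- by rewrite ltrDl.
- by rewrite -EFinD; apply: le_trans (_ : (norm_LM L M x)%:E <= _)%E;
    [apply: ereal_inf_lbound; exists x|rewrite lee_fin].
Qed.

Let dom0 (E : qcms R) : dom (qcms_lip E) 0.
Proof. by have [_ [[E0 _ _ _] _ _ _ _] _ _] := qcmsP E. Qed.

Lemma bridge_src_Misometry M : 0 < M -> quantum_Misometry M L LA bridge_src.
Proof.
move=> M0; have src1 : bridge_src u = uA by [].
have [sLD _ _ _ _] := LLD; have [sLA _ _ _ _] := LLA.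
have Lsrc x : dom_sa L x -> LA (bridge_src x) <= L x.
  by move=> _; have /(bridge_leP _ _ _ _ _ chi0)[_ h _ _ _] := lexx (L x).
split=> //.
- split; first exact: bridge_src_epi.
  exact: (unital_proper_morphism hu hA src1).
- apply/seteqP; split=> [_ [x [_ x2 _] <-]//|a La].
  (* The domain of the bridge relates the coordinates in no way, the gap being finite everywhere. *)
  by exists (0, (a, 0)) => //; split=> //; exact: dom0.
- apply: quotient_norm_LM => //.
  + by move=> x; have /prod_cnorm_le[_ /prod_cnorm_le[]] := lexx (cnorm x).
  + by move=> a [La _]; case: sLA => _ _ _; exact.
  move=> a k La k0 ak.
  have [d [Ld nd Ldk ad]] := isometry_approx_lift hD hA sLD piP chi0 nearA M0 k0 La ak.
  have rhod := isometry_le rhoP Ld; have [_ rhodom _] := rhoP.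
  have crho := star_morphism_contractive hD hB erho.1 rho1 d.
  move: ak; rewrite /norm_LM gt_max => /andP[ak1 ak2].
  (* The B coordinate follows d exactly, so only the gap towards A has to be paid. *)
  exists (d, (a, rho d)); split=> //.
    split; first by split; [exact: Ld.1|exact: La.1|exact: rhodom].
    apply/bridge_sa; split; [exact: Ld.2|exact: La.2|].
    exact: (star_morphism_sa erho.1 Ld.2).
  rewrite ge_max; apply/andP; split; last first.
    apply/(bridge_leP _ _ _ _ _ chi0); split=> //=.
    - exact: ltW.
    - exact: le_trans rhod Ldk.
    - by rewrite subrr cnorm0 mulr_ge0// ltW.
  rewrite ler_pdivrMl//; rewrite ler_pdivrMl// in nd; rewrite ltr_pdivrMl// in ak1.
  apply/prod_cnorm_le; split=> //; apply/prod_cnorm_le; split => /=; first exact: ltW.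
  exact: le_trans crho nd.
Qed.

Lemma bridge_tgt_Misometry M : 0 < M -> quantum_Misometry M L LB bridge_tgt.
Proof.
move=> M0; have tgt1 : bridge_tgt u = uB by [].
have [sLD _ _ _ _] := LLD; have [sLB _ _ _ _] := LLB.
have Ltgt x : dom_sa L x -> LB (bridge_tgt x) <= L x.
  by move=> _; have /(bridge_leP _ _ _ _ _ chi0)[_ _ h _ _] := lexx (L x).
split=> //.
- split; first exact: bridge_tgt_epi.
  exact: (unital_proper_morphism hu hB tgt1).
- apply/seteqP; split=> [_ [x [_ _ x3] <-]//|b Lb].
  by exists (0, (0, b)) => //; split=> //; exact: dom0.
- apply: quotient_norm_LM => //.
  + by move=> x; have /prod_cnorm_le[_ /prod_cnorm_le[]] := lexx (cnorm x).
  + by move=> b [Lb _]; case: sLB => _ _ _; exact.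
  move=> b k Lb k0 bk.
  have [d [Ld nd Ldk bd]] := isometry_approx_lift hD hB sLD rhoP chi0 nearB M0 k0 Lb bk.
  have pid := isometry_le piP Ld; have [_ pidom _] := piP.
  have cpi := star_morphism_contractive hD hA epi.1 pi1 d.
  move: bk; rewrite /norm_LM gt_max => /andP[bk1 bk2].
  exists (d, (pi d, b)); split=> //.
    split; first by split; [exact: Ld.1|exact: pidom|exact: Lb.1].
    apply/bridge_sa; split; [exact: Ld.2| |exact: Lb.2].
    exact: (star_morphism_sa epi.1 Ld.2).
  rewrite ge_max; apply/andP; split; last first.
    apply/(bridge_leP _ _ _ _ _ chi0); split=> //=.
    - exact: le_trans pid Ldk.
    - exact: ltW.
    - by rewrite subrr cnorm0 mulr_ge0// ltW.
  rewrite ler_pdivrMl//; rewrite ler_pdivrMl// in nd; rewrite ltr_pdivrMl// in bk1.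
  apply/prod_cnorm_le; split=> //; apply/prod_cnorm_le; split => /=; last exact: ltW.
  exact: le_trans cpi nd.
Qed.

End CompactBridge.

(** * The tunnel and its extent *)

Lemma hausdorff_distance_ge0 (R : realType) (T : Type) (d : T -> T -> \bar R) X Y :
  (0 <= hausdorff_distance d X Y)%E.
Proof.
by apply: le_ereal_inf_tmp => _ [e [e0 _ _] <-]; rewrite lee_fin ltW.
Qed.

(** The strict inequality leaves room to replace the infima by an actual nearby state, which is the
    form used in all estimates on the bridge. *)
Lemma hausdorff_states_within (R : realType) (D A : cstarAlgType R)
    (LD : lipschitz_data D) (pi : D -> A) (chi : R) :
  (hausdorff_distance (mk LD) (state D) (dual_image pi (state A)) < chi%:E)%E ->
  states_within LD pi chi.
Proof.
move=> /ereal_inf_lt[_ [e [e0 sub _] <-]]; rewrite lte_fin => echi phi sphi.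
have : (ereal_inf [set mk LD phi y | y in dual_image pi (state A)] < chi%:E)%E.
  by apply: le_lt_trans (sub phi sphi) _; rewrite lte_fin.
by move=> /ereal_inf_lt[_ [_ [psi spsi <-] <-]] h; exists psi => //; exact: ltW.
Qed.

Section Tunnel.
Context {R : realType} {A B : qcms R} (t : compact_tunnel A B) (chi : R).
Context (chi0 : 0 < chi) (t_chi : (compact_extent t < chi%:E)%E).

Local Notation D := (ct_D t).
Local Notation LD := (qcms_lip D).
Local Notation LA := (qcms_lip A).
Local Notation LB := (qcms_lip B).
Local Notation pi := (ct_pi t).
Local Notation rho := (ct_rho t).

Lemma tunnel_nearA : states_within LD pi chi.
Proof.
apply: hausdorff_states_within; apply: le_lt_trans t_chi.
by rewrite /compact_extent le_max lexx.
Qed.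

Lemma tunnel_nearB : states_within LD rho chi.
Proof.
apply: hausdorff_states_within; apply: le_lt_trans t_chi.
by rewrite /compact_extent le_max lexx orbT.
Qed.

Let piP : quantum_isometry LD LA pi := ct_piP t.
Let rhoP : quantum_isometry LD LB rho := ct_rhoP t.

Section Units.
Context {uD : D} {uA : A} {uB : B}.
Context (hD : is_one uD) (hA : is_one uA) (hB : is_one uB).

Local Notation C := (D * (A * B))%type.
Local Notation L := (bridge LD LA LB pi rho chi).
Local Notation u := (@bridge_one R D A B uD uA uB).
Local Notation src := (@bridge_src R D A B).
Local Notation tgt := (@bridge_tgt R D A B).

Let hu : is_one (u : C). Proof. exact: bridge_is_one. Qed.
Let epi : star_epimorphism pi. Proof. by case: piP. Qed.
Let erho : star_epimorphism rho. Proof. by case: rhoP. Qed.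
Let esrc := @bridge_src_epi R D A B.
Let etgt := @bridge_tgt_epi R D A B.
Let src1 : src u = uA. Proof. by []. Qed.
Let tgt1 : tgt u = uB. Proof. by []. Qed.
Let qcL : quantum_compact L.
Proof.
exact: (bridge_quantum_compact hD hA hB piP rhoP chi0 tunnel_nearA).
Qed.
Let LLL : leibniz_hermitian_norm L. Proof. by case: qcL. Qed.
Let LLA : leibniz_hermitian_norm LA. Proof. by case: (qcmsP A). Qed.
Let LLB : leibniz_hermitian_norm LB. Proof. by case: (qcmsP B). Qed.

Context {muA : A -> R[i]} {muB : B -> R[i]}.
Context (smuA : state A muA) (smuB : state B muB).

Let proper_bridge : pointed_proper L (scalars C) (muA \o src).
Proof.
apply: (quantum_compact_pointed_proper hu qcL).
exact: (state_comp hu hA esrc.1 src1 smuA).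
Qed.

Let Lu : dom L u /\ L u = 0.
Proof. by have := lip_scalar hu 1 LLL; rewrite scale1r. Qed.

Lemma unit_cutoff : dom_sa L u /\ scalars C u.
Proof.
split; first by split; [exact: Lu.1|exact: (sa_one hu)].
by apply/(scalarsP hu); exists 1; rewrite scale1r.
Qed.

(** Built transparently, so that the three terms of its extent unfold to expressions in the bridge
    seminorm. *)
Definition bridge_tunnel (M : R) (M0 : 0 < M) :
  Mtunnel M (qcms_pointed muA) (qcms_pointed muB).
Proof.
refine (@MTunnel R M (qcms_pointed muA) (qcms_pointed muB) _ _
  (C : cstarAlgType R) L (scalars C) src tgt u _ unit_cutoff _ _ _ _ _).
- exact: (quantum_compact_pointed_proper hA (qcmsP A) smuA).
- exact: (quantum_compact_pointed_proper hB (qcmsP B) smuB).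
- by case: proper_bridge.
- exact: (bridge_src_Misometry hD hA hB piP rhoP chi0 tunnel_nearA M0).
- exact: (bridge_tgt_Misometry hD hA hB piP rhoP chi0 tunnel_nearB M0).
- exact: (scalars_topographic hu hA LLL LLA esrc.1 src1).
- exact: (scalars_topographic hu hB LLL LLB etgt.1 tgt1).
- by case: proper_bridge.
Defined.

Lemma bridge_tunnel_cutoff M (M0 : 0 < M) : extent_cutoff (bridge_tunnel M0) = 0.
Proof.
have /(stateP hA)[_ mA1] := smuA; have /(stateP hB)[_ mB1] := smuB.
have -> : extent_cutoff (bridge_tunnel M0) = Num.max (2 * M * L u)
  (Num.max (normc (1 - muA (src u))) (normc (1 - muB (tgt u)))) by [].
rewrite Lu.2 mulr0 src1 tgt1 mA1 mB1 !subrr.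
by rewrite ComplexField.Normc.normc0 !maxxx.
Qed.

(** The three moves are from a to pi d under muA, from muA o pi to muB o rho, and from rho d to b
    under muB. *)
Lemma bridge_tunnel_base M (M0 : 0 < M) :
  (mk LD (muA \o pi) (muB \o rho) <= chi%:E)%E ->
  (extent_base (bridge_tunnel M0) <= (3 * chi)%:E)%E.
Proof.
move=> h; apply/mk_leP; first by rewrite mulr_ge0// ltW.
move=> x /(bridge_sa_ball chi0)[x1 x2 x3 x4 x5] /=.
have g := (mk_leP _ _ _ (ltW chi0)).1 h _ x1.
have g1 := le_trans (state_bound hA (x.2.1 - pi x.1) smuA) x4.
have g2 := le_trans (state_bound hB (x.2.2 - rho x.1) smuB) x5.
rewrite (scalar_funB _ _ smuA.1.1) in g1; rewrite (scalar_funB _ _ smuB.1.1) normc_distC in g2.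
have t1 := normc_dist_triangle (muA x.2.1) (muA (pi x.1)) (muB x.2.2).
have t2 := normc_dist_triangle (muA (pi x.1)) (muB (rho x.1)) (muB x.2.2).
have s1 := le_trans t2 (lerD g g2); have s2 := le_trans t1 (lerD g1 s1).
by apply: le_trans s2 _; lra.
Qed.

Lemma cutdown_one : cutdown_quasi_states (u : C) = quasi_state C.
Proof.
have hl x : cmul (u : C) x = x by have [_ /(_ x) []] := hu.
have hr x : cmul x (u : C) = x by have [_ /(_ x) []] := hu.
apply/seteqP; split=> [_ [phi qphi <-]|phi qphi].
  by rewrite (_ : (fun a => _) = phi)//; apply/funext => a; rewrite hl hr.
by exists phi => //; apply/funext => a; rewrite hl hr.
Qed.

Lemma triple_eq (x y : C) : x.1 = y.1 -> x.2.1 = y.2.1 -> x.2.2 = y.2.2 -> x = y.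
Proof. by case: x y => [d [a b]] [d' [a' b']] /= -> -> ->. Qed.

Lemma bridge_split (phi : C -> R[i]) : scalar phi -> forall x : C,
  phi x = phi (x.1, 0) + phi (0, (x.2.1, 0)) + phi (0, (0, x.2.2)).
Proof.
move=> lphi [d [a b]]; rewrite -!(scalarD _ _ lphi); congr phi.
by apply: triple_eq; rewrite /= ?addr0 ?add0r.
Qed.

(** The test elements of [bl] have seminorm at most 1 whatever M is, hence gaps at most chi, and
    [quasi_state_transport] applies. For the leg to B the roles of A and B are exchanged. *)
Lemma bridge_tunnel_states M (M0 : 0 < M) :
  (extent_states (bridge_tunnel M0) <= (3 * chi)%:E)%E.
Proof.
have c3 : 0 < 3 * chi by rewrite mulr_gt0.
apply: ereal_inf_lbound; exists (3 * chi) => //.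
have comp phi : quasi_state C phi -> [/\ positive_functional (fun d => phi (d, 0)),
    positive_functional (fun a => phi (0, (a, 0))),
    positive_functional (fun b => phi (0, (0, b))) &
    complex.Re (phi (uD, 0)) + complex.Re (phi (0, (uA, 0))) +
      complex.Re (phi (0, (0, uB))) <= 1].
  move=> /(quasi_stateP hu)[[lphi phi0] phi1]; split.
  - split=> [z a b|a].
      by rewrite -lphi; congr phi; apply: triple_eq; rewrite //= scaler0 addr0.
    rewrite (_ : (_, 0) = cmul (cstar ((a, 0) : C)) (a, 0)) ?phi0//.
    by apply: triple_eq => //; exact: (esym (cmul0r _)).
  - split=> [z a b|a].
      by rewrite -lphi; congr phi; apply: triple_eq; rewrite //= scaler0 addr0.
    rewrite (_ : (0, _) = cmul (cstar ((0, (a, 0)) : C)) (0, (a, 0))) ?phi0//.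
    by apply: triple_eq => //; exact: (esym (cmul0r _)).
  - split=> [z a b|a].
      by rewrite -lphi; congr phi; apply: triple_eq; rewrite //= scaler0 addr0.
    rewrite (_ : (0, _) = cmul (cstar ((0, (0, a)) : C)) (0, (0, a))) ?phi0//.
    by apply: triple_eq => //; exact: (esym (cmul0r _)).
  - by rewrite -!Re_add -(bridge_split lphi u).
split=> // phi; rewrite /= cutdown_one => qphi;
  have [pD pA pB mass] := comp _ qphi; have lphi := qphi.1.1.
- have [psi qpsi hpsi] := quasi_state_transport hD hA hB erho chi0 tunnel_nearA pD pA pB mass.
  apply: le_trans (ereal_inf_lbound _) _; first by exists (psi \o src) => //; exists psi.
  apply/bl_leP; first exact: ltW.
  move=> x Lx; rewrite /norm_LM ge_max => /andP[_ Lx1].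
  have [x1 x2 x3 x4 x5] := bridge_sa_ball chi0 (conj Lx Lx1).
  by rewrite (bridge_split lphi); exact: hpsi.
- have mass' : complex.Re (phi (uD, 0)) + complex.Re (phi (0, (0, uB))) +
      complex.Re (phi (0, (uA, 0))) <= 1 by rewrite addrAC.
  have [psi qpsi hpsi] := quasi_state_transport hD hB hA epi chi0 tunnel_nearB pD pB pA mass'.
  apply: le_trans (ereal_inf_lbound _) _; first by exists (psi \o tgt) => //; exists psi.
  apply/bl_leP; first exact: ltW.
  move=> x Lx; rewrite /norm_LM ge_max => /andP[_ Lx1].
  have [x1 x2 x3 x4 x5] := bridge_sa_ball chi0 (conj Lx Lx1).
  by rewrite (bridge_split lphi) [X in normc (X - _)]addrAC; exact: hpsi.
Qed.

Lemma local_metametric_le M : 0 < M ->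
  (mk LD (muA \o pi) (muB \o rho) <= chi%:E)%E ->
  (local_metametric M (qcms_pointed muA) (qcms_pointed muB) <= (3 * chi)%:E)%E.
Proof.
move=> M0 h; apply: le_trans (ereal_inf_lbound _) _.
  by exists (bridge_tunnel M0).
rewrite /extent !ge_max bridge_tunnel_states bridge_tunnel_base//=.
by rewrite bridge_tunnel_cutoff lee_fin mulr_ge0// ltW.
Qed.

(** Test elements in A lift to D with seminorm below 1 + delta for every delta > 0, as the isometry
    is expressed by an infimum. *)
Lemma mk_isometry (phi psi : A -> R[i]) : state A phi -> state A psi ->
  (mk LA phi psi <= mk LD (phi \o pi) (psi \o pi))%E.
Proof.
move=> sphi spsi; have pi1 := star_epimorphism_one hD hA epi.
have s1 := state_comp hD hA epi.1 pi1 sphi; have s2 := state_comp hD hA epi.1 pi1 spsi.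
have [_ [sLD _ _ _ _] _ [[fin _ _ _] _]] := qcmsP D.
have [m0 mfin] := fin _ _ s1 s2.
have mE : mk LD (phi \o pi) (psi \o pi) = (fine (mk LD (phi \o pi) (psi \o pi)))%:E.
  by rewrite fineK// ge0_fin_numE.
have r0 := fine_ge0 m0; set r := fine _ in mE r0; rewrite mE.
apply/mk_leP => // a [La La1].
have r1 : 0 < r + 1 by rewrite ltr_wpDl.
(* This delta gives (1 + delta) r <= r + e, including when r = 0. *)
apply/ler_addgt0Pr => e e0; have e1 : 0 < e / (r + 1) by rewrite divr_gt0.
have [|d [Ld <- /ltW Ldk]] := @isometry_lift _ _ _ _ _ _ a (1 + e / (r + 1)) piP La.
  by rewrite (le_lt_trans La1)// ltrDl.
have k0 : 0 < 1 + e / (r + 1) by rewrite addr_gt0.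
have mle : (mk LD (phi \o pi) (psi \o pi) <= r%:E)%E by rewrite mE.
apply: le_trans (mk_le_scaled sLD s1.1.1 s2.1.1 r0 mle Ld k0 Ldk) _.
rewrite mulrDl mul1r lerD2l mulrAC -mulrA ler_piMr ?(ltW e0)//.
by rewrite ler_pdivrMr// mul1r lerDl.
Qed.

Lemma mk_isometry_ge (phi psi : B -> R[i]) :
  (mk LD (phi \o rho) (psi \o rho) <= mk LB phi psi)%E.
Proof.
apply: ge_esup => [|_ [d [Ld Ld1] <-]]; first exact: esup_ge0.
apply: esup_ubound; exists (rho d) => //; have [_ rhodom _] := rhoP.
split; first by split; [exact: rhodom|exact: (star_morphism_sa erho.1 Ld.2)].
exact: le_trans (isometry_le rhoP Ld) Ld1.
Qed.

(** Two states of A, seen in D, are each chi-close to a state coming from B; the distance in D of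
    states coming from B is at most their distance in B. *)
Lemma tunnel_qdiam_le : (qdiam LA <= qdiam LB + (2 * chi)%:E)%E.
Proof.
apply: ge_esup => [|_ [phi [psi [sphi spsi ->]]]].
  by rewrite adde_ge0 ?esup_ge0// lee_fin mulr_ge0// ltW.
have pi1 := star_epimorphism_one hD hA epi.
have [phi' sphi' h1] := tunnel_nearB (state_comp hD hA epi.1 pi1 sphi).
have [psi' spsi' h2] := tunnel_nearB (state_comp hD hA epi.1 pi1 spsi).
apply: le_trans (mk_isometry sphi spsi) _.
apply: le_trans (mk_triangle _ _ (phi' \o rho) _) _.
have h3 : (mk LD (phi' \o rho) (psi' \o rho) <= qdiam LB)%E.
  apply: le_trans (mk_isometry_ge _ _) _; apply: esup_ubound.
  by exists phi', psi'.
have h4 : (mk LD (phi' \o rho) (psi \o pi) <= qdiam LB + chi%:E)%E.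
  apply: le_trans (mk_triangle _ _ (psi' \o rho) _) _; apply: leeD => //.
  by rewrite mkC.
apply: le_trans (leeD h1 h4) _.
rewrite addeCA -EFinD (_ : chi + chi = 2 * chi)//; ring.
Qed.

End Units.
End Tunnel.

(** * Passage to the limit *)

Section Limits.
Context {R : realType}.
Implicit Types (A B : qcms R).

Definition tunnel_sym A B (t : compact_tunnel A B) : compact_tunnel B A :=
  CompactTunnel (ct_rhoP t) (ct_piP t).

Lemma tunnel_symE A B (t : compact_tunnel A B) :
  compact_extent (tunnel_sym t) = compact_extent t.
Proof. by rewrite /compact_extent maxC. Qed.

Lemma qcms_one A : exists u : A, is_one u.
Proof. by case: (qcmsP A). Qed.

(** A Lipschitz ball lies within K of the scalars, so two states differ on it by at most 2 K.
    Finiteness turns the diameter term into a difference of real exponentials. *)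
Lemma qdiam_fin A : exists2 q : R, 0 <= q & qdiam (qcms_lip A) = q%:E.
Proof.
have [u hu] := qcms_one A; have [_ LL _ mkA] := qcmsP A.
have [mu smu] := unital_state hu.
have [K bdd] := sa_ball_bounded hu mkA LL smu.
have [[L0 _ LZ _] _ _ _ _] := LL.
have K0 : 0 <= K.
  apply: le_trans (cnorm_ge0 _) (bdd 0 _); split; first by split=> //; exact: sa0.
  by have := LZ 0 _ L0; rewrite scale0r ComplexField.Normc.normc0 mul0r => -[_ ->].
have q0 : (0 <= qdiam (qcms_lip A))%E := esup_ge0 _.
have qK : (qdiam (qcms_lip A) <= (K + K)%:E)%E.
  apply: ge_esup => [|_ [phi [psi [sphi spsi ->]]]]; first by rewrite lee_fin addr_ge0.
  apply/mk_leP; first by rewrite addr_ge0.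
  move=> x Lx; rewrite -(state_sub_scalar hu x (complex.Re (mu x))%:C sphi spsi).
  rewrite (le_trans (le_normcD _ _))// normcN lerD//.
    by rewrite (le_trans (state_bound hu _ sphi))// bdd.
  by rewrite (le_trans (state_bound hu _ spsi))// bdd.
exists (fine (qdiam (qcms_lip A))); first exact: fine_ge0.
by rewrite fineK// ge0_fin_numE// (le_lt_trans qK)// ltry.
Qed.

(** For a <= b factor out exp (- a) <= 1 and use exp x >= 1 + x at x = a - b. *)
Lemma expRN_lipschitz (a b : R) : 0 <= a -> 0 <= b ->
  `|expR (- a) - expR (- b)| <= `|a - b|.
Proof.
wlog ab : a b / a <= b.
  move=> h a0 b0; have [ab|/ltW ba] := leP a b; first exact: h.
  by rewrite distrC (distrC a) h.
move=> a0 b0; rewrite ger0_norm ?subr_ge0 ?ler_expR ?lerN2//.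
rewrite distrC ger0_norm ?subr_ge0//.
have -> : expR (- a) - expR (- b) = expR (- a) * (1 - expR (a - b)).
  by rewrite mulrBr mulr1 -expRD addrA addNr add0r.
rewrite -[leRHS]mul1r ler_pM ?expR_ge0 ?subr_ge0//.
- by rewrite -expR0 ler_expR subr_le0.
- by rewrite -expR0 ler_expR oppr_le0.
- by have := expR_ge1Dx (a - b); lra.
Qed.

Lemma local_metametric_ge0 M A B (muA : A -> R[i]) (muB : B -> R[i]) :
  (0 <= local_metametric M (qcms_pointed muA) (qcms_pointed muB))%E.
Proof.
apply: le_ereal_inf_tmp => _ [t ->].
by rewrite /extent !le_max [(0 <= extent_base _)%E]esup_ge0 orbT.
Qed.

Lemma propinquity_ge0 A B : (0 <= propinquity A B)%E.
Proof.
apply: le_ereal_inf_tmp => _ [t ->].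
by rewrite /compact_extent le_max hausdorff_distance_ge0.
Qed.

Lemma quantum_metametric_ge0 A B (muA : A -> R[i]) (muB : B -> R[i]) :
  (0 <= quantum_metametric (qcms_pointed muA) (qcms_pointed muB))%E.
Proof. by rewrite /quantum_metametric le_max abse_ge0 orbT. Qed.

Lemma metametric_bound A B (t : compact_tunnel A B) (chi : R)
    (muB : B -> R[i]) : 0 < chi -> (compact_extent t < chi%:E)%E -> state B muB ->
  exists muA, [/\ state A muA,
    (forall M, 0 < M ->
      (local_metametric M (qcms_pointed muA) (qcms_pointed muB) <= (3 * chi)%:E)%E) &
    (quantum_metametric (qcms_pointed muA) (qcms_pointed muB) <= (4 * chi)%:E)%E].
Proof.
move=> chi0 t_chi smuB.
have [uA hA] := qcms_one A; have [uB hB] := qcms_one B.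
have [uD hD] := qcms_one (ct_D t).
have [erho _ _] := ct_rhoP t.
have rho1 := star_epimorphism_one hD hB erho.
have [muA smuA h] := tunnel_nearA t_chi (state_comp hD hB erho.1 rho1 smuB).
rewrite mkC in h.
have loc M : 0 < M ->
    (local_metametric M (qcms_pointed muA) (qcms_pointed muB) <= (3 * chi)%:E)%E.
  by move=> M0; exact: (local_metametric_le chi0 t_chi hD hA hB smuA smuB M0 h).
exists muA; split=> //.
rewrite /quantum_metametric ge_max; apply/andP; split.
  (* The supremum of the local distances, at most 3 chi, must be strictly below the chosen epsilon;
     hence 4. *)
  apply: ereal_inf_lbound; exists (4 * chi) => //; split; first by rewrite mulr_gt0.
  apply: (@le_lt_trans _ _ (3 * chi)%:E); last by rewrite lte_fin ltr_pM2r// ltr_nat.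
  apply: ge_esup => [|_ [r /= /andP[r1 _] <-]]; first by rewrite lee_fin mulr_ge0// ltW.
  by apply: loc; exact: lt_le_trans r1.
have q1 := tunnel_qdiam_le chi0 t_chi hD hA.
have t_chi' : (compact_extent (tunnel_sym t) < chi%:E)%E by rewrite tunnel_symE.
have q2 := tunnel_qdiam_le chi0 t_chi' hD hB.
rewrite /=; have [a a0 aE] := qdiam_fin A; have [b b0 bE] := qdiam_fin B.
rewrite aE bE -!EFinD !lee_fin in q1 q2.
rewrite aE bE /= lee_fin (le_trans (expRN_lipschitz a0 b0))// ler_norml.
by apply/andP; split; lra.
Qed.

End Limits.

Theorem corollary5p13 (R : realType) (A_ : nat -> qcms R) (A : qcms R)
    (propinquity_cvg : propinquity (A_ n) A @[n --> \oo] --> 0%E)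
    (mu : A -> R[i]) (mu_state : state A mu) :
  exists mu_ : forall n, A_ n -> R[i],
    [/\ forall n, state (A_ n) (mu_ n),
        ereal_sup [set local_metametric M (qcms_pointed (mu_ n))
                                          (qcms_pointed mu) |
                    M in [set M : R | 1 <= M]] @[n --> \oo] --> 0%E &
        quantum_metametric (qcms_pointed (mu_ n)) (qcms_pointed mu)
          @[n --> \oo] --> 0%E].
Proof.
(* The added 1 / (n + 1) makes chi positive and larger than the infimum defining the propinquity, so
   that a tunnel of extent below chi exists. *)
pose h n : \bar R := (4%:E * (propinquity (A_ n) A + n.+1%:R^-1%:E))%E.
have hcvg : h @ \oo --> 0%E.
  have -> : 0%E = (4%:E * (0 + 0%:E))%E :> \bar R by rewrite adde0 mule0.
  apply: cvgeZl => //; apply: cvgeD => //.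
  by apply: cvg_EFin; [exact: nearW|exact: cvg_harmonic].
have exists_mu n : exists nu : A_ n -> R[i], [/\ state (A_ n) nu,
    (ereal_sup [set local_metametric M (qcms_pointed nu) (qcms_pointed mu) |
       M in [set M : R | (1 <= M)%R]] <= h n)%E &
    (quantum_metametric (qcms_pointed nu) (qcms_pointed mu) <= h n)%E].
  have [uA hA] := qcms_one (A_ n).
  have p0 := propinquity_ge0 (A_ n) A.
  have d0 : 0 < n.+1%:R^-1 :> R by rewrite invr_gt0.
  (* Where the propinquity is infinite there may be no tunnel, but then h n is infinite and any
     state will do. *)
  have [poo|pfin] := eqVneq (propinquity (A_ n) A) +oo%E.
    have [nu snu] := unital_state hA; exists nu.
    have -> : h n = +oo%E by rewrite /h poo addye// gt0_muley// lte_fin.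
    by rewrite !leey.
  have [p pE] : exists p, propinquity (A_ n) A = p%:E.
    exists (fine (propinquity (A_ n) A)); rewrite fineK// ge0_fin_numE//.
    by rewrite ltey.
  have pge0 : 0 <= p by rewrite -lee_fin -pE.
  have chi0 : 0 < p + n.+1%:R^-1 by rewrite ltr_wpDl.
  have : (propinquity (A_ n) A < (p + n.+1%:R^-1)%:E)%E by rewrite pE lte_fin ltrDl.
  move=> /ereal_inf_lt[_ [t ->] t_chi].
  have [nu [snu loc glob]] := metametric_bound chi0 t_chi mu_state.
  have hE : h n = (4 * (p + n.+1%:R^-1))%:E by rewrite /h pE -EFinD -EFinM.
  exists nu; split=> //; rewrite hE//.
  apply: ge_ereal_sup => _ [M /= M1 <-].
  apply: (le_trans (loc M (lt_le_trans ltr01 M1))).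
  by rewrite lee_fin ler_pM2r// ler_nat.
pose mu_ n := projT1 (cid (exists_mu n)).
have muP n := projT2 (cid (exists_mu n)).
exists mu_; split.
- by move=> n; case: (muP n).
- apply: (squeeze_cvge _ (cvg_cst _) hcvg); apply: nearW => n.
  have [_ -> _] := muP n; rewrite andbT.
  apply: le_trans (local_metametric_ge0 1 (mu_ n) mu) _.
  (* The member M = 1 shows that the supremum, taken in the extended reals, is nonnegative. *)
  by apply: ereal_sup_ubound; exists 1 => //=.
- apply: (squeeze_cvge _ (cvg_cst _) hcvg); apply: nearW => n.
  by have [_ _ ->] := muP n; rewrite quantum_metametric_ge0.
Qed.
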